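(* Let $(M^7,g_M)$ be a 3-Sasakian 7-manifold and, for each $\epsilon\in\{+1,-1\}$, let $\mathcal{F}_\epsilon$ be the 3-parameter family of coclosed $\mathrm{G}_2$-structures on $M$ defined in the context. For each $\epsilon\in\{\pm1\}$, the Laplacian coflow starting at any initial coclosed $\mathrm{G}_2$-structure in $\mathcal{F}_\epsilon$ converges, after rescaling, to the nearly parallel $\mathrm{G}_2$-structure in $\mathcal{F}_\epsilon$ (which is unique up to scale: $\varphi^{np}$ if $\epsilon=1$, $\varphi^{ts}$ if $\epsilon=-1$). In particular, the nearly parallel $\mathrm{G}_2$-structures $\varphi^{np}$ and $\varphi^{ts}$ are both stable within their families.
   Context: 3-Sasakian setting. A complete Riemannian 7-manifold $(M^7,g_M)$ is 3-Sasakian if it has an orthonormal triple of Killing fields $E_1,E_2,E_3$ with $[E_i,E_j]=2E_k$ for cyclic permutations $(i,j,k)$ of $(1,2,3)$, each $E_i$ defining a Sasakian structure. Then there is a locally free $\mathrm{SU}(2)$-action on $M$ with leaf space a 4-dimensional orbifold $N$ carrying an anti-self-dual Einstein metric $g_N$ of scalar curvature 48, and an orbifold Riemannian submersion $\pi:M\to N$. Let $\eta_1,\eta_2,\eta_3$ be the 1-forms dual to $E_1,E_2,E_3$, so $g_M=\eta_1^2+\eta_2^2+\eta_3^2+\pi^*g_N$. There are 2-forms $\omega_1,\omega_2,\omega_3$ on $M$, pullbacks of orthogonal self-dual 2-forms on $N$, with $\omega_i\wedge\omega_j=2\delta_{ij}\pi^*\mathrm{vol}_N$, $d\eta_i=-2\eta_j\wedge\eta_k-2\omega_i$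 and $d\omega_i=-2\eta_j\wedge\omega_k+2\eta_k\wedge\omega_j$ for cyclic $(i,j,k)$. Families. For $\epsilon\in\{\pm1\}$, $\mathcal{F}_\epsilon$ consists of the $\mathrm{G}_2$-structures given, for constants $a,b,c>0$, by the 3-form $$\varphi_\epsilon=\epsilon a^2b\,\eta_1\wedge\eta_2\wedge\eta_3-ac^2(\eta_1\wedge\omega_1+\eta_2\wedge\omega_2)-\epsilon bc^2\,\eta_3\wedge\omega_3,$$ with induced metric $a^2(\eta_1^2+\eta_2^2)+b^2\eta_3^2+c^2\pi^*g_N$, volume form $\epsilon a^2bc^4\eta_1\wedge\eta_2\wedge\eta_3\wedge\pi^*\mathrm{vol}_N$ and dual 4-form $$\psi_\epsilon=c^4\pi^*\mathrm{vol}_N-\epsilon abc^2(\eta_2\wedge\eta_3\wedge\omega_1+\eta_3\wedge\eta_1\wedge\omega_2)-a^2c^2\,\eta_1\wedge\eta_2\wedge\omega_3,$$ which is closed (i.e. the $\mathrm{G}_2$-structure is coclosed). A $\mathrm{G}_2$-structure $\varphi$ with dual $\psi$ is nearly parallel if $d\varphi=\lambda\psi$ for a non-zero constant $\lambda$. $\varphi^{np}$ denotes the element of $\mathcal{F}_{+1}$ with $a=b=1/\sqrt5$, $c=1$; $\varphi^{ts}$ denotes the element of $\mathcal{F}_{-1}$ with $a=b=c=1$; both are nearly parallel. Flow. The Laplacian coflow is $\frac{\partial}{\partial t}\psi=\Delta_\psi\psi=dd^*_\psi\psi$, where $\Delta_\psi$ is the Hodge Laplacian of the metric induced by $\psi$.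 It preserves each $\mathcal{F}_\epsilon$, and the coflow starting in $\mathcal{F}_\epsilon$ means the solution $\psi_\epsilon(t)$ given by positive functions $a(t),b(t),c(t)$. The rescaled flow is the evolution of the scale-invariant quantities $X=a^2/c^2$, $Y=ab/c^2$ as functions of $s$, where $\frac{ds}{dt}=\frac1{c^2}$. Convergence after rescaling to an element of $\mathcal{F}_\epsilon$ means that the rescaled flow exists for all $s\ge 0$ and $(X(s),Y(s))$ converges as $s\to\infty$ to the value of $(X,Y)$ at that element; equivalently $c^{-4}\psi_\epsilon$ converges to the dual 4-form of the element with that value of $(X,Y)$ and $c=1$. A critical point of the rescaled flow is stable (dynamically) if the rescaled flow starting sufficiently near it flows back (converges) to it. *)

(* Defs.v *)
From HB Require Import structures.
From mathcomp Require Import all_boot all_order all_algebra.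
From mathcomp Require Import all_classical all_reals all_analysis.

Set Implicit Arguments.
Unset Strict Implicit.
Unset Printing Implicit Defensive.

Import Order.TTheory GRing.Theory Num.Theory.
Import numFieldNormedType.Exports.

Local Open Scope classical_set_scope.
Local Open Scope ring_scope.

(* Tensor fields on a manifold are families of coordinate expressions, one for
   each chart, related by the usual transformation laws; d, the Hodge star, the
   Levi-Civita connection, and so on are given by their coordinate formulas,
   which are natural and therefore commute with the transformation laws. *)

Section ExteriorAlgebra.
Context {R : realType} {n : nat}.

(* An exterior form on R^n: [alpha I] is the coefficient of
   dx^{i_1} /\ ... /\ dx^{i_k}, where I = {i_1 < ... < i_k}. *)
Definition ext : Type := {ffun {set 'I_n} -> R^o}.

Definition homogeneous (k : nat) (alpha : ext) : Prop :=
  forall I : {set 'I_n}, #|I| != k -> alpha I = 0.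

(* dx^I /\ dx^J = ext_sign I J dx^(I :|: J) for disjoint I and J *)
Definition ext_sign (I J : {set 'I_n}) : R :=
  (-1) ^+ #|[set ij : 'I_n * 'I_n |
              [&& ij.1 \in I, ij.2 \in J & (ij.2 < ij.1)%N]]%SET|.

Definition wedge (alpha beta : ext) : ext :=
  [ffun K : {set 'I_n} => \sum_(I : {set 'I_n} | I \subset K)
     ext_sign I (K :\: I) * (alpha I * beta (K :\: I))].

Definition ext1 : ext := [ffun I : {set 'I_n} => (I == finset.set0)%:R].

Definition covec (v : 'rV[R]_n) : ext :=
  [ffun I : {set 'I_n} => \sum_(i < n) v 0 i * (I == [set i]%SET)%:R].

(* interior product of v with alpha *)
Definition interior_product (v : 'rV[R]_n) (alpha : ext) : ext :=
  [ffun I : {set 'I_n} => \sum_(i < n | i \notin I)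
     v 0 i * (ext_sign [set i]%SET I * alpha (i |: I)%SET)].

(* The homomorphism of exterior algebras sending dx^i to
   \sum_j A i j dx^j; the product is taken in increasing order of i. *)
Definition ext_map (A : 'M[R]_n) (alpha : ext) : ext :=
  \sum_(I : {set 'I_n})
     alpha I *: \big[wedge/ext1]_(i <- enum I) covec (row i A).

(* Hodge star of the inner product with Gram matrix g and Riemannian volume
   form vol: alpha /\ star beta = <alpha, beta> vol.  The coefficient of
   star beta on dx^J is read off by taking alpha = dx^(~: J), since
   <dx^K, beta> = (ext_map g^-1 beta) K. *)
Definition star (g : 'M[R]_n) (vol beta : ext) : ext :=
  [ffun J : {set 'I_n} => ext_sign (~: J)%SET J *
     (vol [set: 'I_n]%SET * ext_map (invmx g) beta (~: J)%SET)].

End ExteriorAlgebra.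

Arguments ext : clear implicits.

Notation "a /^\ b" := (wedge a b) (at level 40, left associativity) : ring_scope.

Section Calculus.
Context {R : realType} {n : nat}.

Definition partial (i : 'I_n) (f : 'rV[R]_n -> R^o) (x : 'rV[R]_n) : R^o :=
  'D_('e_i) f x.

Fixpoint is_Ck (k : nat) (U : set 'rV[R]_n) (f : 'rV[R]_n -> R^o) : Prop :=
  (forall x, U x -> {for x, continuous f}) /\
  if k is k'.+1 then
    forall i, (forall x, U x -> derivable f x 'e_i) /\ is_Ck k' U (partial i f)
  else True.

Definition smooth_on (U : set 'rV[R]_n) (f : 'rV[R]_n -> R^o) : Prop :=
  forall k, is_Ck k U f.

(* exterior derivative: d alpha = \sum_i dx^i /\ (partial_i alpha) *)
Definition ext_d (alpha : 'rV[R]_n -> ext R n) (x : 'rV[R]_n) : ext R n :=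
  \sum_(i < n) covec 'e_i /^\
     [ffun I : {set 'I_n} => partial i (fun y => alpha y I) x].

Definition hodge (g : 'rV[R]_n -> 'M[R]_n) (vol alpha : 'rV[R]_n -> ext R n)
    (x : 'rV[R]_n) : ext R n :=
  star (g x) (vol x) (alpha x).

(* d^* on k-forms *)
Definition codiff (g : 'rV[R]_n -> 'M[R]_n) (vol : 'rV[R]_n -> ext R n)
    (k : nat) (alpha : 'rV[R]_n -> ext R n) (x : 'rV[R]_n) : ext R n :=
  (-1) ^+ (n * k.+1).+1 *: hodge g vol (ext_d (hodge g vol alpha)) x.

(* Hodge Laplacian on k-forms, k > 0 *)
Definition hodge_laplacian (g : 'rV[R]_n -> 'M[R]_n)
    (vol : 'rV[R]_n -> ext R n) (k : nat) (alpha : 'rV[R]_n -> ext R n)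
    (x : 'rV[R]_n) : ext R n :=
  ext_d (codiff g vol k alpha) x + codiff g vol k.+1 (ext_d alpha) x.

Definition lie_bracket (X Y : 'rV[R]_n -> 'rV[R]_n) (x : 'rV[R]_n) : 'rV[R]_n :=
  \row_a \sum_(b < n) (X x 0 b * partial b (fun y => Y y 0 a) x
                       - Y x 0 b * partial b (fun y => X y 0 a) x).

(* the matrix of the Lie derivative L_X g *)
Definition lie_metric (X : 'rV[R]_n -> 'rV[R]_n) (g : 'rV[R]_n -> 'M[R]_n)
    (x : 'rV[R]_n) : 'M[R]_n :=
  \matrix_(a, b) \sum_(c < n)
    (X x 0 c * partial c (fun y => g y a b) x
     + g x c b * partial a (fun y => X y 0 c) x
     + g x a c * partial b (fun y => X y 0 c) x).

(* Gamma^c_{ab} of the Levi-Civita connection *)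
Definition christoffel (g : 'rV[R]_n -> 'M[R]_n) (x : 'rV[R]_n)
    (c a b : 'I_n) : R :=
  2^-1 * \sum_(d < n) invmx (g x) c d *
    (partial a (fun y => g y d b) x + partial b (fun y => g y d a) x
     - partial d (fun y => g y a b) x).

(* [nabla g X x a c] is the component of d_c in nabla_{d_a} X *)
Definition nabla (g : 'rV[R]_n -> 'M[R]_n) (X : 'rV[R]_n -> 'rV[R]_n)
    (x : 'rV[R]_n) : 'M[R]_n :=
  \matrix_(a, c) (partial a (fun y => X y 0 c) x
                  + \sum_(b < n) christoffel g x c a b * X x 0 b).

(* [nabla_endo g T x b a c] is the component of d_c in (nabla_{d_b} T)(d_a),
   where T is the field of endomorphisms T(d_a) = \sum_c (T a c) d_c *)
Definition nabla_endo (g T : 'rV[R]_n -> 'M[R]_n) (x : 'rV[R]_n)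
    (b a c : 'I_n) : R :=
  partial b (fun y => T y a c) x
  + \sum_(d < n) (christoffel g x c b d * T x a d
                  - christoffel g x d b a * T x d c).

End Calculus.

Section Manifolds.
Context {R : realType} {n : nat}.

Record manifold := Manifold {
  pt :> topologicalType ;
  mfd_nonempty : [set: pt] !=set0 ;
  mfd_hausdorff : hausdorff_space pt ;
  mfd_countable : @second_countable pt ;
  chart : Type ;
  dom : chart -> set pt ;
  chart_map : chart -> pt -> 'rV[R]_n ;
  chart_inv : chart -> 'rV[R]_n -> pt ;
  dom_open : forall i, open (dom i) ;
  img_open : forall i, open (chart_map i @` dom i) ;
  chart_mapK : forall i p, dom i p -> chart_inv i (chart_map i p) = p ;
  chart_map_continuous : forall i p, dom i p -> {for p, continuous (chart_map i)} ;
  chart_inv_continuous : forall i p, dom i p ->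
    {for chart_map i p, continuous (chart_inv i)} ;
  dom_cover : forall p, exists i, dom i p ;
  transition_smooth : forall i j c,
    smooth_on (chart_map i @` (dom i `&` dom j))
              (fun x => chart_map j (chart_inv i x) 0 c)
}.

Variable M : manifold.

Definition img (i : chart M) : set 'rV[R]_n := chart_map i @` dom i.

Definition overlap (i j : chart M) : set 'rV[R]_n :=
  chart_map i @` (dom i `&` dom j).

Definition transition (i j : chart M) (x : 'rV[R]_n) : 'rV[R]_n :=
  chart_map j (chart_inv i x).

(* Jacobian matrix of the change of coordinates: the entry (a, b) is
   d(y^a)/d(x^b) *)
Definition jac (i j : chart M) (x : 'rV[R]_n) : 'M[R]_n :=
  \matrix_(a, b) partial b (fun y => transition i j y 0 a) x.

(* values outside [img i] are irrelevant *)
Definition vfield : Type := chart M -> 'rV[R]_n -> 'rV[R]_n.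
Definition mfield : Type := chart M -> 'rV[R]_n -> 'M[R]_n.
Definition efield : Type := chart M -> 'rV[R]_n -> ext R n.

Definition is_vector_field (X : vfield) : Prop :=
  (forall i a, smooth_on (img i) (fun x => X i x 0 a)) /\
  (forall i j x, overlap i j x ->
     X j (transition i j x) = X i x *m (jac i j x)^T).

Definition is_metric (g : mfield) : Prop :=
  [/\ forall i a b, smooth_on (img i) (fun x => g i x a b),
      forall i x, img i x -> (g i x)^T = g i x,
      forall i x (v : 'rV[R]_n), img i x -> v != 0 ->
        0 < (v *m g i x *m v^T) 0 0 &
      forall i j x, overlap i j x ->
        g i x = (jac i j x)^T *m g j (transition i j x) *m jac i j x].

Definition is_form (k : nat) (alpha : efield) : Prop :=
  [/\ forall i x, img i x -> homogeneous k (alpha i x),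
      forall i I, smooth_on (img i) (fun x => alpha i x I) &
      forall i j x, overlap i j x ->
        alpha i x = ext_map (jac i j x) (alpha j (transition i j x))].

Definition is_geodesic (g : mfield) (gamma : R -> M) : Prop :=
  continuous gamma /\
  forall i t, dom i (gamma t) ->
    let u c : R -> R^o := fun s => chart_map i (gamma s) 0 c in
    forall c, derivable (u c) t 1 /\
      is_derive t 1 (derive1 (u c))
        (- \sum_(a < n) \sum_(b < n)
             christoffel (g i) (chart_map i (gamma t)) c a b
             * derive1 (u a) t * derive1 (u b) t).

(* geodesic completeness *)
Definition complete_metric (g : mfield) : Prop :=
  forall i x (v : 'rV[R]_n), img i x ->
    exists gamma : R -> M, [/\ is_geodesic g gamma, gamma 0 = chart_inv i x &
      forall c, derive1 (fun s => chart_map i (gamma s) 0 c : R^o) 0 = v 0 c].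

(* the 1-form g(X, -) *)
Definition dual_form (g : mfield) (X : vfield) : efield :=
  fun i x => covec (X i x *m g i x).

Definition is_killing (g : mfield) (X : vfield) : Prop :=
  is_vector_field X /\ forall i x, img i x -> lie_metric (X i) (g i) x = 0.

(* The unit Killing field X defines a Sasakian structure: Phi = nabla X
   satisfies (nabla_Y Phi)(Z) = g(X, Z) Y - g(Y, Z) X. *)
Definition is_sasakian (g : mfield) (X : vfield) : Prop :=
  [/\ is_killing g X,
      forall i x, img i x -> (X i x *m g i x *m (X i x)^T) 0 0 = 1 &
      forall i x (b a c : 'I_n), img i x ->
        nabla_endo (g i) (nabla (g i) (X i)) x b a c
        = (X i x *m g i x) 0 a * (c == b)%:R - g i x b a * X i x 0 c].

(* Indices in 'I_3 are added modulo 3, so (i, i + 1, i + 2) runs over the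
   cyclic permutations of (1, 2, 3). *)
Definition is_three_sasakian (g : mfield) (E : 'I_3 -> vfield) : Prop :=
  [/\ is_metric g, complete_metric g,
      forall i, is_sasakian g (E i),
      forall i j k x, img k x ->
        (E i k x *m g k x *m (E j k x)^T) 0 0 = (i == j)%:R &
      forall i k x, img k x ->
        lie_bracket (E i k) (E (i + 1) k) x = 2 *: E (i + 2) k x].

End Manifolds.

Arguments manifold : clear implicits.
Arguments vfield {R n} M.
Arguments mfield {R n} M.
Arguments efield {R n} M.

Section Families.
Context {R : realType} {M : manifold R 7}.
Variables (g : mfield M) (E : 'I_3 -> vfield M).
Variables (omega : 'I_3 -> efield M) (nu : efield M).

(* In this section i is an index in {0, 1, 2} and k is a chart. *)

Definition eta (i : 'I_3) : efield M := dual_form g (E i).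

(* indices for (1, 2, 3) *)
Definition i1 : 'I_3 := 0.
Definition i2 : 'I_3 := 1.
Definition i3 : 'I_3 := 2.

Definition eta123 : efield M :=
  fun k x => eta i1 k x /^\ eta i2 k x /^\ eta i3 k x.

(* The 2-forms omega_i and the 4-form nu = pi^* vol_N of a 3-Sasakian
   7-manifold.  Tensors pulled back from the leaf space N are horizontal, and
   pi^* g_N = g - \sum_i eta_i^2.  So the horizontal form nu is the pullback of
   the volume form of an orientation of N exactly when eta_123 /\ nu is a
   Riemannian volume form of g; and since star omega = eta_123 /\ star_N omega
   for horizontal 2-forms omega, the equation for star omega_i says that
   omega_i is self-dual for g_N. *)
Definition is_transverse_data : Prop :=
  [/\ is_form 4 nu /\ (forall i, is_form 2 (omega i)),
      forall i k x, img k x -> interior_product (E i k x) (nu k x) = 0 /\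
        (forall j, interior_product (E i k x) (omega j k x) = 0),
      forall k x, img k x ->
        ((eta123 k x /^\ nu k x) [set: 'I_7]%SET) ^+ 2 = \det (g k x) /\
        (forall i, star (g k x) (eta123 k x /^\ nu k x) (omega i k x)
                   = eta123 k x /^\ omega i k x),
      forall i j k x, img k x ->
        omega i k x /^\ omega j k x = (2 * (i == j)%:R) *: nu k x &
      forall i k x, img k x ->
        let e j := eta j k x in let w j := omega j k x in
        ext_d (eta i k) x
          = - 2 *: (e (i + 1) /^\ e (i + 2)) - 2 *: w i /\
        ext_d (omega i k) x
          = - 2 *: (e (i + 1) /^\ w (i + 2)) + 2 *: (e (i + 2) /^\ w (i + 1))].

(* An element of F_eps is given by its three scale parameters. *)
Record scales := Scales { sa : R ; sb : R ; sc : R }.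

Definition positive_scales (p : scales) : Prop :=
  [/\ 0 < sa p, 0 < sb p & 0 < sc p].

Definition phi (eps : R) (p : scales) : efield M := fun k x =>
  let: Scales a b c := p in
  let e i := eta i k x in let w i := omega i k x in
  (eps * a ^+ 2 * b) *: (e i1 /^\ e i2 /^\ e i3)
  - (a * c ^+ 2) *: (e i1 /^\ w i1 + e i2 /^\ w i2)
  - (eps * b * c ^+ 2) *: (e i3 /^\ w i3).

Definition eta_mx (i : 'I_3) (k : chart M) (x : 'rV[R]_7) : 'M[R]_7 :=
  let e := E i k x *m g k x in e^T *m e.

(* the metric induced by phi eps p: a^2(eta_1^2+eta_2^2)+b^2 eta_3^2+c^2 pi^*g_N *)
Definition metric (p : scales) : mfield M := fun k x =>
  let: Scales a b c := p in
  a ^+ 2 *: (eta_mx i1 k x + eta_mx i2 k x) + b ^+ 2 *: eta_mx i3 k x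
  + c ^+ 2 *: (g k x - \sum_(i < 3) eta_mx i k x).

(* the volume form of phi eps p *)
Definition volume (eps : R) (p : scales) : efield M := fun k x =>
  let: Scales a b c := p in
  (eps * a ^+ 2 * b * c ^+ 4) *: (eta123 k x /^\ nu k x).

(* the dual 4-form of phi eps p *)
Definition psi (eps : R) (p : scales) : efield M := fun k x =>
  let: Scales a b c := p in
  let e i := eta i k x in let w i := omega i k x in
  c ^+ 4 *: nu k x
  - (eps * a * b * c ^+ 2) *:
      (e i2 /^\ e i3 /^\ w i1 + e i3 /^\ e i1 /^\ w i2)
  - (a ^+ 2 * c ^+ 2) *: (e i1 /^\ e i2 /^\ w i3).

Definition nearly_parallel (eps : R) (p : scales) : Prop :=
  exists2 lambda : R, lambda != 0 &
    forall k x, img k x ->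
      ext_d (phi eps p k) x = lambda *: psi eps p k x.

Definition np : scales := Scales (Num.sqrt 5)^-1 (Num.sqrt 5)^-1 1.
Definition ts : scales := Scales 1 1 1.

(* Delta_psi psi for psi = psi eps p *)
Definition laplacian_psi (eps : R) (p : scales) : efield M := fun k x =>
  hodge_laplacian (metric p k) (volume eps p k) 4 (psi eps p k) x.

Definition time (T : \bar R) : set R := [set t | 0 <= t /\ (t%:E < T)%E].

(* f has derivative l at t as a function on D (one-sided at an end point of
   D) *)
Definition has_deriv_in (D : set R) (f : R -> R) (t l : R) : Prop :=
  (fun u => (f u - f t) / (u - t)) @ within D (t^') --> l.

(* p is a solution on [0, T) of the Laplacian coflow d psi/dt = Delta_psi psi
   in F_eps *)
Definition coflow (eps : R) (T : \bar R) (p : R -> scales) : Prop :=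
  (0 < T)%E /\
  forall t, time T t -> positive_scales (p t) /\
    forall k x I, img k x ->
      has_deriv_in (time T) (fun u => psi eps (p u) k x I) t
                   (laplacian_psi eps (p t) k x I).

(* p, on [0, T), is the maximal solution of the coflow starting at p0, and
   every other solution starting at p0 is a restriction of it *)
Definition maximal_coflow (eps : R) (p0 : scales) (T : \bar R)
    (p : R -> scales) : Prop :=
  [/\ coflow eps T p, p 0 = p0 &
      forall T' p', coflow eps T' p' -> p' 0 = p0 ->
        (T' <= T)%E /\ forall t, time T' t -> p' t = p t].

(* (X, Y) = (a^2 / c^2, a b / c^2) *)
Definition ratios (p : scales) : R * R :=
  (sa p ^+ 2 / sc p ^+ 2, sa p * sb p / sc p ^+ 2).

(* The rescaled flow starting at p0 exists for all s >= 0, and is Z = (X, Y)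
   as a function of s, where ds/dt = c^-2 (values of Z at s < 0 are
   irrelevant). *)
Definition rescaled_flow (eps : R) (p0 : scales) (Z : R -> R * R) : Prop :=
  exists (T : \bar R) (p : R -> scales) (s : R -> R),
    [/\ maximal_coflow eps p0 T p, s 0 = 0,
        forall t, time T t -> has_deriv_in (time T) s t (sc (p t) ^+ 2)^-1,
        forall r : R, 0 <= r -> exists2 t, time T t & s t = r &
        forall t, time T t -> Z (s t) = ratios (p t)].

Definition converges_after_rescaling (eps : R) (p0 q : scales) : Prop :=
  exists2 Z : R -> R * R, rescaled_flow eps p0 Z &
    Z s @[s --> +oo] --> ratios q.

Definition critical_point (eps : R) (q : scales) : Prop :=
  rescaled_flow eps q (fun=> ratios q).

Definition dynamically_stable (eps : R) (q : scales) : Prop :=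
  critical_point eps q /\
  \forall z \near ratios q, forall p0, positive_scales p0 -> ratios p0 = z ->
    converges_after_rescaling eps p0 q.

End Families.

Arguments scales : clear implicits.
Arguments np {R}.
Arguments ts {R}.

(* Main.v *)
Require Import Defs.
From HB Require Import structures.
From mathcomp Require Import all_boot all_order all_algebra.
From mathcomp Require Import all_classical all_reals all_analysis.
From mathcomp Require Import ring lra.
Set Implicit Arguments.
Unset Strict Implicit.
Unset Printing Implicit Defensive.
Import Order.TTheory GRing.Theory Num.Theory.
Import numFieldNormedType.Exports.
Local Open Scope classical_set_scope.
Local Open Scope ring_scope.

(** Two ratios carry the whole problem: [X = a^2 / c^2] and the signed ratio
    [r = eps * b / a].

    Geometry.  The structure equations make the spans of
    e123, [e_i /\ w_i] and of nu, [e_j /\ e_k /\ w_i] into a model of the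
    differential forms involved: [d] and the Hodge stars of the metrics in the
    families are given by small explicit matrices ([d_comb3], [star_comb4]).
    Only [star omega_i] is known at the start; the stars of nu, of the mixed
    forms, and for the rescaled metrics follow because the star turns wedging
    with [v^flat] into contraction with [v] ([star_wedge_flat], [star_nu],
    [star_rescaled_mixed]).  As psi is closed, its Laplacian is
    [d star d star psi = d star (d phi)], which is computed in
    [laplacian_comb4]; comparing coefficients in [d phi = lambda psi] gives
    [a = b] and [c^2 = (3 + 2 eps) a^2], so the nearly parallel structures are
    the multiples of a single one ([nearly_parallel_scales]).

    Dynamics.  In the time s with [ds/dt = c^-2], X and r satisfy a planar
    autonomous system [flow_X], [flow_r] that no longer contains eps: the two
    families are the quadrants r > 0 and r < 0.  Each quadrant contains one zero
    of the field, (1/5, 1) and (1, -1), and in each a Lyapunov function is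
    available.  For r < 0, the function [(1 + X)^2 (1 - r)^2 / (- X r)] is proper
    and decreases strictly away from its minimum ([orbit_neg]).  For r > 0,
    barriers bound X and r from above and X away from 0, the function
    [lyap_pos] keeps r away from 0 and forces r to tend to 1, and then
    [X' = 4 - 20 X + O(r - 1)] forces X to tend to 1/5 ([orbit_pos]).  Confined
    orbits exist for all times by Picard iteration ([picard],
    [global_solution]).

    Back to the coflow.  Along an orbit [c^2] solves a linear equation and the
    original time is a primitive of [c^2], so the orbit yields a coflow
    ([rescaled_flow_of_orbit]).  It is defined for all t, since [c^2] is
    eventually nondecreasing, and it is maximal because in the coordinates
    [c^2], X, r the coflow is a locally Lipschitz system, whose solutions are
    unique ([coflow_unique]).  Convergence from every initial structure contains
    stability: the limit itself is a constant orbit. *)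

(** * Exterior algebra in coordinates *)

Section Exterior.
Import mathcomp.boot.finset.
Context {R : realType} {n : nat}.
Local Open Scope set_scope.
Local Open Scope bool_scope.
Local Open Scope ring_scope.
Implicit Types (I J K : {set 'I_n}) (i j : 'I_n) (v h : 'rV[R]_n).
Implicit Types (alpha beta gamma : ext R n).
Local Notation set0 := set0.

Definition dx I : ext R n := [ffun J : {set 'I_n} => (J == I)%:R].

Lemma ext_basis alpha : alpha = \sum_I alpha I *: dx I.
Proof.
apply/ffunP => J; rewrite sum_ffunE (bigD1 J) //= !ffunE eqxx.
rewrite big1 ?addr0; first by rewrite /GRing.scale /= mulr1.
by move=> I IJ; rewrite !ffunE eq_sym (negPf IJ) scaler0.
Qed.

(** Identities that are linear in each form need to be checked on the basis
    forms only. *)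
Lemma ext_ind (P : ext R n -> Prop) :
  P 0 -> (forall a alpha beta, P alpha -> P beta -> P (a *: alpha + beta)) ->
  (forall I, P (dx I)) -> forall alpha, P alpha.
Proof.
move=> P0 PL Pdx alpha; rewrite (ext_basis alpha).
by elim/big_rec: _ => // I beta _ Pb; apply: PL.
Qed.

Lemma homogeneous_ind k (P : ext R n -> Prop) :
  P 0 -> (forall a alpha beta, P alpha -> P beta -> P (a *: alpha + beta)) ->
  (forall I, #|I| = k -> P (dx I)) -> forall alpha, homogeneous k alpha -> P alpha.
Proof.
move=> P0 PL Pdx alpha hk; rewrite (ext_basis alpha).
elim/big_rec: _ => // I beta _ Pb; case: (eqVneq #|I| k) => [Ik|/hk ->].
  by apply: PL => //; apply: Pdx.
by rewrite scale0r add0r.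
Qed.

(** The sign [ext_sign I J] is the product of these over the pairs in I x J, so
    it is bimultiplicative for disjoint unions.  That is all that associativity
    and graded commutativity of the wedge product need. *)
Definition sgn i j : R := if (j < i)%N then -1 else 1.

Lemma sgnxx i : sgn i i = 1. Proof. by rewrite /sgn ltnn. Qed.

Lemma sgn_sq i j : sgn i j * sgn i j = 1.
Proof. by rewrite /sgn; case: ifP; rewrite ?mulrNN mulr1. Qed.

Lemma sgnC i j : i != j -> sgn i j = - sgn j i.
Proof.
rewrite /sgn neq_ltn => /orP[] h; rewrite h ltnNge (ltnW h) /= ?opprK //.
Qed.

Lemma ext_signE I J : ext_sign I J = \prod_(i in I) \prod_(j in J) sgn i j.
Proof.
rewrite /ext_sign pair_big /= -prodr_const big_mkcond [RHS]big_mkcond /=.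
apply: eq_bigr => -[i j] _; rewrite !inE /= /sgn.
by case: (i \in I); case: (j \in J) => //=.
Qed.

Lemma ext_sign0l J : ext_sign set0 J = 1 :> R.
Proof. by rewrite ext_signE big_set0. Qed.

Lemma ext_sign0r I : ext_sign I set0 = 1 :> R.
Proof. by rewrite ext_signE big1 // => i _; rewrite big_set0. Qed.

Lemma prod_setU I J (F : 'I_n -> R) : [disjoint I & J] ->
  \prod_(i in I :|: J) F i = \prod_(i in I) F i * \prod_(i in J) F i.
Proof.
move=> d; rewrite (big_setID I) setUK.
congr (_ * _); apply: eq_bigl => i; rewrite !inE.
by case: (boolP (i \in I)) => //= /(disjointFr d) ->.
Qed.

Lemma ext_signUl I J K : [disjoint I & J] ->
  ext_sign (I :|: J) K = ext_sign I K * ext_sign J K :> R.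
Proof. by move=> d; rewrite !ext_signE prod_setU. Qed.

Lemma ext_signUr I J K : [disjoint J & K] ->
  ext_sign I (J :|: K) = ext_sign I J * ext_sign I K :> R.
Proof.
move=> d; rewrite !ext_signE -big_split /=; apply: eq_bigr => i _.
by rewrite prod_setU.
Qed.

Lemma ext_sign11 i j : ext_sign [set i] [set j] = sgn i j.
Proof. by rewrite ext_signE !big_set1. Qed.

Lemma ext_sign_sq I J : ext_sign I J * ext_sign I J = 1 :> R.
Proof.
rewrite !ext_signE -big_split /= big1 // => i _.
by rewrite -big_split /= big1 // => j _; rewrite sgn_sq.
Qed.

Lemma ext_signC I J : [disjoint I & J] ->
  ext_sign I J = (-1) ^+ (#|I| * #|J|) * ext_sign J I :> R.
Proof.
move=> d; rewrite !ext_signE [X in _ = _ * X]exchange_big /= mulnC exprM.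
rewrite -[((-1) ^+ _) ^+ _]prodr_const -big_split /=; apply: eq_bigr => i iI.
rewrite -prodr_const -big_split /=; apply: eq_bigr => j jJ.
rewrite mulN1r -sgnC //; apply: contraTneq jJ => <-.
by rewrite (disjointFr d iI).
Qed.

Lemma ext_signD1 i J : ext_sign [set i] (J :\ i) = ext_sign [set i] J :> R.
Proof.
case: (boolP (i \in J)) => iJ; last first.
  by congr ext_sign; apply/setDidPl; rewrite disjoint_sym disjoints1.
rewrite -[in RHS](setD1K iJ) ext_signUr ?ext_sign11 ?sgnxx ?mul1r //.
by rewrite disjoints1 !inE eqxx.
Qed.

Lemma wedgeDl alpha beta gamma :
  (alpha + beta) /^\ gamma = alpha /^\ gamma + beta /^\ gamma.
Proof.
apply/ffunP => K; rewrite !ffunE -big_split; apply: eq_bigr => I _ /=.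
by rewrite !ffunE mulrDl mulrDr.
Qed.

Lemma wedgeDr alpha beta gamma :
  gamma /^\ (alpha + beta) = gamma /^\ alpha + gamma /^\ beta.
Proof.
apply/ffunP => K; rewrite !ffunE -big_split; apply: eq_bigr => I _ /=.
by rewrite !ffunE mulrDr mulrDr.
Qed.

Lemma wedgeZl (a : R) alpha beta : (a *: alpha) /^\ beta = a *: (alpha /^\ beta).
Proof.
apply/ffunP => K; rewrite !ffunE scaler_sumr; apply: eq_bigr => I _ /=.
rewrite !ffunE /GRing.scale /=; ring.
Qed.

Lemma wedgeZr (a : R) alpha beta : alpha /^\ (a *: beta) = a *: (alpha /^\ beta).
Proof.
apply/ffunP => K; rewrite !ffunE scaler_sumr; apply: eq_bigr => I _ /=.
rewrite !ffunE /GRing.scale /=; ring.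
Qed.

Lemma wedge0l alpha : 0 /^\ alpha = 0.
Proof. by rewrite -[X in X /^\ _](scale0r (0 : ext R n)) wedgeZl scale0r. Qed.

Lemma wedge0r alpha : alpha /^\ 0 = 0.
Proof. by rewrite -[X in _ /^\ X](scale0r (0 : ext R n)) wedgeZr scale0r. Qed.

Lemma wedgeNl alpha beta : (- alpha) /^\ beta = - (alpha /^\ beta).
Proof. by rewrite -scaleN1r wedgeZl scaleN1r. Qed.

Lemma wedgeNr alpha beta : alpha /^\ (- beta) = - (alpha /^\ beta).
Proof. by rewrite -scaleN1r wedgeZr scaleN1r. Qed.

Lemma wedgeBl alpha beta gamma :
  (alpha - beta) /^\ gamma = alpha /^\ gamma - beta /^\ gamma.
Proof. by rewrite wedgeDl wedgeNl. Qed.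

Lemma wedgeBr alpha beta gamma :
  gamma /^\ (alpha - beta) = gamma /^\ alpha - gamma /^\ beta.
Proof. by rewrite wedgeDr wedgeNr. Qed.

Lemma wedge_suml T (r : seq T) (P : pred T) (F : T -> ext R n) beta :
  (\sum_(t <- r | P t) F t) /^\ beta = \sum_(t <- r | P t) F t /^\ beta.
Proof.
apply: (big_morph (fun alpha => alpha /^\ beta)); last exact: wedge0l.
by move=> a b; rewrite wedgeDl.
Qed.

Lemma wedge_sumr T (r : seq T) (P : pred T) (F : T -> ext R n) beta :
  beta /^\ (\sum_(t <- r | P t) F t) = \sum_(t <- r | P t) beta /^\ F t.
Proof.
apply: (big_morph (fun alpha => beta /^\ alpha)); last exact: wedge0r.
by move=> a b; rewrite wedgeDr.
Qed.

Lemma wedge_dx I J :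
  dx I /^\ dx J = if [disjoint I & J] then (ext_sign I J : R) *: dx (I :|: J) else 0.
Proof.
apply/ffunP => K; rewrite !ffunE.
case: (boolP (I \subset K)) => IK; last first.
  rewrite big1 => [|L LK].
    case: ifP => d; rewrite !ffunE //.
    case: eqP IK => [->|_ _]; last by rewrite scaler0.
    by rewrite subsetUl.
  rewrite !ffunE; case: eqP LK => [->|_ _]; first by rewrite (negPf IK).
  by rewrite mul0r mulr0.
rewrite (bigD1 I) //= big1 ?addr0 => [|L /andP[_ LI]]; last first.
  by rewrite !ffunE (negPf LI) mul0r mulr0.
rewrite !ffunE eqxx mul1r.
case: ifP => d.
  rewrite !ffunE /GRing.scale /=; case: eqP => [KJ|KJ]; case: eqP => [KIJ|KIJ] //.
  - by rewrite KJ.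
  - case: KIJ; apply/setP => x; rewrite -KJ !inE.
    by have := fintype.subsetP IK x; case: (x \in I) => //= ->.
  - case: KJ; apply/setP => x; rewrite KIJ !inE.
    have := disjointFr d (x := x); case: (x \in I) => //= ->; rewrite //.
  - by rewrite !mulr0.
rewrite !ffunE; case: eqP => [KJ|]; last by rewrite mulr0.
case/negP: d; rewrite -KJ -setI_eq0; apply/eqP/setP => x; rewrite !inE.
by case: (x \in I).
Qed.

Lemma ext1E : ext1 = dx set0. Proof. by []. Qed.

Lemma wedge1l alpha : ext1 /^\ alpha = alpha.
Proof.
elim/ext_ind: alpha => [|a alpha beta Pa Pb|I]; first by rewrite wedge0r.
  by rewrite wedgeDr wedgeZr Pa Pb.
by rewrite ext1E wedge_dx -setI_eq0 set0I eqxx ext_sign0l set0U scale1r.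
Qed.

Lemma wedge1r alpha : alpha /^\ ext1 = alpha.
Proof.
elim/ext_ind: alpha => [|a alpha beta Pa Pb|I]; first by rewrite wedge0l.
  by rewrite wedgeDl wedgeZl Pa Pb.
by rewrite ext1E wedge_dx -setI_eq0 setI0 eqxx ext_sign0r setU0 scale1r.
Qed.

Lemma wedgeA alpha beta gamma :
  alpha /^\ (beta /^\ gamma) = alpha /^\ beta /^\ gamma.
Proof.
elim/ext_ind: alpha => [|a alpha1 alpha2 P1 P2|I]; first by rewrite !wedge0l.
  by rewrite !(wedgeDl, wedgeZl) P1 P2.
elim/ext_ind: beta => [|a beta1 beta2 P1 P2|J]; first by rewrite !(wedge0l, wedge0r).
  by rewrite !(wedgeDl, wedgeZl, wedgeDr, wedgeZr) P1 P2.
elim/ext_ind: gamma => [|a gamma1 gamma2 P1 P2|K]; first by rewrite !wedge0r.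
  by rewrite !(wedgeDr, wedgeZr) P1 P2.
rewrite !wedge_dx.
case: (boolP [disjoint J & K]) => JK; case: (boolP [disjoint I & J]) => IJ;
  rewrite ?(wedgeZl, wedgeZr, wedge0l, wedge0r) ?wedge_dx //.
- rewrite -!setI_eq0 setIUl setIUr !setU_eq0 !setI_eq0 IJ JK /= andbT.
  case: ifP => IK; last by rewrite !scaler0.
  rewrite !scalerA setUA ext_signUl // ext_signUr //; congr (_ *: _); ring.
- by rewrite -!setI_eq0 setIUr setU_eq0 !setI_eq0 (negPf IJ) scaler0.
- by rewrite -!setI_eq0 setIUl setU_eq0 !setI_eq0 (negPf JK) andbF scaler0.
Qed.

Lemma homogeneous_dx I : homogeneous #|I| (dx I).
Proof. by move=> J; rewrite ffunE; case: (J =P I) => // ->; rewrite eqxx. Qed.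

Lemma homogeneous0 k : homogeneous k (0 : ext R n).
Proof. by move=> I _; rewrite ffunE. Qed.

Lemma homogeneousD k alpha beta :
  homogeneous k alpha -> homogeneous k beta -> homogeneous k (alpha + beta).
Proof. by move=> ha hb I Ik; rewrite ffunE ha // hb // addr0. Qed.

Lemma homogeneousZ k (a : R) alpha : homogeneous k alpha -> homogeneous k (a *: alpha).
Proof. by move=> ha I Ik; rewrite ffunE ha // scaler0. Qed.

Lemma homogeneous_wedge k l alpha beta :
  homogeneous k alpha -> homogeneous l beta -> homogeneous (k + l) (alpha /^\ beta).
Proof.
move=> ha hb; move: alpha ha; apply: homogeneous_ind => [|a x y hx hy|I Ik].
- by rewrite wedge0l; exact: homogeneous0.
- by rewrite wedgeDl wedgeZl; apply: homogeneousD => //; apply: homogeneousZ.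
move: beta hb; apply: homogeneous_ind => [|a x y hx hy|J Jl].
- by rewrite wedge0r; exact: homogeneous0.
- by rewrite wedgeDr wedgeZr; apply: homogeneousD => //; apply: homogeneousZ.
rewrite wedge_dx; case: ifP => d; last exact: homogeneous0.
apply: homogeneousZ; rewrite -Ik -Jl.
suff -> : (#|I| + #|J| = #|I :|: J|)%N by exact: homogeneous_dx.
by rewrite cardsU; move: d; rewrite -setI_eq0 => /eqP ->; rewrite cards0 subn0.
Qed.

Lemma homogeneous_top k alpha : homogeneous k alpha -> (n < k)%N -> alpha = 0.
Proof.
move=> ha nk; apply/ffunP => I; rewrite ffunE ha // neq_ltn.
by rewrite (leq_ltn_trans (max_card _)) // card_ord.
Qed.

Lemma wedgeC k l alpha beta : homogeneous k alpha -> homogeneous l beta ->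
  alpha /^\ beta = (-1) ^+ (k * l) *: (beta /^\ alpha).
Proof.
move=> ha hb; move: alpha ha; apply: homogeneous_ind => [|a x y hx hy|I Ik].
- by rewrite wedge0l wedge0r scaler0.
- by rewrite wedgeDl wedgeZl wedgeDr wedgeZr hx hy scalerDr !scalerA mulrC.
move: beta hb; apply: homogeneous_ind => [|a x y hx hy|J Jl].
- by rewrite wedge0l wedge0r scaler0.
- by rewrite wedgeDl wedgeZl wedgeDr wedgeZr hx hy scalerDr !scalerA mulrC.
rewrite !wedge_dx disjoint_sym; case: ifP => d; last by rewrite scaler0.
rewrite setUC scalerA -Ik -Jl ext_signC // disjoint_sym //.
Qed.

End Exterior.

(** * Covectors, interior product and the flat Hodge star *)

Section Contraction.
Import mathcomp.boot.finset.
Context {R : realType} {n : nat}.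
Local Open Scope set_scope.
Local Open Scope bool_scope.
Local Open Scope ring_scope.
Implicit Types (I J K : {set 'I_n}) (i j : 'I_n) (u v h : 'rV[R]_n).
Implicit Types (alpha beta gamma : ext R n).

Lemma covecE h : covec h = \sum_i h 0 i *: dx [set i].
Proof.
apply/ffunP => I; rewrite ffunE sum_ffunE; apply: eq_bigr => i _.
by rewrite !ffunE.
Qed.

Lemma covecD u v : covec (u + v) = covec u + covec v.
Proof.
by rewrite !covecE -big_split; apply: eq_bigr => i _; rewrite !mxE scalerDl.
Qed.

Lemma covecZ (a : R) v : covec (a *: v) = a *: covec v.
Proof.
by rewrite !covecE scaler_sumr; apply: eq_bigr => i _; rewrite !mxE scalerA.
Qed.

Lemma covec_delta i : covec 'e_i = dx [set i] :> ext R n.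
Proof.
rewrite covecE (bigD1 i) //= mxE !eqxx scale1r big1 ?addr0 // => j ji.
by rewrite mxE (negPf ji) andbF scale0r.
Qed.

Lemma homogeneous_covec h : homogeneous 1 (covec h).
Proof.
rewrite covecE; elim/big_rec: _ => [|i beta _]; first exact: homogeneous0.
apply: homogeneousD; apply: homogeneousZ; rewrite -(cards1 i).
exact: homogeneous_dx.
Qed.

Local Notation iota := interior_product.

Lemma iprodD v alpha beta : iota v (alpha + beta) = iota v alpha + iota v beta.
Proof.
apply/ffunP => I; rewrite !ffunE -big_split; apply: eq_bigr => i _ /=.
by rewrite !ffunE !mulrDr.
Qed.

Lemma iprodZ v (a : R) alpha : iota v (a *: alpha) = a *: iota v alpha.
Proof.
apply/ffunP => I; rewrite !ffunE scaler_sumr; apply: eq_bigr => i _ /=.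
rewrite !ffunE /GRing.scale /=; ring.
Qed.

Lemma iprod0 v : iota v (0 : ext R n) = 0.
Proof. by rewrite -(scale0r (0 : ext R n)) iprodZ !scale0r. Qed.

Lemma iprod_suml T (r : seq T) (a : T -> R) (F : T -> 'rV[R]_n) alpha :
  iota (\sum_(t <- r) a t *: F t) alpha = \sum_(t <- r) a t *: iota (F t) alpha.
Proof.
apply/ffunP => I; rewrite sum_ffunE !ffunE.
transitivity (\sum_(t <- r) \sum_(i | i \notin I)
   (a t * F t 0 i) * (ext_sign [set i]%SET I * alpha (i |: I)%SET)).
  rewrite exchange_big /=; apply: eq_bigr => i _; rewrite summxE mulr_suml.
  by apply: eq_bigr => t _; rewrite mxE.
apply: eq_bigr => t _; rewrite !ffunE scaler_sumr; apply: eq_bigr => i _.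
by rewrite -mulrA.
Qed.

Lemma iprod_delta v alpha : iota v alpha = \sum_i v 0 i *: iota 'e_i alpha.
Proof. by rewrite {1}[v]row_sum_delta iprod_suml. Qed.

Lemma iprod_dx i I :
  iota 'e_i (dx I) = if i \in I then (ext_sign [set i] I : R) *: dx (I :\ i) else 0.
Proof.
apply/ffunP => J; rewrite ffunE big_mkcond (bigD1 i) //= big1 ?addr0; last first.
  move=> j ji; case: ifP => // _; by rewrite mxE (negPf ji) andbF mul0r.
rewrite mxE !eqxx mul1r ffunE; case: (boolP (i \in I)) => iI; last first.
  rewrite ffunE; case: ifP => // iJ; case: eqP => [E|_]; last by rewrite mulr0.
  by rewrite -E setU11 in iI.
rewrite !ffunE; case: ifP => iJ; last first.
  case: eqP => [E|_]; last by rewrite scaler0.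
  by move/negbFE: iJ; rewrite E !inE eqxx.
case: (eqVneq J (I :\ i)) => [->|/eqP JI].
  by rewrite setD1K // eqxx ext_signD1.
case: eqP => [E|_]; last by rewrite mulr0 scaler0.
by case: JI; rewrite -E setU1K.
Qed.

Lemma iprod_covec v h :
  iota v (covec h) = (\sum_i v 0 i * h 0 i) *: ext1.
Proof.
rewrite iprod_delta scaler_suml; apply: eq_bigr => i _.
rewrite -scalerA; congr (_ *: _); rewrite covecE.
rewrite (big_morph (iota 'e_i) (iprodD _) (iprod0 _)) (bigD1 i) //=.
rewrite big1 ?addr0 => [|j ji].
  rewrite iprodZ iprod_dx set11 ext_sign11 sgnxx scale1r ext1E.
  by congr (_ *: dx _); rewrite setDv.
by rewrite iprodZ iprod_dx inE eq_sym (negPf ji) scaler0.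
Qed.

Lemma iprod_homogeneous k v alpha :
  homogeneous k.+1 alpha -> homogeneous k (iota v alpha).
Proof.
move=> ha I Ik; rewrite ffunE big1 // => i iI.
by rewrite ha ?mulr0 // cardsU1 iI.
Qed.

(** Antiderivation property.  On basis forms one index [i] is contracted at a
    time, and the cases are whether [i] occurs in the left or right factor; if
    it occurs in both, the left side is 0 and the two terms cancel by sign. *)
Lemma iprod_wedge k v alpha beta : homogeneous k alpha ->
  iota v (alpha /^\ beta)
  = iota v alpha /^\ beta + (-1) ^+ k *: (alpha /^\ iota v beta).
Proof.
move=> ha; move: alpha ha; apply: homogeneous_ind => [|a x y hx hy|I Ik].
- by rewrite !(wedge0l, iprod0) scaler0 addr0.
- rewrite !(wedgeDl, wedgeZl, iprodD, iprodZ) hx hy.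
  rewrite !scalerDr addrACA; congr (_ + (_ + _)).
  by rewrite !scalerA mulrC.
move: beta; apply: ext_ind => [|a x y hx hy|J].
- by rewrite !(wedge0r, iprod0) scaler0 addr0.
- rewrite !(wedgeDr, wedgeZr, iprodD, iprodZ) hx hy.
  rewrite !scalerDr addrACA; congr (_ + (_ + _)).
  by rewrite !scalerA mulrC.
rewrite [LHS]iprod_delta [in iota v (dx I)]iprod_delta.
rewrite [in iota v (dx J)]iprod_delta.
rewrite wedge_suml wedge_sumr scaler_sumr -big_split /=; apply: eq_bigr => i _.
rewrite wedgeZl wedgeZr scalerA [_ * v 0 i]mulrC -scalerA -scalerDr.
congr (_ *: _); rewrite wedge_dx !iprod_dx.
case: (boolP [disjoint I & J]) => IJ.
  rewrite iprodZ iprod_dx inE.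
  case: (boolP (i \in I)) => iI /=.
    rewrite (disjointFr IJ iI) wedge0r scaler0 addr0 wedgeZl wedge_dx.
    have dI : [disjoint I :\ i & J] by apply: disjointWl IJ; exact: subD1set.
    rewrite dI setDUl; have -> : J :\ i = J.
      by apply/setDidPl; rewrite disjoint_sym disjoints1 (disjointFr IJ iI).
    rewrite !scalerA; congr (_ *: _).
    rewrite (ext_signUr _ IJ) -[in ext_sign I J](setD1K iI) ext_signUl.
      transitivity (ext_sign [set i] J * ext_sign [set i] J * ext_sign (I :\ i) J
         * ext_sign [set i] I :> R); [ring | by rewrite ext_sign_sq mul1r mulrC].
    by rewrite disjoints1 !inE eqxx.
  rewrite wedge0l add0r; case: ifP => iJ; last by rewrite scaler0 wedge0r scaler0.
  rewrite wedgeZr wedge_dx.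
  have dJ : [disjoint I & J :\ i] by apply: disjointWr IJ; exact: subD1set.
  rewrite dJ setDUl; have -> : I :\ i = I.
    by apply/setDidPl; rewrite disjoint_sym disjoints1.
  rewrite !scalerA; congr (_ *: _).
  rewrite (ext_signUr _ IJ) -[in ext_sign I J](setD1K iJ) ext_signUr; last first.
    by rewrite disjoints1 !inE eqxx.
  have dIi : [disjoint I & [set i]] by rewrite disjoint_sym disjoints1.
  rewrite (ext_signC dIi) cards1 muln1 Ik.
  transitivity ((-1) ^+ k * (ext_sign [set i] I * ext_sign [set i] I)
    * ext_sign I (J :\ i) * ext_sign [set i] J : R); first by ring.
  rewrite ext_sign_sq; ring.
rewrite iprod0; case: (boolP (i \in I)) => iI; case: (boolP (i \in J)) => iJ;
  rewrite ?wedge0l ?wedge0r ?scaler0 ?addr0 ?add0r // ?wedgeZl ?wedgeZr !wedge_dx.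
- case: ifP => dI; case: ifP => dJ; last by rewrite !scaler0 addr0.
  + have E : (I :\ i) :|: J = I :|: (J :\ i).
      apply/setP => x; rewrite !inE; case: (eqVneq x i) => [->|]; rewrite ?iI ?iJ //=.
    rewrite E !scalerA -scalerDl.
    have dI1 : [disjoint [set i] & I :\ i] by rewrite disjoints1 !inE eqxx.
    have dJ1 : [disjoint [set i] & J :\ i] by rewrite disjoints1 !inE eqxx.
    have dIi : [disjoint I :\ i & [set i]] by rewrite disjoint_sym.
    have -> : ext_sign (I :\ i) J = ext_sign (I :\ i) [set i] * ext_sign (I :\ i) (J :\ i) :> R.
      by rewrite -(ext_signUr _ dJ1) setD1K.
    have -> : ext_sign I (J :\ i) = ext_sign [set i] (J :\ i) * ext_sign (I :\ i) (J :\ i) :> R.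
      by rewrite -(ext_signUl _ dI1) setD1K.
    rewrite (ext_signC dIi) cards1 muln1 !ext_signD1.
    have <- : (#|I :\ i|.+1)%N = k by rewrite -Ik (cardsD1 i I) iI.
    rewrite [X in X *: _](_ : _ = 0) ?scale0r //.
    rewrite exprS.
    transitivity ((-1) ^+ #|I :\ i| * (ext_sign [set i] I * ext_sign [set i] I
      - ext_sign [set i] J * ext_sign [set i] J) * ext_sign (I :\ i) (J :\ i) : R).
      by ring.
    by rewrite !ext_sign_sq subrr mulr0 mul0r.
  + case/negP: (negbT dJ); rewrite -setI_eq0; apply/eqP/setP => x; rewrite !inE.
    have := disjointFr dI (x := x); rewrite !inE.
    by case: (eqVneq x i) => //= _; [rewrite andbF | case: (x \in I) => //= ->].
  + case/negP: (negbT dI); rewrite -setI_eq0; apply/eqP/setP => x; rewrite !inE.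
    have := disjointFr dJ (x := x); rewrite !inE.
    by case: (eqVneq x i) => //= _; case: (x \in I) => //= ->.
- case: ifP => dI; rewrite ?scaler0 //.
  case/negP: IJ; rewrite -setI_eq0; apply/eqP/setP => x; rewrite !inE.
  have := disjointFr dI (x := x); rewrite !inE.
  case: (eqVneq x i) => /= [-> _|_]; first by rewrite (negPf iJ) andbF.
  by case: (x \in I) => //= ->.
- case: ifP => dJ; rewrite ?scaler0 //.
  case/negP: IJ; rewrite -setI_eq0; apply/eqP/setP => x; rewrite !inE.
  have := disjointFr dJ (x := x); rewrite !inE.
  case: (eqVneq x i) => /= [-> _|_]; first by rewrite (negPf iI).
  by case: (x \in I) => //= ->.
Qed.

(** The Hodge star of the Euclidean metric, for which the dx^i are orthonormal. *)
Definition star0 alpha : ext R n :=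
  [ffun J : {set 'I_n} => ext_sign (~: J) J * alpha (~: J)].

Lemma star0D alpha beta : star0 (alpha + beta) = star0 alpha + star0 beta.
Proof. by apply/ffunP => J; rewrite !ffunE mulrDr. Qed.

Lemma star0Z (a : R) alpha : star0 (a *: alpha) = a *: star0 alpha.
Proof. apply/ffunP => J; rewrite !ffunE /GRing.scale /=; ring. Qed.

Lemma star00 : star0 0 = 0.
Proof. by apply/ffunP => J; rewrite !ffunE mulr0. Qed.

Lemma star0_dx I : star0 (dx I) = (ext_sign I (~: I) : R) *: dx (~: I).
Proof.
apply/ffunP => J; rewrite !ffunE; case: (eqVneq J (~: I)) => [->|/eqP JI].
  by rewrite setCK eqxx.
case: eqP => [E|_]; last by rewrite mulr0 scaler0.
by case: JI; rewrite -E setCK.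
Qed.

(** Makes the star of a product computable without expanding it in a basis. *)
Lemma star0_wedge_covec v alpha : star0 (alpha /^\ covec v) = iota v (star0 alpha).
Proof.
move: alpha; apply: ext_ind => [|a x y hx hy|I].
- by rewrite wedge0l star00 iprod0.
- by rewrite wedgeDl wedgeZl !star0D !star0Z iprodD iprodZ hx hy.
rewrite covecE wedge_sumr (big_morph star0 star0D star00) [RHS]iprod_delta.
apply: eq_bigr => i _; rewrite wedgeZr star0Z; congr (_ *: _).
rewrite wedge_dx star0_dx iprodZ iprod_dx !inE.
rewrite disjoint_sym disjoints1; case: ifP => iI; last by rewrite star00 scaler0.
rewrite star0Z star0_dx !scalerA; have -> : ~: (I :|: [set i]) = ~: I :\ i.
  by apply/setP => x; rewrite !inE negb_or andbC.
congr (_ *: _); have iCI : i \in ~: I by rewrite inE.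
have dIi : [disjoint I & [set i]] by rewrite disjoint_sym disjoints1.
rewrite ext_signUl // -[in ext_sign I (~: I)](setD1K iCI) ext_signUr; last first.
  by rewrite disjoints1 !inE eqxx.
rewrite ext_signD1; ring.
Qed.

End Contraction.

(** * Pullback along a linear map and the Hodge star of a metric *)

Section Pullback.
Import mathcomp.boot.finset.
Context {R : realType} {n : nat}.
Local Open Scope set_scope.
Local Open Scope bool_scope.
Local Open Scope ring_scope.
Implicit Types (I J K : {set 'I_n}) (i j : 'I_n) (u v h : 'rV[R]_n).
Implicit Types (alpha beta gamma : ext R n) (A B : 'M[R]_n).

Lemma enum_min I i : i \in I -> (forall j, j \in I -> (i <= j)%N) ->
  enum I = i :: enum (I :\ i).
Proof.
move=> iI imin; pose lt (x y : 'I_n) := (x < y)%N.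
have lt_tr : transitive lt by move=> x y z; exact: ltn_trans.
have lt_irr : irreflexive lt by move=> x; rewrite /lt ltnn.
have srt (J : {set 'I_n}) : sorted lt (enum J).
  rewrite {1}/enum_mem; apply: sorted_filter => //; rewrite -enumT.
  by have := iota_ltn_sorted 0 n; rewrite -val_enum_ord sorted_map.
apply: (irr_sorted_eq lt_tr lt_irr) => [||x].
- exact: srt.
- rewrite /= path_min_sorted ?srt //; apply/allP => x.
  rewrite mem_enum !inE => /andP[xi xI]; rewrite /lt ltn_neqAle imin // andbT.
  by rewrite eq_sym.
- by rewrite inE !mem_enum !inE; case: (eqVneq x i) => [->|].
Qed.

Lemma covec_sq h : covec h /^\ covec h = 0.
Proof.
have := wedgeC (homogeneous_covec h) (homogeneous_covec h).
rewrite expr1 scaleN1r => /eqP; rewrite -subr_eq0 opprK -mulr2n -scaler_nat.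
by rewrite scaler_eq0 pnatr_eq0 /= => /eqP.
Qed.

Lemma covecC h u : covec h /^\ covec u = - (covec u /^\ covec h).
Proof.
by rewrite (wedgeC (homogeneous_covec h) (homogeneous_covec u)) expr1 scaleN1r.
Qed.

Local Notation rows A I := (\big[wedge/ext1]_(i <- enum I) covec (row i A)).

Lemma rows_min A I i : i \in I -> (forall j, j \in I -> (i <= j)%N) ->
  rows A I = covec (row i A) /^\ rows A (I :\ i).
Proof. by move=> iI imin; rewrite (enum_min iI imin) big_cons. Qed.

(** Moving a covector into its place in an increasing product: each transposition
    costs a sign, and a repeated row gives 0. *)
Lemma rows_covec A i J : covec (row i A) /^\ rows A J =
  if i \in J then 0 else (ext_sign [set i] J : R) *: rows A (i |: J).
Proof.
elim: {J}_.+1 {-2}J (ltnSn #|J|) => // m IH J; rewrite ltnS => Jm.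
have [J0|[j0 j0J]] := set_0Vmem J.
  by rewrite J0 inE enum_set0 big_nil setU0 enum_set1 big_cons big_nil !wedge1r
    ext_sign0r scale1r.
have [j jJ jmin] : exists2 j, j \in J & forall k, k \in J -> (j <= k)%N.
  by case: (arg_minnP (fun k : 'I_n => k : nat) j0J) => j; exists j.
rewrite (rows_min A jJ jmin) wedgeA.
have [ij|ji|/val_inj ij] := ltngtP (i : nat) j.
- have iJ : i \notin J.
    by apply: contraTN ij => /jmin; rewrite -leqNgt.
  rewrite (negPf iJ) -wedgeA -(rows_min A jJ jmin).
  rewrite (@rows_min A (i |: J) i) ?setU11 ?setU1K //; last first.
    move=> k; rewrite !inE => /orP[/eqP ->//|/jmin]; apply: leq_trans.
    exact: ltnW.
  rewrite ext_signE big_set1 big1 ?scale1r // => k /jmin jk.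
  by rewrite /sgn ltnNge (leq_trans _ jk) // ltnW.
- rewrite covecC wedgeNl -wedgeA IH; last first.
    by apply: leq_trans Jm; rewrite (cardsD1 j J) jJ.
  have inej : i != j by rewrite neq_ltn ji orbT.
  rewrite !inE inej /=; case: ifP => iJ; first by rewrite wedge0r oppr0.
  rewrite (@rows_min A (i |: J) j) ?inE ?jJ ?orbT //; last first.
    by move=> k; rewrite !inE => /orP[/eqP ->|/jmin //]; rewrite ltnW.
  have -> : (i |: J) :\ j = i |: (J :\ j).
    apply/setP => k; rewrite !inE; case: (eqVneq k j) => //= ->.
    by rewrite eq_sym (negPf inej).
  rewrite wedgeZr -scaleNr; congr (_ *: _).
  have dj : [disjoint [set j] & J :\ j] by rewrite disjoints1 !inE eqxx.
  rewrite -[in RHS](setD1K jJ) ext_signUr // ext_sign11 /sgn ji mulN1r //.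
- by rewrite ij jJ covec_sq wedge0l.
Qed.

Lemma rows_wedge A I J : rows A I /^\ rows A J =
  if [disjoint I & J] then (ext_sign I J : R) *: rows A (I :|: J) else 0.
Proof.
elim: {I}_.+1 {-2}I (ltnSn #|I|) => // m IH I; rewrite ltnS => Im.
have [I0|[i iI]] := set_0Vmem I.
  rewrite I0 enum_set0 big_nil wedge1l -setI_eq0 set0I eqxx.
  by rewrite ext_sign0l scale1r set0U.
have sq : (ext_sign [set i] (I :\ i) : R) * ext_sign [set i] (I :\ i) = 1.
  exact: ext_sign_sq.
have di : [disjoint [set i] & I :\ i] by rewrite disjoints1 !inE eqxx.
have -> : rows A I = (ext_sign [set i] (I :\ i) : R) *:
    (covec (row i A) /^\ rows A (I :\ i)).
  by rewrite rows_covec !inE eqxx /= scalerA sq scale1r setD1K.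
rewrite wedgeZl -wedgeA IH; last first.
  by apply: leq_trans Im; rewrite (cardsD1 i I) iI.
have -> : [disjoint I & J] = (i \notin J) && [disjoint I :\ i & J].
  rewrite -{1}(setD1K iI) -!setI_eq0 setIUl setU_eq0 !setI_eq0 disjoints1 //.
case: (boolP [disjoint I :\ i & J]) => IJ; last by rewrite andbF wedge0r scaler0.
rewrite andbT wedgeZr rows_covec !inE eqxx /=.
case: ifP => iJ /=; first by rewrite !scaler0.
rewrite setUA setD1K // !scalerA; congr (_ *: _).
have -> : ext_sign I J = ext_sign [set i] J * ext_sign (I :\ i) J :> R.
  by rewrite -(ext_signUl _ di) setD1K.
rewrite (ext_signUr _ IJ).
transitivity ((ext_sign [set i] (I :\ i) * ext_sign [set i] (I :\ i)) *
  ext_sign [set i] J * ext_sign (I :\ i) J : R); first by ring.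
by rewrite sq mul1r.
Qed.

Lemma ext_mapD A alpha beta : ext_map A (alpha + beta) = ext_map A alpha + ext_map A beta.
Proof.
by rewrite /ext_map -big_split; apply: eq_bigr => I _; rewrite ffunE scalerDl.
Qed.

Lemma ext_mapZ A (a : R) alpha : ext_map A (a *: alpha) = a *: ext_map A alpha.
Proof.
by rewrite /ext_map scaler_sumr; apply: eq_bigr => I _; rewrite ffunE scalerA.
Qed.

Lemma ext_map0 A : ext_map A 0 = 0.
Proof. by rewrite -(scale0r (0 : ext R n)) ext_mapZ !scale0r. Qed.

Lemma ext_map_dx A I : ext_map A (dx I) = rows A I.
Proof.
rewrite /ext_map (bigD1 I) //= ffunE eqxx scale1r big1 ?addr0 // => J JI.
by rewrite ffunE (negPf JI) scale0r.
Qed.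

(** Functoriality: [ext_map] was defined by ordered products of rows, so it is
    an algebra morphism once products of rows obey the rules of basis forms. *)
Lemma ext_mapM A alpha beta :
  ext_map A (alpha /^\ beta) = ext_map A alpha /^\ ext_map A beta.
Proof.
move: alpha; apply: ext_ind => [|a x y hx hy|I].
- by rewrite wedge0l ext_map0 wedge0l.
- by rewrite !(wedgeDl, wedgeZl, ext_mapD, ext_mapZ) hx hy.
move: beta; apply: ext_ind => [|a x y hx hy|J].
- by rewrite wedge0r ext_map0 wedge0r.
- by rewrite !(wedgeDr, wedgeZr, ext_mapD, ext_mapZ) hx hy.
rewrite wedge_dx !ext_map_dx rows_wedge.
by case: ifP => d; rewrite ?ext_map0 // ext_mapZ ext_map_dx.
Qed.

Lemma ext_map1 A : ext_map A ext1 = ext1.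
Proof. by rewrite ext1E ext_map_dx enum_set0 big_nil ext1E. Qed.

Lemma ext_map_covec A h : ext_map A (covec h) = covec (h *m A).
Proof.
rewrite covecE (big_morph _ (ext_mapD A) (ext_map0 A)).
rewrite mulmx_sum_row (big_morph covec (id1 := 0) (op1 := +%R)); last 2 first.
- exact: covecD.
- by rewrite -(scale0r (0 : 'rV[R]_n)) covecZ scale0r.
apply: eq_bigr => i _; rewrite ext_mapZ covecZ ext_map_dx enum_set1.
by rewrite big_cons big_nil wedge1r.
Qed.

(** With this form of the star no determinant of [g] ever has to be computed:
    the volume form enters through its top coefficient only. *)
Lemma starE (g : 'M[R]_n) vol beta :
  star g vol beta = vol [set: 'I_n]%SET *: star0 (ext_map (invmx g) beta).
Proof.
apply/ffunP => J; rewrite !ffunE /GRing.scale /=; ring.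
Qed.

Lemma starD (g : 'M[R]_n) vol alpha beta :
  star g vol (alpha + beta) = star g vol alpha + star g vol beta.
Proof. by rewrite !starE ext_mapD star0D scalerDr. Qed.

Lemma starZ (g : 'M[R]_n) vol (a : R) alpha :
  star g vol (a *: alpha) = a *: star g vol alpha.
Proof. by rewrite !starE ext_mapZ star0Z !scalerA mulrC. Qed.

Lemma star_zero (g : 'M[R]_n) vol : star g vol 0 = 0.
Proof. by rewrite -(scale0r (0 : ext R n)) starZ !scale0r. Qed.

(** Pulling back along [g^-1] undoes the lowering of the index of [v], which
    reduces this to the flat star. *)
Lemma star_wedge_flat (g : 'M[R]_n) vol v beta : g \in unitmx ->
  star g vol (beta /^\ covec (v *m g)) = interior_product v (star g vol beta).
Proof.
by move=> gu; rewrite !starE ext_mapM ext_map_covec mulmxK // star0_wedge_covec iprodZ.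
Qed.

(** Every 2-form comes from an antisymmetric matrix, see [two_form_mx]; the
    metric then acts on it by matrix multiplication. *)
Definition form2 (W : 'M[R]_n) : ext R n :=
  \sum_i \sum_j W i j *: (covec 'e_i /^\ covec 'e_j).

Lemma two_form_mx beta : homogeneous 2 beta ->
  exists2 W, W^T = - W & beta = form2 W.
Proof.
move: beta; apply: homogeneous_ind => [|a x y [W hW ->] [V hV ->]|I I2].
- exists 0; first by rewrite trmx0 oppr0.
  by rewrite /form2 big1 // => i _; rewrite big1 // => j _; rewrite mxE scale0r.
- exists (a *: W + V); first by rewrite linearD linearZ /= hW hV scalerN opprD.
  rewrite /form2 scaler_sumr -big_split; apply: eq_bigr => i _ /=.
  rewrite scaler_sumr -big_split; apply: eq_bigr => j _ /=.
  by rewrite !mxE scalerDl scalerA.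
move/eqP/cards2P: I2 => [i [j [ij ->]]].
exists ((2^-1 * sgn i j) *: (delta_mx i j - delta_mx j i)).
  by rewrite linearZ linearB /= !trmx_delta -scalerN opprB.
have e2 (k l : 'I_n) : \sum_i0 \sum_j0 ((delta_mx k l : 'M[R]_n) i0 j0) *: (covec 'e_i0 /^\ covec 'e_j0)
    = covec 'e_k /^\ covec 'e_l :> ext R n.
  rewrite (bigD1 k) //= [X in _ + X]big1 ?addr0 => [|m mk]; last first.
    by rewrite big1 // => p _; rewrite mxE (negPf mk) scale0r.
  rewrite (bigD1 l) //= big1 ?addr0 => [|p pl].
    by rewrite mxE !eqxx scale1r.
  by rewrite mxE (negPf pl) andbF scale0r.
transitivity ((2^-1 * sgn i j : R) *:
    (covec 'e_i /^\ covec 'e_j - covec 'e_j /^\ covec 'e_i : ext R n)).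
  rewrite [covec 'e_j /^\ _]covecC opprK.
  rewrite -[X in _ *: (_ + X)]scale1r -[X in _ *: (X + _)]scale1r -scalerDl scalerA.
  rewrite !covec_delta wedge_dx disjoints1 inE ij /= ext_sign11 scalerA.
  rewrite [X in X *: _](_ : _ = sgn i j * sgn i j); last by field.
  by rewrite sgn_sq scale1r.
rewrite -(e2 i j) -(e2 j i) -sumrB scaler_sumr; apply: eq_bigr => k _.
rewrite -sumrB scaler_sumr; apply: eq_bigr => l _.
by rewrite !mxE scalerBr !scalerA -scalerBl -mulrBr.
Qed.

End Pullback.

(** * The transverse geometry at a point *)

Lemma ord3_neq (i : 'I_3) : [/\ (i + 1 == i) = false, (i + 2 == i) = false,
  (i + 1 == i + 2) = false & (i + 2 == i + 1) = false].
Proof. by case: i => -[|[|[|//]]] p. Qed.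

Lemma ord3_shift (i : 'I_3) :
  [/\ i + 1 + 1 = i + 2, i + 1 + 2 = i, i + 2 + 1 = i & i + 2 + 2 = i + 1].
Proof. by case: i => -[|[|[|//]]] p; split; apply: val_inj. Qed.

Lemma ord3_add : [/\ 1 + 1 = 2 :> 'I_3, 1 + 2 = 0 :> 'I_3, 2 + 1 = 0 :> 'I_3 & 2 + 2 = 1 :> 'I_3].
Proof. by split; apply: val_inj. Qed.

Lemma ord3P (i : 'I_3) : [\/ i = 0, i = 1 | i = 2].
Proof.
by case: i => -[|[|[|//]]] p; [apply: Or31|apply: Or32|apply: Or33]; apply: val_inj.
Qed.

Section TransverseLinearAlgebra.
Context {R : realType}.
Implicit Types (u v h : 'rV[R]_7) (alpha beta : ext R 7).
Local Notation iota := interior_product.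

Lemma wedge_covecC k h alpha : homogeneous k alpha ->
  covec h /^\ alpha = (-1) ^+ k *: (alpha /^\ covec h).
Proof. by move=> ha; rewrite (wedgeC (homogeneous_covec h) ha) mul1n. Qed.

Lemma wedge_twoC alpha beta : homogeneous 2 alpha ->
  alpha /^\ beta = beta /^\ alpha.
Proof.
move=> ha; move: beta; apply: ext_ind => [|a x y hx hy|I].
- by rewrite wedge0l wedge0r.
- by rewrite wedgeDl wedgeDr wedgeZl wedgeZr hx hy.
by rewrite (wedgeC ha (@homogeneous_dx R 7 I)) exprM sqrrN expr1n expr1n scale1r.
Qed.

Lemma iprod_wedge_covec v h beta :
  iota v (covec h /^\ beta)
  = (\sum_i v 0 i * h 0 i) *: beta - covec h /^\ iota v beta.
Proof.
by rewrite (iprod_wedge _ _ (homogeneous_covec h)) iprod_covec wedgeZl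
  wedge1l expr1 scaleN1r.
Qed.

Lemma covec_inj v : covec v = 0 -> v = 0.
Proof.
move=> v0; apply/rowP => i; move/ffunP: v0 => /(_ [set i]%SET).
rewrite !ffunE (bigD1 i) //= eqxx mulr1 big1 ?addr0 ?mxE // => j ji.
case: eqP => [/finset.set1_inj E|_]; last by rewrite mulr0.
by rewrite E eqxx in ji.
Qed.

Lemma pairingE v h : \sum_i v 0 i * h 0 i = (v *m h^T) 0 0.
Proof. by rewrite mxE; apply: eq_bigr => i _; rewrite mxE. Qed.

Lemma homogeneous0E alpha : homogeneous 0 alpha -> alpha = alpha finset.set0 *: ext1.
Proof.
move=> h0; apply/ffunP => I; rewrite !ffunE.
case: (eqVneq I finset.set0) => [->|I0]; first by rewrite /GRing.scale /= mulr1.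
by rewrite scaler0 h0 // cards_eq0.
Qed.

Lemma homogeneous_topE alpha : homogeneous 7 alpha ->
  alpha = alpha [set: 'I_7]%SET *: dx [set: 'I_7]%SET.
Proof.
move=> h0; apply/ffunP => I; rewrite !ffunE.
case: (eqVneq I [set: 'I_7]%SET) => [->|I0]; first by rewrite /GRing.scale /= mulr1.
rewrite scaler0 h0 //; apply: contraNneq I0 => I7.
by rewrite eqEcard finset.subsetT cardsT card_ord I7.
Qed.

Lemma star1 (g : 'M[R]_7) vol : homogeneous 7 vol -> star g vol ext1 = vol.
Proof.
move=> hv; rewrite starE ext_map1 ext1E star0_dx ext_sign0l finset.setC0 scale1r.
by rewrite -homogeneous_topE.
Qed.

(** Contraction with the bivector whose indices are raised from those of the
    two-form [form2 W]. *)
Definition contract (g W : 'M[R]_7) alpha : ext R 7 :=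
  \sum_i \sum_j W i j *: iota ('e_j *m invmx g) (iota ('e_i *m invmx g) alpha).

(** This is [star_wedge_flat] for the covectors of each term of the 2-form. *)
Lemma star_wedge_form2 (g W : 'M[R]_7) vol beta : g \in unitmx ->
  star g vol (beta /^\ form2 W) = contract g W (star g vol beta).
Proof.
move=> gu; rewrite /form2 wedge_sumr.
rewrite (big_morph _ (starD g vol) (star_zero g vol)); apply: eq_bigr => i _.
rewrite wedge_sumr (big_morph _ (starD g vol) (star_zero g vol)).
apply: eq_bigr => j _; rewrite wedgeZr starZ wedgeA.
rewrite -[in covec 'e_j](mulmxKV gu 'e_j) star_wedge_flat //.
by rewrite -[in covec 'e_i](mulmxKV gu 'e_i) star_wedge_flat.
Qed.

Lemma iprod_form2 W v : W^T = - W -> iota v (form2 W) = (2 : R) *: covec (v *m W).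
Proof.
move=> hW; rewrite /form2 (big_morph _ (iprodD v) (iprod0 v)).
have covec_sum (F : 'I_7 -> 'rV[R]_7) : covec (\sum_i F i) = \sum_i covec (F i).
  apply: (big_morph covec (@covecD R 7)).
  by rewrite -(scale0r (0 : 'rV[R]_7)) covecZ scale0r.
have vi i : \sum_j v 0 j * ('e_i : 'rV[R]_7) 0 j = v 0 i.
  rewrite (bigD1 i) //= mxE !eqxx mulr1 big1 ?addr0 // => j ji.
  by rewrite mxE (negPf ji) andbF mulr0.
have -> : \sum_i iota v (\sum_j W i j *: (covec 'e_i /^\ covec 'e_j)) =
   \sum_i \sum_j ((W i j * v 0 i) *: covec 'e_j - (W i j * v 0 j) *: covec 'e_i).
  apply: eq_bigr => i _; rewrite (big_morph _ (iprodD v) (iprod0 v)).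
  apply: eq_bigr => j _; rewrite iprodZ iprod_wedge_covec iprod_covec.
  by rewrite !vi wedgeZr wedge1r scalerBr !scalerA.
have -> : (2 : R) *: covec (v *m W) = covec (v *m W) - covec (v *m W^T).
  rewrite hW mulmxN -[- (v *m W)]scaleN1r covecZ scaleN1r opprK.
  by rewrite scaler_nat mulr2n.
under eq_bigr do rewrite sumrB.
rewrite sumrB; congr (_ - _).
  rewrite exchange_big /= [in RHS](row_sum_delta (v *m W)) covec_sum.
  apply: eq_bigr => j _; rewrite covecZ mxE scaler_suml.
  by apply: eq_bigr => i _; rewrite mulrC.
rewrite [in RHS](row_sum_delta (v *m W^T)) covec_sum.
apply: eq_bigr => j _; rewrite covecZ mxE scaler_suml.
by apply: eq_bigr => i _; rewrite mxE mulrC.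
Qed.

Lemma ext_map_form2 A (W : 'M[R]_7) : ext_map A (form2 W) = form2 (A^T *m W *m A).
Proof.
have covec_sum (a : 'I_7 -> R) : covec (\sum_i a i *: 'e_i) = \sum_i a i *: covec 'e_i.
  rewrite (big_morph covec (id1 := 0) (op1 := +%R)); last 2 first.
  - exact: covecD.
  - by rewrite -(scale0r (0 : 'rV[R]_7)) covecZ scale0r.
  by apply: eq_bigr => i _; rewrite covecZ.
have eA i : covec ('e_i *m A) = \sum_k A i k *: covec 'e_k.
  rewrite [in LHS](row_sum_delta ('e_i *m A)) covec_sum.
  by apply: eq_bigr => k _; rewrite -rowE mxE.
rewrite /form2 (big_morph _ (ext_mapD A) (ext_map0 A)).
transitivity (\sum_i \sum_j \sum_k \sum_l
   (W i j * A i k * A j l) *: (covec 'e_k /^\ covec 'e_l : ext R 7)).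
  apply: eq_bigr => i _; rewrite (big_morph _ (ext_mapD A) (ext_map0 A)).
  apply: eq_bigr => j _; rewrite ext_mapZ ext_mapM !ext_map_covec !eA.
  rewrite wedge_suml scaler_sumr; apply: eq_bigr => k _.
  rewrite wedge_sumr scaler_sumr; apply: eq_bigr => l _.
  by rewrite wedgeZl wedgeZr !scalerA.
transitivity (\sum_k \sum_l \sum_i \sum_j
   (W i j * A i k * A j l) *: (covec 'e_k /^\ covec 'e_l : ext R 7)).
  under eq_bigr do rewrite exchange_big /=.
  rewrite exchange_big /=; apply: eq_bigr => k _.
  under eq_bigr do rewrite exchange_big /=.
  by rewrite exchange_big.
apply: eq_bigr => k _; apply: eq_bigr => l _.
under eq_bigr do rewrite -scaler_suml.
rewrite -scaler_suml; congr (_ *: _).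
rewrite exchange_big /= mxE; apply: eq_bigr => j _.
rewrite mxE mulr_suml; apply: eq_bigr => i _; rewrite mxE; ring.
Qed.

Section Point.
Variables (g : 'M[R]_7) (E : 'I_3 -> 'rV[R]_7).
Variables (w : 'I_3 -> ext R 7) (nu : ext R 7).
Let e i := covec (E i *m g).
Let e123 := e 0 /^\ e 1 /^\ e 2.
Hypothesis gsym : g^T = g.
Hypothesis gu : g \in unitmx.
Hypothesis Eorth : forall i j, (E i *m g *m (E j)^T) 0 0 = (i == j)%:R.
Hypothesis w2 : forall i, homogeneous 2 (w i).
Hypothesis nu4 : homogeneous 4 nu.
Hypothesis iw : forall i j, iota (E i) (w j) = 0.
Hypothesis inu : forall i, iota (E i) nu = 0.
Hypothesis ww : forall i j, w i /^\ w j = (2 * (i == j)%:R) *: nu.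
Hypothesis vol0 : (e123 /^\ nu) [set: 'I_7]%SET != 0.
Hypothesis starw : forall i, star g (e123 /^\ nu) (w i) = e123 /^\ w i.

Let eh i : homogeneous 1 (e i). Proof. exact: homogeneous_covec. Qed.

Let e123h : homogeneous 3 e123.
Proof. by apply: (homogeneous_wedge (k := 2)) => //; apply: (homogeneous_wedge (k := 1)). Qed.

Let volh : homogeneous 7 (e123 /^\ nu).
Proof. exact: (homogeneous_wedge e123h nu4). Qed.

Lemma iprod_frame i j beta :
  iota (E i) (e j /^\ beta) = (i == j)%:R *: beta - e j /^\ iota (E i) beta.
Proof.
rewrite iprod_wedge_covec pairingE trmx_mul gsym mulmxA Eorth //.
Qed.

(** The contraction of [v] with [form2 W] is twice the covector of [v *m W]. *)
Lemma horizontal_form2 W i k : W^T = - W -> w k = form2 W -> E i *m W = 0.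
Proof.
move=> hW wW; apply: covec_inj; have := iw i k; rewrite wW iprod_form2 //.
by move=> /eqP; rewrite scaler_eq0 pnatr_eq0 => /eqP.
Qed.

(** Horizontal contraction does not see the vertical covectors: the two cross
    terms pair [E i] with [W], which is zero. *)
Lemma contract_frame W i beta : W^T = - W -> E i *m W = 0 ->
  contract g W (e i /^\ beta) = e i /^\ contract g W beta.
Proof.
move=> hW EW.
have raise (k : 'I_7) : \sum_(j < 7) (('e_k : 'rV[R]_7) *m invmx g) 0 j * (E i *m g) 0 j = E i 0 k.
  by rewrite (pairingE ('e_k *m invmx g) (E i *m g)) trmx_mul gsym mulmxA mulmxKV // -rowE !mxE.
transitivity (\sum_k \sum_j ((W k j * E i 0 k) *: iota ('e_j *m invmx g) beta
  - (W k j * E i 0 j) *: iota ('e_k *m invmx g) beta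
  + W k j *: (e i /^\ iota ('e_j *m invmx g) (iota ('e_k *m invmx g) beta)))).
  apply: eq_bigr => k _; apply: eq_bigr => j _.
  rewrite iprod_wedge_covec raise.
  rewrite -[- (covec _ /^\ _)]scaleN1r iprodD !iprodZ iprod_wedge_covec raise.
  by rewrite scaleN1r opprB scalerDr scalerBr !scalerA addrA addrAC.
rewrite /contract wedge_sumr.
transitivity (\sum_k \sum_j (W k j * E i 0 k) *: iota ('e_j *m invmx g) beta
  - \sum_k \sum_j (W k j * E i 0 j) *: iota ('e_k *m invmx g) beta
  + \sum_k \sum_j W k j *: (e i /^\ iota ('e_j *m invmx g) (iota ('e_k *m invmx g) beta))).
  rewrite -sumrB -big_split /=; apply: eq_bigr => k _.
  by rewrite -sumrB -big_split.
rewrite exchange_big /= big1 => [|j _]; last first.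
  rewrite -scaler_suml; have -> : \sum_k W k j * E i 0 k = (E i *m W) 0 j.
    by rewrite mxE; apply: eq_bigr => k _; rewrite mulrC.
  by rewrite EW mxE scale0r.
rewrite big1 => [|k _]; last first.
  rewrite -scaler_suml; have -> : \sum_j W k j * E i 0 j = - (E i *m W) 0 k.
    rewrite mxE -sumrN; apply: eq_bigr => j _; rewrite mulrC -mulrN; congr (_ * _).
    by move/matrixP: hW => /(_ j k); rewrite !mxE.
  by rewrite EW mxE oppr0 scale0r.
rewrite subr0 add0r; apply: eq_bigr => k _; rewrite wedge_sumr.
by apply: eq_bigr => j _; rewrite wedgeZr.
Qed.

Lemma contract_e123 W beta : W^T = - W -> (forall i, E i *m W = 0) ->
  contract g W (e123 /^\ beta) = e123 /^\ contract g W beta.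
Proof. by move=> hW EW; rewrite /e123 -!wedgeA !contract_frame. Qed.

(** On forms of top total degree, contraction is its own adjoint: an 8-form
    vanishes, so contracting the product of the two factors gives 0. *)
Lemma wedge_contract_top W alpha : W^T = - W -> homogeneous 2 alpha ->
  alpha /^\ contract g W (e123 /^\ nu) = contract g W alpha /^\ (e123 /^\ nu).
Proof.
move=> hW a2; set vol := e123 /^\ nu; pose f (i : 'I_7) := ('e_i : 'rV[R]_7) *m invmx g.
have top u v : alpha /^\ iota v (iota u vol) = - (iota u (iota v alpha) /^\ vol).
  have ivh : homogeneous 6 (iota u vol) by exact: iprod_homogeneous.
  have iah : homogeneous 1 (iota v alpha) by exact: iprod_homogeneous.
  have := iprod_wedge v (iota u vol) a2.
  rewrite (homogeneous_top (homogeneous_wedge a2 ivh)) // iprod0 sqrrN expr1n scale1r.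
  move/esym/eqP; rewrite addrC addr_eq0 => /eqP ->.
  have := iprod_wedge u vol iah.
  rewrite (homogeneous_top (homogeneous_wedge iah volh)) // iprod0 expr1 scaleN1r.
  by move/esym/eqP; rewrite subr_eq0 => /eqP ->.
rewrite /contract wedge_sumr wedge_suml.
transitivity (\sum_i \sum_j W j i *: (iota (f i) (iota (f j) alpha) /^\ vol)).
  apply: eq_bigr => i _; rewrite wedge_sumr; apply: eq_bigr => j _.
  rewrite wedgeZr top scalerN -scaleNr; congr (_ *: _).
  by move/matrixP: hW => /(_ j i); rewrite !mxE => ->; rewrite opprK.
rewrite exchange_big /=; apply: eq_bigr => i _; rewrite wedge_suml.
by apply: eq_bigr => j _; rewrite wedgeZl.
Qed.

Lemma vol_scale_inj (a b : R) : a *: (e123 /^\ nu) = b *: (e123 /^\ nu) -> a = b.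
Proof.
move: (e123 /^\ nu) vol0 => v v0 /ffunP /(_ [set: 'I_7]%SET).
by rewrite !ffunE; apply: mulIf.
Qed.

(** Only the stars of the [w i] are given; that of nu follows.  Write [w 0] as
    the 2-form of a matrix [W].  Since [w 0 /\ w 0 = 2 nu], the star of [2 nu]
    is the contraction by [W] of [star (w 0) = e123 /\ w 0], that is, e123
    times the number [l = contract W (w 0)].  By adjointness, [l] times the
    volume form is [w 0 /\ star (w 0)], which is twice the volume form. *)
Lemma star_nu : star g (e123 /^\ nu) nu = e123.
Proof.
have [W hW wW] := two_form_mx (w2 0).
have EW i : E i *m W = 0 by exact: horizontal_form2 hW wW.
have sw : star g (e123 /^\ nu) (w 0) = contract g W (e123 /^\ nu).
  by rewrite -[w 0]wedge1l wW star_wedge_form2 // star1.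
have [l Ll] : exists l : R, contract g W (w 0) = l *: ext1.
  exists (contract g W (w 0) finset.set0); apply: homogeneous0E.
  rewrite /contract; elim/big_rec: _ => [|i x _ hx]; first exact: homogeneous0.
  apply: homogeneousD => //.
  elim/big_rec: _ => [|j y _ hy]; first exact: homogeneous0.
  apply: homogeneousD => //; apply: homogeneousZ.
  by do 2! apply: iprod_homogeneous.
have l2 : l = 2.
  apply: vol_scale_inj; have := wedge_contract_top hW (w2 0).
  rewrite Ll wedgeZl wedge1l -sw starw wedge_twoC // -wedgeA ww eqxx mulr1 => <-.
  by rewrite wedgeZr.
have := @star_wedge_form2 g W (e123 /^\ nu) (w 0) gu.
rewrite -wW ww eqxx mulr1 starZ starw contract_e123 // Ll l2 wedgeZr wedge1r.
by move=> /(congr1 (fun x => (2 : R)^-1 *: x)); rewrite !scalerA mulVf ?pnatr_eq0 // !scale1r.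
Qed.

Variables (a : 'I_3 -> R) (c : R).
Hypothesis a0 : forall i, a i != 0.
Hypothesis c0 : c != 0.

Let ee i := (E i *m g)^T *m (E i *m g).
Definition rescaled_metric : 'M[R]_7 :=
  \sum_i a i ^+ 2 *: ee i + c ^+ 2 *: (g - \sum_i ee i).

Let EE i := (E i)^T *m E i.
(** The frame [E i] is orthonormal for [g], so the inverse of a metric that is
    rescaled separately on the fibres and on the base is explicit. *)
Definition rescaled_cometric : 'M[R]_7 :=
  \sum_i (a i ^- 2 - c ^- 2) *: EE i + c ^- 2 *: invmx g.

Lemma mulmx_cometric : rescaled_metric *m rescaled_cometric = 1%:M.
Proof.
have gE i : g *m EE i = (E i *m g)^T *m E i by rewrite /EE mulmxA trmx_mul gsym.
have eg i : ee i *m invmx g = (E i *m g)^T *m E i by rewrite /ee -mulmxA mulmxK.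
have eE i j : ee i *m EE j = (i == j)%:R *: ((E i *m g)^T *m E i).
  rewrite /ee /EE mulmxA -[_ *m (E j)^T]mulmxA.
  rewrite [E i *m g *m _]mx11_scalar Eorth mul_mx_scalar -scalemxAl.
  by case: eqP => [->|_]; rewrite // !scale0r.
have -> : rescaled_metric = \sum_i (a i ^+ 2 - c ^+ 2) *: ee i + c ^+ 2 *: g.
  rewrite /rescaled_metric scalerBr scaler_sumr addrCA addrC; congr (_ + _).
  by rewrite -sumrB; apply: eq_bigr => i _; rewrite scalerBl.
have cg : (c ^+ 2 *: g) *m (c ^- 2 *: invmx g) = 1%:M.
  by rewrite -scalemxAl -scalemxAr scalerA mulfV ?expf_neq0 // scale1r mulmxV.
rewrite /rescaled_cometric mulmxDl !mulmxDr cg addrA -[RHS]add0r; congr (_ + _).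
rewrite !mulmx_suml mulmx_sumr -!big_split /= big1 // => i _.
rewrite -!scalemxAl -!scalemxAr gE eg mulmx_sumr (bigD1 i) //= big1 ?addr0.
  rewrite -scalemxAr eE eqxx scale1r !scalerA -!scalerDl.
  rewrite [X in X *: _](_ : _ = 0) ?scale0r //; field.
  by rewrite a0 c0.
by move=> j ji; rewrite -scalemxAr eE eq_sym (negPf ji) scale0r !scaler0.
Qed.

Lemma rescaled_unit : rescaled_metric \in unitmx.
Proof. by case: (mulmx1_unit mulmx_cometric). Qed.

Lemma invmx_rescaled : invmx rescaled_metric = rescaled_cometric.
Proof.
by rewrite -[RHS](mulKmx rescaled_unit) mulmx_cometric mulmx1.
Qed.

Lemma frame_rescaled i : E i *m rescaled_metric = a i ^+ 2 *: (E i *m g).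
Proof.
have Ee j : E i *m ee j = (i == j)%:R *: (E j *m g).
  rewrite /ee mulmxA; have -> : E i *m (E j *m g)^T = (i == j)%:R%:M.
    by rewrite trmx_mul gsym mulmxA [LHS]mx11_scalar Eorth.
  by rewrite mul_scalar_mx.
rewrite /rescaled_metric mulmxDr !mulmx_sumr -scalemxAr mulmxBr mulmx_sumr.
under [X in X + _]eq_bigr do rewrite -scalemxAr Ee.
under [X in _ - X]eq_bigr do rewrite Ee.
rewrite (bigD1 i) //= big1 => [|j ji]; last by rewrite eq_sym (negPf ji) scale0r scaler0.
rewrite addr0 eqxx scale1r (bigD1 i) //= big1 => [|j ji]; last first.
  by rewrite eq_sym (negPf ji) scale0r.
by rewrite eqxx scale1r addr0 subrr scaler0 addr0.
Qed.

(** On horizontal 2-forms the rescaled cometric differs from [g^-1] by a factor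
    [c ^- 2] in each index, because [W] kills the vertical part. *)
Lemma ext_map_horizontal i :
  ext_map rescaled_cometric (w i) = c ^- 4 *: ext_map (invmx g) (w i).
Proof.
have [W hW wW] := two_form_mx (w2 i); have EW j := horizontal_form2 j hW wW.
have WE j : W *m (E j)^T = 0.
  by apply: trmx_inj; rewrite trmx_mul trmxK hW mulmxN EW oppr0 trmx0.
rewrite wW !ext_map_form2.
have WQ : W *m rescaled_cometric = c ^- 2 *: (W *m invmx g).
  rewrite /rescaled_cometric mulmxDr mulmx_sumr big1 ?add0r -?scalemxAr // => j _.
  by rewrite -scalemxAr /EE mulmxA WE mul0mx scaler0.
have QW : rescaled_cometric^T *m W = c ^- 2 *: ((invmx g)^T *m W).
  apply: trmx_inj; rewrite linearZ /= !trmx_mul !trmxK hW !mulNmx scalerN; congr (- _).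
  exact: WQ.
rewrite QW -scalemxAl -[_ *m rescaled_cometric]mulmxA WQ -scalemxAr scalerA mulmxA.
have -> : c ^- 2 * c ^- 2 = c ^- 4 by rewrite -invfM -exprD.
rewrite /form2 scaler_sumr; apply: eq_bigr => k _.
rewrite scaler_sumr; apply: eq_bigr => l _.
by rewrite [in LHS]mxE scalerA.
Qed.

Variable kv : R.
Let starp := star rescaled_metric (kv *: (e123 /^\ nu)).

Lemma star_rescaled beta (m : R) :
  ext_map rescaled_cometric beta = m *: ext_map (invmx g) beta ->
  starp beta = (kv * m) *: star g (e123 /^\ nu) beta.
Proof.
move=> hb; rewrite /starp !starE invmx_rescaled hb star0Z ffunE !scalerA.
by congr (_ *: _); rewrite /GRing.scale /=; ring.
Qed.

Lemma star_rescaled_w i : starp (w i) = (kv / c ^+ 4) *: (e123 /^\ w i).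
Proof. by rewrite (star_rescaled (ext_map_horizontal i)) starw. Qed.

Lemma star_rescaled_nu : starp nu = (kv / c ^+ 8) *: e123.
Proof.
rewrite (@star_rescaled _ (c ^- 8)) ?star_nu //.
have -> : nu = 2^-1 *: (w 0 /^\ w 0).
  by rewrite ww eqxx mulr1 scalerA mulVf ?pnatr_eq0 // scale1r.
rewrite !ext_mapZ !ext_mapM ext_map_horizontal wedgeZl wedgeZr !scalerA.
by congr (_ *: _); field.
Qed.

(** Lowering the index of [E i] in the rescaled metric gives [a i ^+ 2 *: e i], so
    vertical factors are moved through the star by contraction. *)
Lemma star_rescaled_frame beta i :
  starp (beta /^\ e i) = a i ^- 2 *: iota (E i) (starp beta).
Proof.
have -> : e i = a i ^- 2 *: covec (E i *m rescaled_metric).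
  by rewrite frame_rescaled covecZ scalerA mulVf ?expf_neq0 // scale1r.
by rewrite wedgeZr /starp starZ star_wedge_flat // rescaled_unit.
Qed.

Lemma e123_cyclic i : e i /^\ e (i + 1) /^\ e (i + 2) = e123.
Proof.
have H j k l : e j /^\ e k /^\ e l = e k /^\ e l /^\ e j.
  have ekl : homogeneous 2 (e k /^\ e l) by exact: (homogeneous_wedge (eh k) (eh l)).
  by rewrite -wedgeA /e (wedge_covecC _ ekl) sqrrN expr1n scale1r.
have [a11 a12 a21 a22] := ord3_add.
have [-> | -> | ->] := ord3P i.
- by rewrite !add0r.
- by rewrite a11 a12 /e123 [RHS]H.
- by rewrite a21 a22 H.
Qed.

(** Contract [star (w i)], a multiple of [e i /\ e (i+1) /\ e (i+2) /\ w i], with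
    [E (i+1)] and [E (i+2)]. *)
Lemma star_rescaled_mixed i :
  starp (e (i + 1) /^\ e (i + 2) /^\ w i)
  = (kv / (c ^+ 4 * a (i + 1) ^+ 2 * a (i + 2) ^+ 2)) *: (e i /^\ w i).
Proof.
rewrite -wedge_twoC // wedgeA !star_rescaled_frame star_rescaled_w.
have [i1 i2 i12 _] := ord3_neq i.
have neg v x : iota v (- x) = - iota v x by rewrite -scaleN1r iprodZ scaleN1r.
rewrite -(e123_cyclic i) -!wedgeA !iprodZ.
have -> : iota (E (i + 1)) (e i /^\ (e (i + 1) /^\ (e (i + 2) /^\ w i)))
    = - (e i /^\ (e (i + 2) /^\ w i)).
  rewrite 3!iprod_frame i1 i12 eqxx !scale0r scale1r iw wedge0r !sub0r oppr0.
  by rewrite wedge0r subr0.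
rewrite neg 2!iprod_frame i2 eqxx scale0r scale1r iw wedge0r sub0r subr0 opprK.
by rewrite !scalerA; congr (_ *: _); field; rewrite c0 !a0.
Qed.

End Point.
End TransverseLinearAlgebra.

(** * Exterior calculus *)

Section ExteriorCalculus.
Context {R : realType} {n : nat}.
Implicit Types (alpha beta gamma delta : 'rV[R]_n -> ext R n) (x : 'rV[R]_n).

Definition diff_form alpha x :=
  forall i I, derivable (fun y => alpha y I : R^o) x 'e_i.

Definition partial_form i alpha x : ext R n :=
  [ffun I : {set 'I_n} => partial i (fun y => alpha y I) x].

Lemma is_derive_big (T : Type) (r : seq T) (P : pred T) (F : T -> 'rV[R]_n -> R^o)
    (dF : T -> R^o) x v :
  (forall t, is_derive x v (F t) (dF t)) ->
  is_derive x v (fun y => \sum_(t <- r | P t) F t y : R^o) (\sum_(t <- r | P t) dF t).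
Proof.
move=> hF; elim: r => [|t r IH].
  under eq_fun do rewrite big_nil; rewrite big_nil; exact: is_derive_cst.
under eq_fun do rewrite big_cons; rewrite big_cons; case: (P t) => //.
exact: is_deriveD.
Qed.

Lemma derivable_big (T : Type) (r : seq T) (P : pred T) (F : T -> 'rV[R]_n -> R^o) x v :
  (forall t, derivable (F t) x v) ->
  derivable (fun y => \sum_(t <- r | P t) F t y : R^o) x v.
Proof.
move=> dF; apply: ex_derive; apply: is_derive_big => t.
exact: (derivableP (dF t)).
Qed.

Lemma is_derive_partial alpha x i I : diff_form alpha x ->
  is_derive x 'e_i (fun y => alpha y I : R^o) (partial_form i alpha x I).
Proof. by move=> da; rewrite ffunE; apply: derivableP; exact: da. Qed.

(** Differentiability and the value of the partial derivatives are obtained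
    together, from coefficientwise derivatives. *)
Lemma partial_formP alpha x (D : 'I_n -> ext R n) :
  (forall i I, is_derive x 'e_i (fun y => alpha y I : R^o) (D i I)) ->
  diff_form alpha x /\ forall i, partial_form i alpha x = D i.
Proof.
move=> hD; split=> [i I|i]; first exact: (@ex_derive _ _ _ _ _ _ _ (hD i I)).
by apply/ffunP => I; rewrite ffunE /partial; apply: derive_val.
Qed.

Lemma diff_formD_aux alpha beta x : diff_form alpha x -> diff_form beta x ->
  forall i I, is_derive x 'e_i (fun y => (alpha y + beta y) I : R^o)
    ((partial_form i alpha x + partial_form i beta x) I).
Proof.
move=> da db i I; rewrite [X in is_derive _ _ _ X]ffunE; under eq_fun do rewrite ffunE.
exact: (is_deriveD (is_derive_partial i I da) (is_derive_partial i I db)).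
Qed.

Lemma diff_formZ_aux (a : R) alpha x : diff_form alpha x ->
  forall i I, is_derive x 'e_i (fun y => (a *: alpha y) I : R^o)
    ((a *: partial_form i alpha x) I).
Proof.
move=> da i I; rewrite [X in is_derive _ _ _ X]ffunE; under eq_fun do rewrite ffunE.
exact: (is_deriveZ a (is_derive_partial i I da)).
Qed.

Lemma diff_form_wedge_aux alpha beta x : diff_form alpha x -> diff_form beta x ->
  forall i I, is_derive x 'e_i (fun y => (alpha y /^\ beta y) I : R^o)
    ((partial_form i alpha x /^\ beta x + alpha x /^\ partial_form i beta x) I).
Proof.
move=> da db i I; under eq_fun do rewrite ffunE.
rewrite [X in is_derive _ _ _ X]ffunE [X in X + _]ffunE [X in _ + X]ffunE -big_split /=.
apply: is_derive_big => J.
have h := is_deriveZ (ext_sign J (I :\: J)%SET : R)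
  (is_deriveM (is_derive_partial i J da) (is_derive_partial i (I :\: J)%SET db)).
by apply: (is_derive_eq h); rewrite /GRing.scale /=; ring.
Qed.

Lemma diff_formD alpha beta x : diff_form alpha x -> diff_form beta x ->
  diff_form (fun y => alpha y + beta y) x.
Proof. by move=> da db; case: (partial_formP (diff_formD_aux da db)). Qed.

Lemma diff_formZ (a : R) alpha x : diff_form alpha x ->
  diff_form (fun y => a *: alpha y) x.
Proof. by move=> da; case: (partial_formP (diff_formZ_aux a da)). Qed.

Lemma diff_form_wedge alpha beta x : diff_form alpha x -> diff_form beta x ->
  diff_form (fun y => alpha y /^\ beta y) x.
Proof. by move=> da db; case: (partial_formP (diff_form_wedge_aux da db)). Qed.

Lemma ext_dE alpha x : ext_d alpha x = \sum_i covec 'e_i /^\ partial_form i alpha x.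
Proof. by []. Qed.

Lemma ext_dD alpha beta x : diff_form alpha x -> diff_form beta x ->
  ext_d (fun y => alpha y + beta y) x = ext_d alpha x + ext_d beta x.
Proof.
move=> da db; have [_ H] := partial_formP (diff_formD_aux da db).
by rewrite !ext_dE -big_split; apply: eq_bigr => i _; rewrite H wedgeDr.
Qed.

Lemma ext_dZ (a : R) alpha x : diff_form alpha x ->
  ext_d (fun y => a *: alpha y) x = a *: ext_d alpha x.
Proof.
move=> da; have [_ H] := partial_formP (diff_formZ_aux a da).
by rewrite !ext_dE scaler_sumr; apply: eq_bigr => i _; rewrite H wedgeZr.
Qed.

Lemma ext_d_comb (a b c : R) alpha beta gamma delta x :
  diff_form alpha x -> diff_form beta x -> diff_form gamma x -> diff_form delta x ->
  ext_d (fun y => a *: alpha y + b *: (beta y + gamma y) + c *: delta y) x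
  = a *: ext_d alpha x + b *: (ext_d beta x + ext_d gamma x) + c *: ext_d delta x.
Proof.
move=> da db dc dd; have dbc := diff_formD db dc.
rewrite (ext_dD (diff_formD (diff_formZ (a := a) da) (diff_formZ (a := b) dbc)) (diff_formZ (a := c) dd)).
rewrite (ext_dD (diff_formZ (a := a) da) (diff_formZ (a := b) dbc)).
by rewrite (ext_dZ a da) (ext_dZ b dbc) (ext_dZ c dd) (ext_dD db dc).
Qed.

Lemma ext_d_wedge k alpha beta x : diff_form alpha x -> diff_form beta x ->
  homogeneous k (alpha x) ->
  ext_d (fun y => alpha y /^\ beta y) x
  = ext_d alpha x /^\ beta x + (-1) ^+ k *: (alpha x /^\ ext_d beta x).
Proof.
move=> da db ha; have [_ H] := partial_formP (diff_form_wedge_aux da db).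
rewrite !ext_dE wedge_suml wedge_sumr scaler_sumr -big_split; apply: eq_bigr => i _ /=.
rewrite H wedgeDr !wedgeA; congr (_ + _).
by rewrite (wedgeC (homogeneous_covec 'e_i) ha) mul1n wedgeZl.
Qed.

(** The exterior derivative is local: identities between forms that hold on the
    open image of a chart may be differentiated there. *)
Lemma ext_d_near alpha beta x : (\forall y \near x, alpha y = beta y) ->
  ext_d alpha x = ext_d beta x.
Proof.
move=> ab; rewrite !ext_dE; apply: eq_bigr => i _; congr (_ /^\ _).
apply/ffunP => I; rewrite !ffunE /partial.
apply: near_eq_derive; near=> y; have -> // : alpha y = beta y by near: y.
Unshelve. all: by end_near. Qed.

Lemma ext_d0 x : ext_d (fun=> 0 : ext R n) x = 0.
Proof.
rewrite ext_dE big1 // => i _; rewrite (_ : partial_form _ _ _ = 0) ?wedge0r //.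
apply/ffunP => I; rewrite !ffunE /partial (_ : (fun=> _) = cst 0) ?derive_cst //.
Qed.

Lemma smooth_derivable (U : set 'rV[R]_n) f x i :
  smooth_on U f -> U x -> derivable f x 'e_i.
Proof. by move=> /(_ 1%N) [_ /(_ i) [+ _]]; apply. Qed.

Lemma diff_form_covec (v : 'rV[R]_n -> 'rV[R]_n) x :
  (forall i j, derivable (fun y => v y 0 j : R^o) x 'e_i) ->
  diff_form (fun y => covec (v y)) x.
Proof.
move=> dv i I; under eq_fun do rewrite ffunE.
apply: ex_derive; apply: is_derive_big => j.
have := is_deriveM (derivableP (dv i j)) (is_derive_cst ((I == [set j]%SET)%:R : R^o) x 'e_i).
exact.
Qed.

End ExteriorCalculus.

(** * Torsion and Laplacian of the structures in the families *)

Section ThreeSasakian.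
Context {R : realType} {M : manifold R 7}.
Variables (g : mfield M) (E : 'I_3 -> vfield M).
Variables (omega : 'I_3 -> efield M) (nu : efield M).
Hypothesis hS : is_three_sasakian g E.
Hypothesis hT : is_transverse_data g E omega nu.

Local Notation e i k x := (covec (E i k x *m g k x)).
Local Notation e123 k x := (e 0 k x /^\ e 1 k x /^\ e 2 k x).
Local Notation w := omega.

Lemma sum_ord3 (V : zmodType) (F : 'I_3 -> V) : \sum_(i < 3) F i = F 0 + F 1 + F 2.
Proof.
rewrite !big_ord_recl big_ord0 addr0 addrA.
by congr (F _ + F _ + F _); apply: val_inj.
Qed.

Local Notation A i k y := (e (i + 1) k y /^\ e (i + 2) k y /^\ w i k y).
Local Notation B i k y := (e i k y /^\ w i k y).

(** phi and [star d phi] lie in the span of these 3-forms; psi, [d phi] and the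
    Laplacian of psi in that of the 4-forms [comb4].  The exterior derivative
    maps the first span to the second, and the Hodge stars of the metrics in the
    families map the second to the first. *)
Definition comb3 (P Q S : R) : efield M := fun k y =>
  P *: e123 k y + Q *: (B 0 k y + B 1 k y) + S *: B 2 k y.

Definition comb4 (P Q S : R) : efield M := fun k y =>
  P *: nu k y + Q *: (A 0 k y + A 1 k y) + S *: A 2 k y.

Definition weight (p : scales R) (i : 'I_3) : R := if i == 2 then sb p else sa p.

Section AtPoint.
Variables (k : chart M) (x : 'rV[R]_7).
Hypothesis kx : img k x.

Lemma metric_sym : (g k x)^T = g k x.
Proof. by case: hS => -[_ + _ _ _ _ _ _]; apply. Qed.

Lemma metric_unit : g k x \in unitmx.
Proof.
rewrite unitmxE unitfE; apply/det0P => -[v v0 vg].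
case: hS => -[_ _ /(_ k x v kx v0) + _] _ _ _ _.
by rewrite vg mul0mx mxE ltxx.
Qed.

Lemma frame_orth i j : (E i k x *m g k x *m (E j k x)^T) 0 0 = (i == j)%:R.
Proof. by case: hS => _ _ _ + _; apply. Qed.

Lemma omega_two i : homogeneous 2 (w i k x).
Proof. by case: hT => -[_ /(_ i) [h _ _]] _ _ _ _; exact: h. Qed.
Arguments omega_two : clear implicits.

Lemma nu_four : homogeneous 4 (nu k x).
Proof. by case: hT => -[[h _ _] _] _ _ _ _; exact: h. Qed.

Lemma iprod_omega i j : interior_product (E i k x) (w j k x) = 0.
Proof. by case: hT => _ /(_ i k x kx) [_ h] _ _ _; exact: h. Qed.

Lemma omega_wedge i j : w i k x /^\ w j k x = (2 * (i == j)%:R) *: nu k x.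
Proof. by case: hT => _ _ _ h _; exact: h. Qed.

(** Its square is the determinant of the metric. *)
Lemma volume_neq0 : (e123 k x /^\ nu k x) [set: 'I_7]%SET != 0.
Proof.
case: hT => _ _ /(_ k x kx) [h _] _ _.
apply: contraTneq metric_unit => v0; rewrite unitmxE -h.
by rewrite /eta123 /eta /dual_form v0 expr0n unitfE eqxx.
Qed.

Lemma star_omega i : star (g k x) (e123 k x /^\ nu k x) (w i k x)
  = e123 k x /^\ w i k x.
Proof. by case: hT => _ _ /(_ k x kx) [_ h] _ _; exact: h. Qed.

Lemma eta_diff i : diff_form (fun y => e i k y) x.
Proof.
apply: diff_form_covec => j l; under eq_fun do rewrite mxE.
case: hS => -[sg _ _ _] _ /(_ i) [[[sE _] _] _ _] _ _.
apply: derivable_big => m.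
exact: (derivableM (smooth_derivable (i := j) (sE k m) kx)
  (smooth_derivable (i := j) (sg k m l) kx)).
Qed.
Arguments eta_diff : clear implicits.

Lemma omega_diff i : diff_form (w i k) x.
Proof.
move=> j I; case: hT => -[_ /(_ i) [_ h _]] _ _ _ _.
exact: (smooth_derivable (i := j) (h k I) kx).
Qed.
Arguments omega_diff : clear implicits.

Lemma nu_diff : diff_form (nu k) x.
Proof.
move=> j I; case: hT => -[[_ h _] _] _ _ _ _.
exact: (smooth_derivable (i := j) (h k I) kx).
Qed.
Arguments nu_diff : clear implicits.

Lemma d_eta i : ext_d (fun y => e i k y) x
  = - 2 *: (e (i + 1) k x /^\ e (i + 2) k x) - 2 *: w i k x.
Proof. by case: hT => _ _ _ _ /(_ i k x kx) [h _]; exact: h. Qed.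

Lemma d_omega i : ext_d (w i k) x
  = - 2 *: (e (i + 1) k x /^\ w (i + 2) k x) + 2 *: (e (i + 2) k x /^\ w (i + 1) k x).
Proof. by case: hT => _ _ _ _ /(_ i k x kx) [_ h]; exact: h. Qed.

Lemma omega_wedgeC i alpha : w i k x /^\ alpha = alpha /^\ w i k x.
Proof. exact: wedge_twoC (omega_two i). Qed.

Lemma omega_wedge0 i j : i != j -> w i k x /^\ w j k x = 0.
Proof. by move=> ij; rewrite omega_wedge (negPf ij) mulr0 scale0r. Qed.

Lemma nu_omega i : nu k x /^\ w i k x = 0.
Proof.
have -> : nu k x = 2^-1 *: (w (i + 1) k x /^\ w (i + 1) k x).
  by rewrite omega_wedge eqxx mulr1 scalerA mulVf ?pnatr_eq0 // scale1r.
have [i1 _ _ _] := ord3_neq i.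
by rewrite wedgeZl -wedgeA omega_wedge0 ?i1 // wedge0r scaler0.
Qed.

Lemma eta_hom i : homogeneous 1 (e i k x).
Proof. exact: homogeneous_covec. Qed.
Arguments eta_hom : clear implicits.

Lemma eta2_hom i j : homogeneous 2 (e i k x /^\ e j k x).
Proof. exact: (homogeneous_wedge (eta_hom i) (eta_hom j)). Qed.
Arguments eta2_hom : clear implicits.

Lemma d_eta_eta i : ext_d (fun y => e (i + 1) k y /^\ e (i + 2) k y) x
  = 2 *: (e (i + 1) k x /^\ w (i + 2) k x) - 2 *: (e (i + 2) k x /^\ w (i + 1) k x).
Proof.
rewrite (ext_d_wedge (eta_diff _) (eta_diff _) (eta_hom _)) expr1 scaleN1r !d_eta.
have [s11 s12 s21 s22] := ord3_shift i; rewrite s11 s12 s21 s22.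
rewrite wedgeBl wedgeBr !(wedgeZl, wedgeZr) omega_wedgeC.
rewrite -wedgeA (covecC (E i k x *m _)) wedgeNr wedgeA covec_sq wedge0l oppr0.
rewrite (covecC (E i k x *m _)) wedgeNr wedgeA covec_sq wedge0l oppr0 !scaler0.
by rewrite !sub0r opprK addrC.
Qed.

Lemma d_A i : ext_d (fun y => A i k y) x = 0.
Proof.
rewrite (ext_d_wedge (diff_form_wedge (eta_diff _) (eta_diff _)) (omega_diff _)
  (eta2_hom _ _)) d_eta_eta d_omega sqrrN expr1n scale1r.
have [i1 i2 _ _] := ord3_neq i.
rewrite wedgeBl wedgeDr !(wedgeZl, wedgeZr) -!wedgeA !omega_wedge0 ?i1 ?i2 //.
rewrite !wedge0r !scaler0 subrr add0r.
rewrite [e (i + 2) k x /^\ (e (i + 1) k x /^\ _)]wedgeA (covecC (E (i + 2) k x *m _)).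
rewrite wedgeNl wedgeNr !wedgeA !covec_sq !wedge0l oppr0 scaler0 add0r.
by rewrite -[e (i + 1) k x /^\ _ /^\ _]wedgeA covec_sq wedge0r wedge0l scaler0.
Qed.

(** [nu] is half the square of [w 0], and [d (w 0)] only involves [w 1] and
    [w 2], whose products with [w 0] vanish. *)
Lemma d_nu : ext_d (nu k) x = 0.
Proof.
have nuE y : img k y -> nu k y = 2^-1 *: (w 0 k y /^\ w 0 k y).
  move=> ky; case: hT => _ _ _ h _; rewrite h // eqxx mulr1 scalerA.
  by rewrite mulVf ?pnatr_eq0 // scale1r.
rewrite (@ext_d_near _ _ _ (fun y => 2^-1 *: (w 0 k y /^\ w 0 k y))); last first.
  have := open_nbhs_nbhs (conj (@img_open _ _ M k) kx); apply: filterS => y; exact: nuE.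
rewrite ext_dZ; last by apply: diff_form_wedge; exact: omega_diff.
rewrite (ext_d_wedge (omega_diff _) (omega_diff _) (omega_two _)) d_omega !add0r.
rewrite sqrrN expr1n scale1r [in X in _ + X]omega_wedgeC.
rewrite wedgeDl !wedgeZl -!wedgeA !omega_wedge0 //.
by rewrite !wedge0r !scaler0 !addr0 scaler0.
Qed.

Lemma d_e123 : ext_d (fun y => e123 k y) x = - 2 *: (A 0 k x + A 1 k x + A 2 k x).
Proof.
have := d_eta_eta 2.
have [a11 a12 a21 a22] := ord3_add; rewrite a21 a22 a11 a12.
rewrite !add0r => dee.
rewrite (ext_d_wedge (diff_form_wedge (eta_diff _) (eta_diff _)) (eta_diff _)
  (eta2_hom _ _)) dee d_eta sqrrN expr1n scale1r.
rewrite a21 a22.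
rewrite wedgeBl wedgeBr !(wedgeZl, wedgeZr) -!wedgeA.
rewrite [e 1 k x /^\ (e 0 k x /^\ _)]wedgeA (covecC (E 1 k x *m _) (E 0 k x *m _)).
rewrite wedgeNl wedgeNr -wedgeA covec_sq !wedge0r oppr0 scaler0 sub0r.
rewrite !omega_wedgeC !wedgeA (covecC (E 0 k x *m _) (E 2 k x *m _)) !wedgeNl.
rewrite !scalerDr scalerN !scaleNr; congr (_ - _).
by rewrite addrC.
Qed.

Lemma d_B i : ext_d (fun y => B i k y) x
  = - 4 *: nu k x + 2 *: (A 0 k x + A 1 k x + A 2 k x) - 4 *: A i k x.
Proof.
have -> : A 0 k x + A 1 k x + A 2 k x = A i k x + A (i + 1) k x + A (i + 2) k x.
  have [a11 a12 a21 a22] := ord3_add.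
  have [-> | -> | ->] := ord3P i.
  - by rewrite !add0r.
  - by rewrite a11 a12 -addrA addrC.
  - by rewrite a21 a22 addrC addrA.
rewrite (ext_d_wedge (eta_diff _) (omega_diff _) (eta_hom _)) expr1 scaleN1r.
rewrite d_eta d_omega.
have [s11 s12 s21 s22] := ord3_shift i; rewrite s11 s12 s21 s22.
rewrite wedgeBl wedgeDr !(wedgeZl, wedgeZr) omega_wedge eqxx mulr1 !wedgeA.
rewrite (covecC (E (i + 2) k x *m _) (E i k x *m _)) wedgeNl.
move: (nu k x) (A i k x) => v a.
move: (e i k x /^\ e (i + 1) k x /^\ w (i + 2) k x) => b.
move: (e i k x /^\ e (i + 2) k x /^\ w (i + 1) k x) => c.
apply/ffunP => I; rewrite !ffunE /GRing.scale /=; ring.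
Qed.

Lemma d_comb3 (P Q S : R) : ext_d (fun y => comb3 P Q S k y) x
  = comb4 (- 8 * Q - 4 * S) (- 2 * P + 2 * S) (- 2 * P + 4 * Q - 2 * S) k x.
Proof.
have d123 : diff_form (fun y => e123 k y) x.
  by do 2! [apply: diff_form_wedge; last exact: eta_diff]; exact: eta_diff.
have dB i : diff_form (fun y => B i k y) x.
  by apply: diff_form_wedge; [exact: eta_diff | exact: omega_diff].
rewrite /comb3 (ext_d_comb P Q S d123 (dB 0) (dB 1) (dB 2)).
rewrite d_e123 !d_B /comb4; move: (nu k x) (A 0 k x) (A 1 k x) (A 2 k x) => v a0 a1 a2.
apply/ffunP => I; rewrite !ffunE /GRing.scale /=; ring.
Qed.

Lemma d_comb4 (P Q S : R) : ext_d (fun y => comb4 P Q S k y) x = 0.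
Proof.
have dA i : diff_form (fun y => A i k y) x.
  apply: diff_form_wedge; last exact: omega_diff.
  by apply: diff_form_wedge; exact: eta_diff.
rewrite /comb4 (ext_d_comb P Q S (nu_diff) (dA 0) (dA 1) (dA 2)).
by rewrite d_nu !d_A addr0 !scaler0 !addr0.
Qed.

Lemma metric_rescaled (p : scales R) :
  metric g E p k x = rescaled_metric (g k x) (fun i => E i k x) (weight p) (sc p).
Proof.
case: p => a b c; rewrite /rescaled_metric /metric /eta_mx !sum_ord3 /weight /=.
by rewrite -!scalerDr.
Qed.

Lemma star_comb4 (eps : R) (p : scales R) (P Q S : R) : positive_scales p ->
  star (metric g E p k x) (volume g E nu eps p k x) (comb4 P Q S k x)
  = comb3 (P * (eps * sa p ^+ 2 * sb p / sc p ^+ 4)) (Q * (eps / sb p))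
      (S * (eps * sb p / sa p ^+ 2)) k x.
Proof.
move=> [pa pb pc]; rewrite metric_rescaled.
have a0 i : weight p i != 0 by rewrite /weight; case: ifP => _; rewrite gt_eqF.
have c0 : sc p != 0 by rewrite gt_eqF.
have -> : volume g E nu eps p k x
    = (eps * sa p ^+ 2 * sb p * sc p ^+ 4) *: (e123 k x /^\ nu k x) by case: (p).
rewrite /comb4 !(starD, starZ).
have SA i := star_rescaled_mixed metric_sym metric_unit frame_orth omega_two
  iprod_omega star_omega a0 c0 (eps * sa p ^+ 2 * sb p * sc p ^+ 4) i.
rewrite !SA (star_rescaled_nu metric_sym metric_unit frame_orth omega_two nu_four
  iprod_omega omega_wedge volume_neq0 star_omega a0 c0) !scalerDr !scalerA.
have pa0 : sa p != 0 by rewrite gt_eqF.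
have pb0 : sb p != 0 by rewrite gt_eqF.
rewrite /comb3 scalerDr.
by congr (_ *: _ + (_ *: _ + _ *: _) + _ *: _); rewrite /weight /=; field; rewrite ?c0 ?pa0 ?pb0.
Qed.

Lemma cyclic_e123 i : e i k x /^\ e (i + 1) k x /^\ e (i + 2) k x = e123 k x.
Proof. exact: (@e123_cyclic R (g k x) (fun i => E i k x)). Qed.

Lemma eta_e123 i : e i k x /^\ e123 k x = 0.
Proof. by rewrite -(cyclic_e123 i) -wedgeA wedgeA covec_sq wedge0l. Qed.

Lemma A_e123 i : A i k x /^\ e123 k x = 0.
Proof.
have -> : A i k x = e (i + 1) k x /^\ w i k x /^\ e (i + 2) k x.
  by rewrite -!wedgeA omega_wedgeC.
by rewrite -[_ /^\ _ /^\ (_ /^\ _ /^\ _)]wedgeA eta_e123 wedge0r.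
Qed.

Lemma A_B i j : A i k x /^\ B j k x = (2 * (i == j)%:R) *: (e123 k x /^\ nu k x).
Proof.
have -> : A i k x /^\ B j k x
    = e (i + 1) k x /^\ e (i + 2) k x /^\ e j k x /^\ (w i k x /^\ w j k x).
  by rewrite -!wedgeA [w i k x /^\ (_ /^\ _)]wedgeA omega_wedgeC -!wedgeA.
rewrite omega_wedge wedgeZr; case: (eqVneq i j) => [<-|_]; last by rewrite mulr0 !scale0r.
congr (_ *: (_ /^\ _)); rewrite -(cyclic_e123 (i + 1)); congr (_ /^\ _ /^\ _).
  by congr (covec (E _ k x *m _)); rewrite -addrA; congr (_ + _); apply: val_inj.
by congr (covec (E _ k x *m _)); rewrite -addrA (_ : 1 + 2 = 0) ?addr0 //; apply: val_inj.
Qed.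

Lemma nu_B i : nu k x /^\ B i k x = 0.
Proof. by rewrite -omega_wedgeC wedgeA nu_omega wedge0l. Qed.

Lemma comb4_wedge (P Q S : R) theta : comb4 P Q S k x /^\ theta
  = P *: (nu k x /^\ theta) + Q *: (A 0 k x /^\ theta + A 1 k x /^\ theta)
    + S *: (A 2 k x /^\ theta).
Proof.
rewrite /comb4; move: (nu k x) (A 0 k x) (A 1 k x) (A 2 k x) => v a0 a1 a2.
by rewrite !(wedgeDl, wedgeZl).
Qed.

Lemma comb4_e123 (P Q S : R) :
  comb4 P Q S k x /^\ e123 k x = P *: (e123 k x /^\ nu k x).
Proof.
rewrite comb4_wedge (A_e123 0) (A_e123 1) (A_e123 2) addr0 !scaler0 !addr0.
rewrite (wedgeC nu_four (homogeneous_wedge (eta2_hom 0 1) (eta_hom 2))).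
by rewrite exprM (_ : (-1) ^+ 4 = 1) ?expr1n ?scale1r // -signr_odd.
Qed.

Lemma comb4_B0 (P Q S : R) :
  comb4 P Q S k x /^\ B 0 k x = (2 * Q) *: (e123 k x /^\ nu k x).
Proof.
rewrite comb4_wedge (A_B 0 0) (A_B 1 0) (A_B 2 0) (nu_B 0) /=.
rewrite mulr1 mulr0 !scale0r !scaler0 !addr0 add0r.
by rewrite scalerA mulrC.
Qed.

Lemma comb4_B2 (P Q S : R) :
  comb4 P Q S k x /^\ B 2 k x = (2 * S) *: (e123 k x /^\ nu k x).
Proof.
rewrite comb4_wedge (A_B 0 2) (A_B 1 2) (A_B 2 2) (nu_B 2) /=.
rewrite mulr1 mulr0 !scale0r !addr0 !scaler0 !add0r.
by rewrite scalerA mulrC.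
Qed.

(** The coefficients are read off by wedging with e123, [B 0] and [B 2], which are
    dual to the three summands up to factors. *)
Lemma comb4_inj (P Q S P' Q' S' : R) : comb4 P Q S k x = comb4 P' Q' S' k x ->
  [/\ P = P', Q = Q' & S = S'].
Proof.
have inj a b : a *: (e123 k x /^\ nu k x) = b *: (e123 k x /^\ nu k x) -> a = b.
  exact: (@vol_scale_inj R (g k x) (fun i => E i k x) _ volume_neq0).
move=> h; split.
- by apply: inj; rewrite -!(comb4_e123 _ Q S) h comb4_e123 !comb4_e123.
- have := congr1 (fun z => z /^\ B 0 k x) h; rewrite /= !comb4_B0 => /inj.
  by apply: mulfI; rewrite pnatr_eq0.
- have := congr1 (fun z => z /^\ B 2 k x) h; rewrite /= !comb4_B2 => /inj.
  by apply: mulfI; rewrite pnatr_eq0.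
Qed.

End AtPoint.

Lemma phi_comb3 (eps : R) (p : scales R) k x :
  phi g E omega eps p k x = comb3 (eps * sa p ^+ 2 * sb p) (- (sa p * sc p ^+ 2))
    (- (eps * sb p * sc p ^+ 2)) k x.
Proof. by case: p => a b c; rewrite /phi /comb3 !scaleNr. Qed.

Lemma psi_comb4 (eps : R) (p : scales R) k x :
  psi g E omega nu eps p k x = comb4 (sc p ^+ 4) (- (eps * sa p * sb p * sc p ^+ 2))
    (- (sa p ^+ 2 * sc p ^+ 2)) k x.
Proof.
have [e11 e12 e21 e22] := ord3_add.
by case: p => a b c; rewrite /psi /comb4 !scaleNr /= e11 e12 e21 e22 !add0r.
Qed.

Definition dphi_coef (eps : R) (p : scales R) : R * R * R :=
  let: Scales a b c := p in
  (4 * c ^+ 2 * (2 * a + eps * b), - 2 * eps * b * (a ^+ 2 + c ^+ 2),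
   - 2 * (eps * a ^+ 2 * b + 2 * a * c ^+ 2 - eps * b * c ^+ 2)).

Lemma d_phi (eps : R) (p : scales R) k x : img k x ->
  ext_d (phi g E omega eps p k) x
  = comb4 (dphi_coef eps p).1.1 (dphi_coef eps p).1.2 (dphi_coef eps p).2 k x.
Proof.
move=> kx; 
have -> : phi g E omega eps p k = comb3 (eps * sa p ^+ 2 * sb p)
    (- (sa p * sc p ^+ 2)) (- (eps * sb p * sc p ^+ 2)) k.
  by apply/funext => y; exact: phi_comb3.
rewrite (d_comb3 kx); case: p => a b c /=.
by congr (comb4 _ _ _ k x); ring.
Qed.

(** The coordinates of [star d phi] in terms of [comb3], up to the use of
    [eps * eps = 1]. *)
Definition torsion_coef (eps : R) (p : scales R) : R * R * R :=
  let: Scales a b c := p in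
  (4 * eps * a ^+ 2 * b * (2 * a + eps * b) / c ^+ 2, - 2 * (a ^+ 2 + c ^+ 2),
   - 2 * (b / a ^+ 2) * (a ^+ 2 * b + 2 * eps * a * c ^+ 2 - b * c ^+ 2)).

Definition laplacian_coef (eps : R) (p : scales R) : R * R * R :=
  let: (P, Q, T) := torsion_coef eps p in
  (- 8 * Q - 4 * T, - 2 * P + 2 * T, - 2 * P + 4 * Q - 2 * T).

(** As psi is closed and [star psi = phi], the Laplacian is [d (star (d phi))], with
    [d^* = star d star] on 4-forms in dimension 7. *)
Lemma laplacian_comb4 (eps : R) (p : scales R) k x :
  eps * eps = 1 -> positive_scales p -> img k x ->
  laplacian_psi g E omega nu eps p k x
  = comb4 (laplacian_coef eps p).1.1 (laplacian_coef eps p).1.2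
      (laplacian_coef eps p).2 k x.
Proof.
move=> eps2 pp kx; have [pa pb pc] := pp.
have pa0 : sa p != 0 by rewrite gt_eqF.
have pb0 : sb p != 0 by rewrite gt_eqF.
have c0 : sc p != 0 by rewrite gt_eqF.
have near_img (P : 'rV[R]_7 -> Prop) y : img k y -> (forall z, img k z -> P z) ->
    \forall z \near y, P z.
  by move=> ky H; apply: filterS (open_nbhs_nbhs (conj (@img_open _ _ M k) ky)).
have eps0 : eps != 0.
  by apply/eqP => e0; move: eps2; rewrite e0 mul0r => /esym/eqP; rewrite oner_eq0.
have dpsi y : img k y -> ext_d (psi g E omega nu eps p k) y = 0.
  move=> ky; have -> : psi g E omega nu eps p k = comb4 (sc p ^+ 4)
      (- (eps * sa p * sb p * sc p ^+ 2)) (- (sa p ^+ 2 * sc p ^+ 2)) k.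
    by apply/funext => z; exact: psi_comb4.
  exact: d_comb4.
have star_psi y : img k y -> hodge (metric g E p k) (volume g E nu eps p k)
    (psi g E omega nu eps p k) y = phi g E omega eps p k y.
  move=> ky; rewrite /hodge psi_comb4 star_comb4 // phi_comb3.
  congr (comb3 _ _ _ k y); first by field; rewrite c0.
    by transitivity (- (eps * eps) * sa p * sc p ^+ 2); [field | rewrite eps2; ring].
  by field.
rewrite /laplacian_psi /hodge_laplacian.
have -> : codiff (metric g E p k) (volume g E nu eps p k) 5
    (ext_d (psi g E omega nu eps p k)) x = 0.
  rewrite /codiff /hodge (@ext_d_near _ _ _ (fun=> 0)) ?ext_d0 ?star_zero ?scaler0 //.
  by apply: (near_img _ _ kx) => y ky; rewrite dpsi // star_zero.
rewrite addr0.
rewrite (@ext_d_near _ _ _ (comb3 (torsion_coef eps p).1.1 (torsion_coef eps p).1.2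
  (torsion_coef eps p).2 k)).
  by rewrite (d_comb3 kx) /laplacian_coef; case: (torsion_coef eps p) => -[].
apply: (near_img _ _ kx) => y ky; rewrite /codiff.
rewrite (_ : (-1) ^+ _ = 1 :> R) ?scale1r; last by rewrite -signr_odd.
rewrite {1}/hodge (@ext_d_near _ _ _ (phi g E omega eps p k)); last exact: (near_img _ _ ky).
rewrite d_phi // star_comb4 //.
move: pa0 pb0 c0; case: (p) => a b c /= pa0 pb0 c0.
congr (comb3 _ _ _ k y).
- by field.
- by transitivity (- 2 * (eps * eps) * (a ^+ 2 + c ^+ 2)); [field | rewrite eps2; ring].
transitivity (- 2 * (b / a ^+ 2) * ((eps * eps) * (a ^+ 2 * b) + 2 * eps * a * c ^+ 2
  - (eps * eps) * b * c ^+ 2)); first by field.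
by rewrite eps2; field.
Qed.

End ThreeSasakian.

(** * One-variable analysis *)

Section RealAnalysis.
Context {R : realType}.
Implicit Types (f g h : R -> R) (a b c s t x : R).

Lemma is_derive_continuous f (t d : R) : is_derive t 1 f d -> {for t, continuous f}.
Proof. by move=> h; apply/differentiable_continuous/derivable1_diffP; exact: ex_derive. Qed.

Lemma is_derive_mull (c t : R) : is_derive t 1 (fun s => c * s) c.
Proof.
by have := @is_deriveZ _ _ _ id c t 1 1 (is_derive_id _ _); rewrite /GRing.scale /= mulr1.
Qed.

Lemma nonincreasing_of_derive f (df : R -> R) a b : a <= b ->
  (forall t, a < t < b -> is_derive t 1 f (df t)) ->
  {within `[a, b], continuous f} ->
  (forall t, a < t < b -> df t <= 0) -> f b <= f a.
Proof.
rewrite le_eqVlt => /predU1P[->//|ab] hf cf hd.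
have hf' t : t \in `]a, b[ -> is_derive t 1 f (df t) by rewrite in_itv /=; exact: hf.
have [c cab E] := MVT ab hf' cf.
move: cab; rewrite in_itv /= => cab.
rewrite -subr_le0 E mulr_le0_ge0 ?hd // subr_ge0 ltW //.
Qed.

Lemma derive_le0 f (df : R -> R) a b : a <= b ->
  (forall t, a <= t <= b -> is_derive t 1 f (df t)) ->
  (forall t, a < t < b -> df t <= 0) -> f b <= f a.
Proof.
move=> ab hf hd; apply: (nonincreasing_of_derive ab (df := df)) => //.
  by move=> t /andP[h1 h2]; apply: hf; rewrite !ltW.
apply: continuous_in_subspaceT => t; rewrite inE /= in_itv /= => /hf.
exact: is_derive_continuous.
Qed.

Lemma derive_ge0 f (df : R -> R) a b : a <= b ->
  (forall t, a <= t <= b -> is_derive t 1 f (df t)) ->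
  (forall t, a < t < b -> 0 <= df t) -> f a <= f b.
Proof.
move=> ab hf hd; rewrite -lerN2.
apply: (@derive_le0 (fun t => - f t) (fun t => - df t)) => // t h.
  by have := hf t h => ?; apply: is_deriveN.
by rewrite oppr_le0 hd.
Qed.

Lemma derive_dominated f g (df dg : R -> R) b : 0 <= b ->
  (forall t, 0 <= t <= b -> is_derive t 1 f (df t)) ->
  (forall t, 0 <= t <= b -> is_derive t 1 g (dg t)) ->
  `|f 0| <= g 0 -> (forall t, 0 < t < b -> `|df t| <= dg t) -> `|f b| <= g b.
Proof.
move=> b0 hf hg h0 hd.
have H1 : f b - g b <= f 0 - g 0.
  apply: (@derive_le0 (fun t => f t - g t) (fun t => df t - dg t)) => // t ht.
    exact: (is_deriveB (hf t ht) (hg t ht)).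
  by rewrite subr_le0 (le_trans (ler_norm _)) // hd.
have H2 : - f b - g b <= - f 0 - g 0.
  apply: (@derive_le0 (fun t => - f t - g t) (fun t => - df t - dg t)) => // t ht.
    exact: (is_deriveB (is_deriveN (hf t ht)) (hg t ht)).
  by rewrite subr_le0 (le_trans (ler_norm _)) // normrN hd.
move: h0; rewrite !ler_norml => /andP[h1 h2]; apply/andP; split; lra.
Qed.

Lemma max_lip c s t : `|Num.max c s - Num.max c t| <= `|s - t|.
Proof.
have := ler_norm (s - t); have := ler_norm (t - s); rewrite (distrC t s) => n1 n2.
have n0 := normr_ge0 (s - t).
by case: (leP c s) => h1; case: (leP c t) => h2; rewrite ler_norml; apply/andP; split; lra.
Qed.

Lemma min_lip c s t : `|Num.min c s - Num.min c t| <= `|s - t|.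
Proof.
have := ler_norm (s - t); have := ler_norm (t - s); rewrite (distrC t s) => n1 n2.
have n0 := normr_ge0 (s - t).
by case: (leP c s) => h1; case: (leP c t) => h2; rewrite ler_norml; apply/andP; split; lra.
Qed.

Definition lipschitz_fun (L : R) f := forall s t, `|f s - f t| <= L * `|s - t|.

Lemma lipschitz_continuous L f : lipschitz_fun L f -> continuous f.
Proof.
move=> hL t; apply/cvgrPdist_le => /= e e0.
have L1 : 0 < `|L| + 1 by rewrite ltr_wpDl.
near=> s; rewrite (le_trans (hL t s)) //.
apply: (@le_trans _ _ ((`|L| + 1) * `|t - s|)).
  by rewrite ler_wpM2r // (le_trans (ler_norm L)) // lerDl.
rewrite -ler_pdivlMl //; near: s.
have t_t : (fun s : R => s) @ t --> t by exact: cvg_id.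
by apply: (cvgr_dist_le _ _ t_t); rewrite mulr_gt0 // invr_gt0.
Unshelve. all: by end_near. Qed.

(** The primitive is taken from a base point before 0, so that it has a two-sided
    derivative at 0. *)
Lemma antiderivative h : continuous h ->
  exists2 H : R -> R, H 0 = 0 & forall s, -1 < s -> is_derive s 1 H (h s).
Proof.
move=> ch; pose mu := @lebesgue_measure R.
pose F x := (\int[mu]_(t in [set` `[-1, x]]) (h t))%R.
exists (fun s => F s - F 0); first by rewrite subrr.
move=> s s1; have ss1 : s < s + 1 by rewrite ltrDl.
have ih : mu.-integrable `[-1, s + 1] (EFin \o h).
  apply: continuous_compact_integrable; first exact: segment_compact.
  exact: continuous_subspaceT.
have [dF F'] := continuous_FTC1_closed ss1 ih s1 (ch s).
have dF1 : is_derive s 1 F (h s) by apply: DeriveDef => //; rewrite -derive1E.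
have := is_deriveB dF1 (is_derive_cst (F 0) s 1).
by rewrite subr0.
Qed.

(** The sequences [v n -+ 2 C / 2^n] are monotone and enclose the limit. *)
Lemma geometric_limit (v : nat -> R) C :
  (forall n, `|v n.+1 - v n| <= C * 2^-1 ^+ n) ->
  exists l, forall n, `|l - v n| <= 2 * C * 2^-1 ^+ n.
Proof.
move=> hv; pose a n := v n - 2 * C * 2^-1 ^+ n; pose b n := v n + 2 * C * 2^-1 ^+ n.
have C0 : 0 <= C by have := le_trans (normr_ge0 _) (hv 0); rewrite expr0 mulr1.
have aS n : a n <= a n.+1.
  have := hv n; rewrite ler_norml => /andP[h _]; rewrite /a exprS; lra.
have bS n : b n.+1 <= b n.
  have := hv n; rewrite ler_norml => /andP[_ h]; rewrite /b exprS; lra.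
have ab n : a n <= b n.
  have : 0 <= C * 2^-1 ^+ n by rewrite mulr_ge0 // exprn_ge0.
  by rewrite /a /b; lra.
have amono := homo_leq (@lexx _ R) (@le_trans _ R) aS.
have bmono m n : (m <= n)%N -> b n <= b m.
  by move=> mn; apply: (@homo_leq _ b (fun x y => y <= x)) => // x y z h1 h2; exact: le_trans h2 h1.
have abmn m n : a m <= b n.
  apply: (le_trans (amono m (maxn m n) (leq_maxl _ _))).
  by apply: (le_trans (ab _)); apply: bmono; exact: leq_maxr.
have sA : has_sup (range a).
  split; first by exists (a 0), 0%N.
  by exists (b 0) => _ [n _ <-]; exact: abmn.
exists (sup (range a)) => n; rewrite ler_norml; apply/andP; split.
  have : a n <= sup (range a) by apply: sup_upper_bound => //; exists n.
  by rewrite /a; lra.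
have : sup (range a) <= b n.
  by apply: ge_sup; [exact: sA.1 | move=> _ [m _ <-]; exact: abmn].
by rewrite /b; lra.
Qed.

(** The rules of calculus for functions written pointwise: derivatives of large
    expressions are built from these as terms. *)
Lemma deriveD_fun (f g : R -> R) t a b : is_derive t 1 f a -> is_derive t 1 g b ->
  is_derive t 1 (fun s => f s + g s) (a + b).
Proof. exact: is_deriveD. Qed.

Lemma deriveN_fun (f : R -> R) t a : is_derive t 1 f a ->
  is_derive t 1 (fun s => - f s) (- a).
Proof. exact: is_deriveN. Qed.

Lemma deriveM_fun (f g : R -> R) t a b : is_derive t 1 f a -> is_derive t 1 g b ->
  is_derive t 1 (fun s => f s * g s) (a * g t + f t * b).
Proof.
move=> hf hg; apply: (is_derive_eq (is_deriveM hf hg)); rewrite /GRing.scale /=; ring.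
Qed.

Lemma deriveV_fun (f : R -> R) t a : is_derive t 1 f a -> f t != 0 ->
  is_derive t 1 (fun s => (f s)^-1) (- (a / f t ^+ 2)).
Proof.
move=> hf f0; have hV := is_deriveV f0 hf.
by apply: (is_derive_eq hV); rewrite /GRing.scale /=; field.
Qed.

Lemma deriveX_fun (f : R -> R) t a : is_derive t 1 f a ->
  is_derive t 1 (fun s => f s ^+ 2) (2 * f t * a).
Proof.
by move=> hf; apply: (is_derive_eq (deriveM_fun hf hf)); ring.
Qed.

Lemma derive_cst_fun (c t : R) : is_derive t 1 (fun=> c) 0.
Proof. exact: is_derive_cst. Qed.

End RealAnalysis.

(** * Picard iteration *)

Section Picard.
Context {R : realType} {I : finType}.
Implicit Types (i j : I) (s t r : R) (n : nat).
Variables (F : I -> (I -> R) -> R) (L B : R) (x0 : I -> R).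
Hypothesis L0 : 0 <= L.
Hypothesis F_lip : forall i u v, `|F i u - F i v| <= L * \sum_j `|u j - v j|.
Hypothesis F_bound : forall i u, `|F i u| <= B.

Let pos (s : R) := Num.max s 0.
Let card := #|I|%:R : R.
Let K := 2 * L * card + 1.
Let C := \sum_j `|F j x0|.

Let B0 : forall i : I, 0 <= B.
Proof. by move=> i; exact: le_trans (normr_ge0 _) (F_bound i x0). Qed.

Let K1 : 1 <= K.
Proof. by rewrite lerDr mulr_ge0 // mulr_ge0. Qed.

Let pos_lip (s t : R) : `|pos s - pos t| <= `|s - t|.
Proof.
by rewrite /pos !(maxC _ 0) max_lip.
Qed.

(* The field is evaluated at non-negative times only, so that the bounds are
   needed there only while the curves extend to negative times. *)
Let field (u : I -> R -> R) i s := F i (fun j => u j (pos s)).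

Let half_lip (u : I -> R -> R) :=
  forall i s t, 0 <= s -> 0 <= t -> `|u i s - u i t| <= B * `|s - t|.

Let field_continuous u i : half_lip u -> continuous (field u i).
Proof.
move=> hu; apply: (@lipschitz_continuous R (L * (card * B))) => s t.
apply: (le_trans (F_lip _ _ _)); rewrite -!mulrA ler_wpM2l //.
apply: (@le_trans _ _ (\sum_(j : I) B * `|s - t|)).
  apply: ler_sum => j _; apply: (le_trans (hu _ _ _ _ _)); rewrite ?le_max ?lexx ?orbT //.
  by rewrite ler_wpM2l // (B0 i).
by rewrite sumr_const -[_ *+ _]mulr_natl.
Qed.

Let primitive_lip (H : I -> R -> R) u :
  (forall i s, -1 < s -> is_derive s 1 (H i) (field u i s)) -> half_lip H.
Proof.
move=> hH i; suff le s t : 0 <= s -> s <= t -> `|H i t - H i s| <= B * (t - s).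
  move=> s t s0 t0; case: (leP s t) => st.
    by rewrite distrC [`|s - t|]distrC [`|t - s|]ger0_norm ?subr_ge0 // le.
  by rewrite [`|s - t|]ger0_norm ?subr_ge0 ?le // ltW.
move=> s0 st; have sN1 r : s <= r -> -1 < r by move=> ?; lra.
rewrite ler_norml; apply/andP; split.
  rewrite -subr_ge0 opprK.
  have := @derive_ge0 R (fun r => H i r + B * r) (fun r => field u i r + B) s t st.
  have -> : H i t - H i s + B * (t - s) = (H i t + B * t) - (H i s + B * s) by ring.
  rewrite subr_ge0; apply=> r /andP[h1 h2].
    exact: (is_deriveD (hH i r (sN1 _ h1)) (is_derive_mull B r)).
  by have := F_bound i (fun j => u j (pos r)); rewrite ler_norml => /andP[h _]; rewrite /field; lra.
rewrite -subr_le0.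
have := @derive_le0 R (fun r => H i r - B * r) (fun r => field u i r - B) s t st.
have -> : H i t - H i s - B * (t - s) = (H i t - B * t) - (H i s - B * s) by ring.
rewrite subr_le0; apply=> r /andP[h1 h2].
  exact: (is_deriveB (hH i r (sN1 _ h1)) (is_derive_mull B r)).
by have := F_bound i (fun j => u j (pos r)); rewrite ler_norml => /andP[_ h]; rewrite /field; lra.
Qed.

Let integral_curve u : half_lip u -> exists H : I -> R -> R,
  [/\ half_lip H, forall i, H i 0 = x0 i &
      forall i s, -1 < s -> is_derive s 1 (H i) (field u i s)].
Proof.
move=> hu.
have /choice [H hH] : forall i, exists H : R -> R,
    H 0 = x0 i /\ forall s, -1 < s -> is_derive s 1 H (field u i s).
  move=> i; have [H H0 dH] := antiderivative (@field_continuous _ i hu).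
  exists (fun s => x0 i + H s); split; first by rewrite H0 addr0.
  move=> s s1; have dHs := dH s s1.
  by have := is_deriveD (is_derive_cst (x0 i) s 1) dHs; rewrite add0r.
have dH i s (lt_s : -1 < s) := (hH i).2 s lt_s.
exists H; split=> //; first exact: primitive_lip dH.
by move=> i; exact: (hH i).1.
Qed.

Let curve := {u : I -> R -> R | half_lip u}.

Let step_ex (u : curve) : exists v : curve, (forall i, sval v i 0 = x0 i) /\
  forall i s, -1 < s -> is_derive s 1 (sval v i) (field (sval u) i s).
Proof.
by case: u => u hu; have [H [hH H0 dH]] := integral_curve hu; exists (exist _ H hH).
Qed.

Let step u := sval (cid (step_ex u)).
Let stepP u := svalP (cid (step_ex u)).

Let const_lip : half_lip (fun i _ => x0 i).
Proof. by move=> i s t _ _; rewrite subrr normr0 mulr_ge0 // (B0 i). Qed.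

Let iterate n : curve := iter n step (exist _ _ const_lip).
Let u n := sval (iterate n).

Let u0 n i : u n i 0 = x0 i.
Proof. by case: n => [//|n]; exact: (stepP _).1. Qed.

Let du n i s : -1 < s -> is_derive s 1 (u n.+1 i) (field (u n) i s).
Proof. exact: (stepP _).2. Qed.

Let bound D n s := D * 2^-1 ^+ n * expR (K * s).

Let d_bound D n s : is_derive s 1 (bound D n) (D * 2^-1 ^+ n * (K * expR (K * s))).
Proof.
have h := is_derive1_comp (is_derive_expR (K * s)) (is_derive_mull K s).
apply: (is_derive_eq (is_deriveZ (D * 2^-1 ^+ n) h)).
by rewrite /GRing.scale /= [X in _ * X]mulrC.
Qed.

Let bound_ge0 D n s : 0 <= D -> 0 <= bound D n s.
Proof.
by move=> D0; rewrite mulr_ge0 ?expR_ge0 // mulr_ge0 // exprn_ge0 // invr_ge0.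
Qed.

(* One Picard step halves the distance of two curves weighted by expR (K * s):
   the integral of the weight gains the factor 1 / K. *)
Let contraction (v w H G : I -> R -> R) D n :
  (forall i s, -1 < s -> is_derive s 1 (H i) (field v i s)) ->
  (forall i s, -1 < s -> is_derive s 1 (G i) (field w i s)) ->
  (forall i, H i 0 = G i 0) -> 0 <= D ->
  (forall i s, 0 <= s -> `|v i s - w i s| <= bound D n s) ->
  forall i s, 0 <= s -> `|H i s - G i s| <= bound D n.+1 s.
Proof.
move=> dH dG HG D0 hvw i s s0.
have N1 r : 0 <= r -> -1 < r by move=> ?; lra.
apply: (@derive_dominated R (fun s => H i s - G i s) (bound D n.+1)
  (fun s => field v i s - field w i s)
  (fun s => D * 2^-1 ^+ n.+1 * (K * expR (K * s)))) => // [r /andP[r0 _]||r /andP[r0 _]].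
- exact: (is_deriveB (dH i r (N1 _ r0)) (dG i r (N1 _ r0))).
- by rewrite HG subrr normr0 bound_ge0.
apply: (le_trans (F_lip _ _ _)).
apply: (@le_trans _ _ (L * \sum_(j : I) bound D n r)).
  rewrite ler_wpM2l //; apply: ler_sum => j _; rewrite /pos (max_l (ltW r0)).
  by apply: hvw; rewrite ltW.
rewrite sumr_const -[_ *+ _]mulr_natl -/card /bound.
rewrite [leRHS](_ : _ = L * (card * (D * 2^-1 ^+ n * expR (K * r))) +
    2^-1 * (D * 2^-1 ^+ n * expR (K * r))); last by rewrite exprS /K; field.
by rewrite lerDl mulr_ge0 ?invr_ge0 // bound_ge0.
Qed.

Let C0 : 0 <= C. Proof. exact: sumr_ge0. Qed.

Let u_step n i s : 0 <= s -> `|u n.+1 i s - u n i s| <= bound C n s.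
Proof.
elim: n i s => [|n IH] i s s0; last first.
  apply: (@contraction (u n.+1) (u n) (u n.+2) (u n.+1) C n) => //.
  - by move=> j r; exact: du.
  - by move=> j r; exact: du.
  - by move=> j; rewrite !u0.
apply: (@derive_dominated R (fun s => u 1 i s - u 0 i s) (bound C 0)
  (fun s => field (u 0) i s - 0) (fun s => C * 2^-1 ^+ 0 * (K * expR (K * s)))) => //.
- move=> r /andP[r0 _]; have r1 : -1 < r by lra.
  exact: (is_deriveB (du 0 i r1) (is_derive_cst (x0 i) r 1)).
- by rewrite !u0 subrr normr0 bound_ge0.
move=> r /andP[r0 _]; rewrite subr0 expr0 mulr1.
apply: (@le_trans _ _ C).
  by rewrite /C (bigD1 i) //= lerDl sumr_ge0.
rewrite ler_peMr // mulr_ege1 //.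
by rewrite (le_trans _ (expR_ge1Dx _)) // lerDl mulr_ge0 ?(le_trans ler01 K1) // ltW.
Qed.

(** The iterates converge geometrically in the weighted distance, uniformly on
    compact intervals.  Evaluating the field at time [max s 0] lets the solution
    start slightly before time 0, where it then has a two-sided derivative. *)
Theorem picard : exists x : I -> R -> R, (forall i, x i 0 = x0 i) /\
  forall i s, -1 < s ->
    is_derive s 1 (x i) (F i (fun j => x j (Num.max s 0))).
Proof.
have /choice [x hx] : forall p : I * R, exists l : R,
    0 <= p.2 -> forall n, `|l - u n p.1 p.2| <= bound (2 * C) n p.2.
  move=> [i s]; case: (leP 0 s) => s0 /=; last by exists 0.
  have [n|l hl] := @geometric_limit R (fun n => u n i s) (C * expR (K * s)).
    by have := u_step n i s0; rewrite /bound mulrAC.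
  exists l => _ n; have := hl n; rewrite /bound.
  by rewrite (_ : 2 * (C * expR (K * s)) * _ = 2 * C * 2^-1 ^+ n * expR (K * s)) //; ring.
pose X i s := x (i, s).
have hX i s n : 0 <= s -> `|X i s - u n i s| <= bound (2 * C) n s.
  by move=> s0; exact: (hx (i, s)).
have small (a b s : R) D : 0 <= D -> (forall n, `|a - b| <= bound D n s) -> a = b.
  move=> D0 hab; apply/eqP; rewrite -subr_eq0 -normr_eq0; apply/eqP.
  have c1 : (fun n => D * expR (K * s) * 2^-1 ^+ n) @ \oo --> (0 : R).
    rewrite -[X in _ --> X](mulr0 (D * expR (K * s))); apply: cvgMr.
    by apply: cvg_expr; rewrite ger0_norm ?invr_ge0 // invf_lt1 // ltr1n.
  apply/eqP; rewrite eq_le normr_ge0 andbT.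
  apply: (ler_cvg_to (cvg_cst _) c1); near=> n.
  by have := hab n; rewrite /bound mulrAC.
have hl : half_lip X.
  move=> i s t s0 t0.
  have c1 : (fun n => B * `|s - t| + (2 * C * expR (K * s) + 2 * C * expR (K * t))
      * 2^-1 ^+ n) @ \oo --> (B * `|s - t|).
    rewrite -[X in _ --> X]addr0; apply: cvgD; first exact: cvg_cst.
    rewrite -[X in _ --> X](mulr0 (2 * C * expR (K * s) + 2 * C * expR (K * t))).
    apply: cvgMr.
    by apply: cvg_expr; rewrite ger0_norm ?invr_ge0 // invf_lt1 // ltr1n.
  apply: (ler_cvg_to (cvg_cst _) c1); near=> n.
  have -> : X i s - X i t = (u n i s - u n i t) + ((X i s - u n i s) - (X i t - u n i t)).
    by ring.
  rewrite (le_trans (ler_normD _ _)) // lerD //.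
    by move: (svalP (iterate n)); apply.
  rewrite (le_trans (ler_normB _ _)) // mulrDl lerD //.
    by have := hX i s n s0; rewrite /bound mulrAC.
  by have := hX i t n t0; rewrite /bound mulrAC.
(* the limit X is equal to its own Picard step H *)
have [H [_ H0 dH]] := integral_curve hl.
have HX i s : 0 <= s -> H i s = X i s.
  move=> s0; apply: (@small _ _ s (2 * (2 * C))) => [|n].
    by rewrite !mulr_ge0.
  have hH : `|H i s - u n.+1 i s| <= bound (2 * C) n.+1 s.
    apply: (@contraction X (u n) H (u n.+1)) => //.
    - by move=> j r; exact: du.
    - by move=> j; rewrite H0 u0.
    - by rewrite mulr_ge0.
    - by move=> j r r0; exact: hX.
  have -> : H i s - X i s = (H i s - u n.+1 i s) - (X i s - u n.+1 i s) by ring.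
  rewrite (le_trans (ler_normB _ _)) //.
  have -> : bound (2 * (2 * C)) n s = bound (2 * C) n.+1 s + bound (2 * C) n.+1 s
    + bound (2 * C) n s by rewrite /bound exprS; field.
  rewrite -addrA; apply: lerD => //; rewrite -[leLHS]addr0; apply: lerD; first exact: hX.
  by rewrite bound_ge0 // mulr_ge0.
exists H; split=> // i s s1.
have -> : (fun j => H j (Num.max s 0)) = (fun j => X j (pos s)).
  by apply/funext => j; rewrite HX // le_max lexx orbT.
exact: dH.
Unshelve. all: by end_near. Qed.

End Picard.

(** * Barriers, decay and systems of differential equations *)

Section ScalarInequalities.
Context {R : realType}.
Implicit Types (f V : R -> R) (s t r c : R).

(** If [P] failed somewhere, the supremum of the [t] with [P] on [0, t) would be
    a point that [P] passes. *)
Lemma real_induction (P : R -> Prop) :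
  (forall t, 0 <= t -> (forall r, 0 <= r < t -> P r) ->
    exists2 d, 0 < d & forall r, t <= r < t + d -> P r) ->
  forall t, 0 <= t -> P t.
Proof.
move=> step t0 t00; apply: contrapT => nP.
pose S : set R := [set t | 0 <= t /\ forall r, 0 <= r < t -> P r].
have S0 : S 0 by split=> // r /andP[h1 h2]; move: (le_lt_trans h1 h2); rewrite ltxx.
have Sub : ubound S t0.
  by move=> t [t0' h]; rewrite leNgt; apply/negP => lt; apply: nP; apply: h; rewrite t00.
have sS : has_sup S by split; [exists 0 | exists t0].
set tau := sup S; have tau0 : 0 <= tau by apply: sup_upper_bound.
have Pr r : 0 <= r < tau -> P r.
  move=> /andP[r0 rt]; have /sup_adherent : 0 < tau - r by rewrite subr_gt0.
  move=> /(_ S sS) [t [_ ht]]; rewrite -/tau => lt.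
  by apply: ht; rewrite r0 /=; lra.
have [d d0 hd] := step tau tau0 Pr.
have : S (tau + d).
  split; first by rewrite addr_ge0 // ltW.
  move=> r /andP[r0 rd]; case: (ltP r tau) => rt; first by apply: Pr; rewrite r0.
  by apply: hd; rewrite rt.
by move=> /(sup_upper_bound sS); rewrite -/tau gerDl leNgt d0.
Qed.

(** If [f b] were above [c], then [f] would lie above [c] from the last time at
    which it was at most [c] on, hence could not increase after it. *)
Lemma barrier f (df : R -> R) c b : 0 <= b ->
  (forall t, 0 <= t <= b -> is_derive t 1 f (df t)) ->
  f 0 <= c -> (forall t, 0 <= t <= b -> c < f t -> df t <= 0) -> f b <= c.
Proof.
move=> b0 hf f0 hd; rewrite leNgt; apply/negP => fb.
pose S : set R := [set t | 0 <= t <= b /\ f t <= c].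
have S0 : S 0 by rewrite /S /= lexx.
have Sub : ubound S b by move=> t [/andP[]].
have sS : has_sup S by split; [exists 0 | exists b].
set a := sup S; have a0 : 0 <= a by apply: sup_upper_bound.
have ab : a <= b by apply: ge_sup; [exists 0|].
have after t : a < t -> t <= b -> c < f t.
  move=> at_ tb; rewrite ltNge; apply/negP => ft.
  have : S t by split=> //; rewrite tb (le_trans a0 (ltW at_)).
  by move=> /(sup_upper_bound sS); rewrite leNgt at_.
have fa : f a <= c.
  rewrite leNgt; apply/negP => fac.
  have ca : {for a, continuous f} by apply: is_derive_continuous (hf a _); rewrite a0.
  have /ca /= [d /= d0 hda] : nbhs (f a) [set y | c < y] by exact: lt_nbhsr.
  have [t [[/andP[t0 tb] ft]]] := sup_adherent d0 sS; rewrite -/a => lt.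
  have ta : t <= a by apply: sup_upper_bound => //; split=> //; rewrite t0.
  have /hda /= : ball a d t by rewrite /ball /= ger0_norm ?subr_ge0 //; lra.
  by rewrite ltNge ft.
move: fb; rewrite ltNge; apply/negP; rewrite negbK; apply: le_trans fa.
apply: (derive_le0 ab (df := df)) => t /andP[h1 h2].
  by apply: hf; rewrite h2 (le_trans a0 h1).
by apply: hd; [rewrite (ltW h2) (le_trans a0 (ltW h1)) | exact: after (ltW h2)].
Qed.

(** [V] is nonincreasing; it gets below each [e > 0] because otherwise it would
    decrease at least at the rate [k * e] forever and become negative. *)
Lemma exp_decay V (dV : R -> R) (k : R) : 0 < k ->
  (forall t, 0 <= t -> is_derive t 1 V (dV t)) ->
  (forall t, 0 <= t -> 0 <= V t) -> (forall t, 0 <= t -> dV t <= - k * V t) ->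
  V t @[t --> +oo] --> 0.
Proof.
move=> k0 hV V0 hd.
have noninc s t : 0 <= s -> s <= t -> V t <= V s.
  move=> s0 st; apply: (derive_le0 st (df := dV)) => r /andP[h1 h2].
    by apply: hV; exact: le_trans h1.
  have r0 : 0 <= r by rewrite (le_trans s0) // ltW.
  by rewrite (le_trans (hd r r0)) // mulNr oppr_le0 mulr_ge0 ?V0 // ltW.
have small e : 0 < e -> exists2 s, 0 <= s & V s <= e.
  move=> e0; apply: contrapT => none.
  have big s : 0 <= s -> e < V s.
    by move=> s0; rewrite ltNge; apply/negP => le; apply: none; exists s.
  pose b := V 0 / (k * e) + 1.
  have ke : 0 < k * e by rewrite mulr_gt0.
  have b0 : 0 <= b by rewrite addr_ge0 // divr_ge0 ?V0 // ltW.
  have : V b + k * e * b <= V 0 + k * e * 0.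
    apply: (@derive_le0 R (fun s => V s + k * e * s) (fun s => dV s + k * e)) => // t.
      by move=> /andP[t0 _]; exact: (is_deriveD (hV t t0) (is_derive_mull _ t)).
    move=> /andP[t0 _]; have t0' := ltW t0.
    have := hd t t0'; rewrite mulNr; have : k * e <= k * V t.
      by rewrite ler_pM2l // ltW // big.
    lra.
  rewrite mulr0 addr0 /b mulrDr mulr1 [k * e * (_ / _)]mulrC divfK ?gt_eqF //.
  by have := V0 b b0; rewrite /b; lra.
apply/cvgrPdist_le => /= e e0; have [s s0 hs] := small e e0.
near=> t; have st : s <= t by near: t; apply: nbhs_pinfty_ge; rewrite num_real.
by rewrite sub0r normrN ger0_norm ?V0 ?(le_trans s0) // (le_trans (noninc s t _ _)).
Unshelve. all: by end_near. Qed.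

End ScalarInequalities.

Section Systems.
Context {R : realType} {I : finType}.
Implicit Types (S : set (I -> R)) (f h : (I -> R) -> R) (u v : I -> R).
Implicit Types (i j : I) (s t r : R).

Local Notation dist u v := (\sum_j `|u j - v j|).

Lemma dist_ge0 u v : 0 <= dist u v. Proof. exact: sumr_ge0. Qed.

(** One constant for both the bound and the Lipschitz condition: this makes the
    class stable under products, so fields are treated term by term. *)
Definition bounded_lip S f := exists2 L : R, 0 <= L &
  (forall u, S u -> `|f u| <= L) /\
  forall u v, S u -> S v -> `|f u - f v| <= L * dist u v.

Lemma bounded_lip_cst S (c : R) : bounded_lip S (fun=> c).
Proof.
exists `|c|; first by []; split=> // u v _ _.
by rewrite subrr normr0 mulr_ge0 // dist_ge0.
Qed.

Lemma bounded_lip_coord S i (B : R) : (forall u, S u -> `|u i| <= B) -> bounded_lip S (fun u => u i).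
Proof.
move=> hB; exists (`|B| + 1); first by rewrite addr_ge0.
split=> [u /hB h|u v _ _].
  by apply: (le_trans h); apply: (le_trans (ler_norm B)); rewrite lerDl.
apply: (@le_trans _ _ (1 * dist u v)).
  by rewrite mul1r (bigD1 i) //= lerDl sumr_ge0.
by rewrite ler_wpM2r ?dist_ge0 // lerDr.
Qed.

Lemma bounded_lipD S f h : bounded_lip S f -> bounded_lip S h -> bounded_lip S (fun u => f u + h u).
Proof.
move=> [L L0 [fb fl]] [K K0 [hb hl]]; exists (L + K); first exact: addr_ge0.
split=> [u Su|u v Su Sv].
  by rewrite (le_trans (ler_normD _ _)) // lerD ?fb ?hb.
have -> : f u + h u - (f v + h v) = (f u - f v) + (h u - h v) by ring.
by rewrite (le_trans (ler_normD _ _)) // mulrDl lerD ?fl ?hl.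
Qed.

Lemma bounded_lipM S f h : bounded_lip S f -> bounded_lip S h -> bounded_lip S (fun u => f u * h u).
Proof.
move=> [L L0 [fb fl]] [K K0 [hb hl]]; exists (L * K + L * K + 0).
  by rewrite addr0 addr_ge0 // mulr_ge0.
have LK : 0 <= L * K by rewrite mulr_ge0.
split=> [u Su|u v Su Sv].
  apply: (@le_trans _ _ (L * K)); last by rewrite addr0 lerDl.
  by rewrite normrM ler_pM ?fb ?hb.
have -> : f u * h u - f v * h v = (f u - f v) * h u + f v * (h u - h v) by ring.
rewrite (le_trans (ler_normD _ _)) // !normrM addr0 mulrDl.
apply: lerD.
  by rewrite mulrAC ler_pM // ?fl ?hb.
by rewrite -mulrA ler_pM // ?fb ?hl.
Qed.

Lemma bounded_lipX S f n : bounded_lip S f -> bounded_lip S (fun u => f u ^+ n).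
Proof.
move=> hf; elim: n => [|n IH].
  by under eq_fun do rewrite expr0; exact: bounded_lip_cst.
by under eq_fun do rewrite exprS; exact: bounded_lipM.
Qed.

Lemma bounded_lipN S f : bounded_lip S f -> bounded_lip S (fun u => - f u).
Proof.
move=> hf; have := bounded_lipM (bounded_lip_cst S (-1)) hf.
by under eq_fun do rewrite mulN1r.
Qed.

Lemma bounded_lipV S f (m : R) : 0 < m -> (forall u, S u -> m <= f u) -> bounded_lip S f ->
  bounded_lip S (fun u => (f u)^-1).
Proof.
move=> m0 fm [L L0 [fb fl]].
have f0 u : S u -> 0 < f u by move=> /fm; exact: lt_le_trans.
exists (m^-1 + L / m ^+ 2).
  by rewrite addr_ge0 ?divr_ge0 ?invr_ge0 ?exprn_ge0 // ltW.
have h1 : 0 <= m^-1 by rewrite invr_ge0 ltW.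
have h2 : 0 <= L / m ^+ 2 by rewrite divr_ge0 ?exprn_ge0 // ltW.
have inv u : S u -> (f u)^-1 <= m^-1 by move=> Su; rewrite lef_pV2 ?posrE ?fm // f0.
split=> [u Su|u v Su Sv].
  rewrite ger0_norm ?invr_ge0 ?(ltW (f0 _ Su)) //.
  by rewrite (le_trans (inv u Su)) // lerDl.
apply: (@le_trans _ _ ((L / m ^+ 2) * dist u v)); last first.
  by rewrite ler_wpM2r ?dist_ge0 // lerDr.
have fu0 := f0 u Su; have fv0 := f0 v Sv.
have -> : (f u)^-1 - (f v)^-1 = (f v - f u) * ((f u)^-1 * (f v)^-1).
  by field; rewrite !gt_eqF.
rewrite normrM distrC mulrAC ler_pM ?fl // ger0_norm; last first.
  by rewrite mulr_ge0 // invr_ge0 ltW.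
by rewrite expr2 invfM ler_pM ?inv // invr_ge0 ltW.
Qed.

Definition solves_on (F : I -> (I -> R) -> R) (x : I -> R -> R) (tau : R) :=
  forall i s, 0 <= s <= tau -> is_derive s 1 (x i) (F i (fun j => x j s)).

Definition box (lo hi : I -> R) : set (I -> R) := [set u | forall i, lo i <= u i <= hi i].

(** Precomposed with the projection onto the box, the field is bounded and
    globally Lipschitz, so its solution exists for all times.  By hypothesis it
    cannot reach the boundary of the box, so it never leaves the region where
    the two fields agree. *)
Theorem global_solution (F : I -> (I -> R) -> R) (lo hi x0 : I -> R) :
  (forall i, lo i < x0 i < hi i) -> (forall i, bounded_lip (box lo hi) (F i)) ->
  (forall x tau, 0 <= tau -> (forall i, x i 0 = x0 i) -> solves_on F x tau ->
    (forall s, 0 <= s <= tau -> box lo hi (fun i => x i s)) ->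
    forall i, lo i < x i tau < hi i) ->
  exists x : I -> R -> R, [/\ forall i, x i 0 = x0 i,
    forall i s, 0 <= s -> is_derive s 1 (x i) (F i (fun j => x j s)) &
    forall s, 0 <= s -> box lo hi (fun i => x i s)].
Proof.
move=> x0box Flip apriori.
pose cl u i := Num.max (lo i) (Num.min (hi i) (u i)).
have lohi i : lo i < hi i by case/andP: (x0box i); exact: lt_trans.
have clbox u : box lo hi (cl u).
  by move=> i; rewrite /cl le_max lexx /= ge_max (ltW (lohi i)) ge_min lexx.
have clid u : box lo hi u -> cl u = u.
  move=> hu; apply/funext => i; have /andP[h1 h2] := hu i.
  by rewrite /cl min_r // max_r.
have cllip u v i : `|cl u i - cl v i| <= `|u i - v i|.
  exact: (le_trans (max_lip _ _ _) (min_lip _ _ _)).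
have /choice [L hL] : forall i, exists L, [/\ 0 <= L, (forall u, box lo hi u -> `|F i u| <= L) &
   forall u v, box lo hi u -> box lo hi v -> `|F i u - F i v| <= L * dist u v].
  by move=> i; have [L L0 [h1 h2]] := Flip i; exists L.
pose LL := \sum_i L i.
have LL_le i : L i <= LL.
  by rewrite /LL (bigD1 i) //= lerDl sumr_ge0 // => j _; case: (hL j).
have LL0 : 0 <= LL by apply: sumr_ge0 => i _; case: (hL i).
pose G i u := F i (cl u).
have Glip i u v : `|G i u - G i v| <= LL * dist u v.
  case: (hL i) => L0 _ h; apply: (le_trans (h _ _ (clbox u) (clbox v))).
  by rewrite ler_pM // ?dist_ge0 //; apply: ler_sum => j _; exact: cllip.
have Gb i u : `|G i u| <= LL.
  by case: (hL i) => _ h _; exact: le_trans (h _ (clbox u)) (LL_le i).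
have [x [xi dx]] := picard x0 LL0 Glip Gb.
have cx i s : 0 <= s -> {for s, continuous (x i)}.
  by move=> s0; apply: is_derive_continuous (dx i s _); lra.
have stay : forall s, 0 <= s -> box lo hi (fun i => x i s).
  apply: real_induction => t t0 ht.
  have boxt : box lo hi (fun i => x i t).
    move: t0; rewrite le_eqVlt => /predU1P[<- i|t0 i].
      by rewrite xi; case/andP: (x0box i) => *; rewrite !ltW.
    have cl_t := cvg_at_left_filter (cx i t (ltW t0)).
    have hr : \forall r \near t^'-, lo i <= x i r <= hi i.
      near=> r; apply: ht; apply/andP; split; near: r.
        exact: nbhs_left_ge.
      exact: nbhs_left_lt.
    apply/andP; split.
      by apply: (ler_cvg_to (cvg_cst _) cl_t); apply: filterS hr => r /andP[].
    by apply: (ler_cvg_to cl_t (cvg_cst _)); apply: filterS hr => r /andP[].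
  have ht' s : 0 <= s <= t -> box lo hi (fun i => x i s).
    move=> /andP[s0]; rewrite le_eqVlt => /predU1P[->//|st]; apply: ht.
    by rewrite s0.
  have inside := apriori x t t0 xi.
  have {inside} inside i : lo i < x i t < hi i.
    apply: inside => // j s /andP[s0 st].
    have s1 : -1 < s by lra.
    have := dx j s s1; rewrite max_l // /G clid //.
    by apply: ht'; rewrite s0.
  have : \forall r \near t, forall i, lo i < x i r < hi i.
    have H i : \forall r \near t, lo i < x i r < hi i.
      have /andP[h1 h2] := inside i; have := cx i t t0 => c.
      by apply: filterS2 (cvgr_gt _ c _ h1) (cvgr_lt _ c _ h2) => r k1 k2; rewrite k1.
    exact: (@filter_forall _ _ (fun i r => lo i < x i r < hi i) (nbhs t)).
  move=> /nbhs_ballP [d /= d0 hd]; exists d => // r /andP[r1 r2] i.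
  have /andP[h1 h2] : lo i < x i r < hi i.
    by apply: hd; rewrite /ball /= distrC ger0_norm ?subr_ge0 //; lra.
  by rewrite !ltW.
exists x; split=> // i s s0.
have s1 : -1 < s by lra.
by have := dx i s s1; rewrite max_l // /G clid //; exact: stay.
Unshelve. all: by end_near. Qed.

(** Gronwall's argument: the squared distance [d] of the two solutions satisfies
    [d' <= N d], so [d s * expR (- N * s)] does not increase from its value 0.
    At time 0 the solutions of interest are differentiable from the right only,
    hence derivatives in the open interval and continuity on the closed one. *)
Theorem unique_solution (F : I -> (I -> R) -> R) (x y : I -> R -> R) S (b : R) :
  (forall i, bounded_lip S (F i)) -> 0 <= b ->
  (forall s, 0 < s < b -> S (fun i => x i s) /\ S (fun i => y i s)) ->
  (forall i s, 0 < s < b -> is_derive s 1 (x i) (F i (fun j => x j s))) ->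
  (forall i s, 0 < s < b -> is_derive s 1 (y i) (F i (fun j => y j s))) ->
  (forall i, {within `[0, b], continuous (x i)}) ->
  (forall i, {within `[0, b], continuous (y i)}) ->
  (forall i, x i 0 = y i 0) -> forall i, x i b = y i b.
Proof.
move=> Flip b0 inS dx dy cx cy xy0.
have /choice [L hL] : forall i, exists L, 0 <= L /\
   forall u v, S u -> S v -> `|F i u - F i v| <= L * dist u v.
  by move=> i; have [L L0 [h1 h2]] := Flip i; exists L.
pose K := \sum_i 2 * L i.
pose d s := \sum_i (x i s - y i s) ^+ 2.
(* the Cauchy-Schwarz inequality in the crude form (sum |z_j|)^2 <= n sum z_j^2 *)
have cs (z : I -> R) (i : I) : `|z i| * \sum_j `|z j| <= #|I|%:R * \sum_j z j ^+ 2.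
  have le1 (k j : I) : `|z k| * `|z j| <= (z k ^+ 2 + z j ^+ 2) / 2.
    have := sqr_ge0 (`|z k| - `|z j|).
    by rewrite sqrrB !real_normK ?num_real // => h; lra.
  rewrite [leLHS]mulr_sumr; apply: (@le_trans _ _ (\sum_(j : I) \sum_(k : I) z k ^+ 2)).
    apply: ler_sum => j _; apply: (le_trans (le1 i j)).
    have zz (k : I) : z k ^+ 2 <= \sum_k z k ^+ 2.
      by rewrite (bigD1 k) //= lerDl sumr_ge0 // => *; exact: sqr_ge0.
    by have := zz i; have := zz j; lra.
  by rewrite sumr_const -[_ *+ _]mulr_natl.
pose N := K * #|I|%:R.
pose dd s := \sum_i 2 * (x i s - y i s) * (F i (fun j => x j s) - F i (fun j => y j s)).
have der s : 0 < s < b -> is_derive s 1 d (dd s).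
  move=> hs; rewrite /d /dd; elim: (index_enum I) => [|i r IH].
    under eq_fun do rewrite big_nil; rewrite big_nil; exact: is_derive_cst.
  under eq_fun do rewrite big_cons; rewrite big_cons; apply: is_deriveD => //.
  have h := is_deriveX 2 (is_deriveB (dx i s hs) (dy i s hs)).
  apply: (is_derive_eq h); rewrite /GRing.scale /= expr1 !fctE; ring.
have dd_le s : 0 < s < b -> dd s <= N * d s.
  move=> hs; have [Sx Sy] := inS s hs.
  rewrite /dd /N /K !mulr_suml; apply: ler_sum => i _.
  have [L0 hLi] := hL i.
  apply: (@le_trans _ _ (2 * L i * (`|x i s - y i s| * dist (x^~ s) (y^~ s)))).
    apply: (le_trans (ler_norm _)); rewrite !normrM ger0_norm //.
    rewrite -mulrA -[2 * L i * _]mulrA ler_wpM2l // mulrCA ler_wpM2l //.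
    exact: hLi.
  rewrite -[leRHS]mulrA ler_wpM2l ?mulr_ge0 //.
  exact: (cs (fun j => x j s - y j s)).
have cd : {within `[0, b], continuous d}.
  rewrite /d; elim: (index_enum I) => [|i r IH].
    rewrite (_ : (fun _ => _) = cst 0); last by apply/funext => s; rewrite big_nil.
    by apply: continuous_subspaceT; exact: cst_continuous.
  pose z := x i - y i; pose q : R -> R := fun s => \sum_(j <- r) (x j s - y j s) ^+ 2.
  rewrite (_ : (fun _ => _) = z * z + q); last first.
    by apply/funext => s; rewrite big_cons expr2.
  have cz : {within `[0, b], continuous z}.
    by rewrite /z => s; apply: continuousD; [exact: cx | apply: continuousN; exact: cy].
  by move=> s; apply: continuousD; [apply: continuousM; exact: cz | exact: IH].
have dec : d b * expR (- N * b) <= d 0 * expR (- N * 0).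
  have dE s : is_derive s 1 (fun s => expR (- N * s)) (expR (- N * s) * - N).
    exact: (is_derive1_comp (is_derive_expR _) (is_derive_mull (- N) s)).
  apply: (@nonincreasing_of_derive R (fun s => d s * expR (- N * s))
    (fun s => (dd s - N * d s) * expR (- N * s))) => // [s hs||s hs].
  - have h := is_deriveM (der s hs) (dE s).
    apply: (is_derive_eq h); rewrite /GRing.scale /=; ring.
  - move=> t; apply: continuousM; first exact: cd.
    apply: continuous_subspaceT => r; exact: is_derive_continuous (dE r).
  by rewrite mulr_le0_ge0 ?expR_ge0 // subr_le0 dd_le.
have d0 : d 0 = 0 by rewrite /d big1 // => i _; rewrite xy0 subrr expr0n.
have db : d b = 0.
  apply/eqP; rewrite eq_le; apply/andP; split; last first.
    by apply: sumr_ge0 => i _; exact: sqr_ge0.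
  by move: dec; rewrite d0 mul0r pmulr_lle0 // expR_gt0.
move=> i; apply/eqP; rewrite -subr_eq0 -sqrf_eq0; apply/eqP.
have /psumr_eq0P := db; apply=> // j _; exact: sqr_ge0.
Qed.

End Systems.

(** * The rescaled flow in the ratios X and r *)

Section PlanarFlow.
Context {R : realType}.
Implicit Types (X r s t : R).

(** The components of the rescaled coflow in [X = a^2 / c^2] and the signed
    ratio [r = eps * b / a].  With the sign put into [r], the same field serves
    both families: eps = 1 is the quadrant r > 0, eps = -1 is r < 0. *)
Definition flow_X X r :=
  16 * (r - 1) * X ^+ 2 + (4 * r ^+ 2 - 16 * r - 8) * X + (8 - 8 * r + 4 * r ^+ 2).

Definition flow_r X r :=
  4 * r * (1 - r) * ((2 + r) * (2 * X - 1) + r / X).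

Definition flow (b : bool) (u : bool -> R) :=
  if b then flow_X (u true) (u false) else flow_r (u true) (u false).

Lemma flow_bounded_lip (lo hi : bool -> R) : 0 < lo true -> forall b, bounded_lip (box lo hi) (flow b).
Proof.
move=> lo0.
have cb b : bounded_lip (box lo hi) (fun u => u b).
  apply: (@bounded_lip_coord _ _ _ _ (`|lo b| + `|hi b|)) => u /(_ b) /andP[h1 h2].
  have := ler_norm (hi b); have := ler_norm (- lo b); rewrite normrN => n1 n2.
  have := normr_ge0 (hi b); have := normr_ge0 (lo b) => n3 n4.
  by rewrite ler_norml; apply/andP; split; lra.
have cV : bounded_lip (box lo hi) (fun u => (u true)^-1).
  by apply: (bounded_lipV lo0) => // u /(_ true) /andP[].
have cc c : bounded_lip (box lo hi) (fun=> c) by exact: bounded_lip_cst.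
case; rewrite /flow /flow_X /flow_r.
  by do ![exact: cb | exact: cc | apply: bounded_lipD | apply: bounded_lipN | apply: bounded_lipM | apply: bounded_lipX].
by do ![exact: cb | exact: cV | exact: cc | apply: bounded_lipD | apply: bounded_lipN | apply: bounded_lipM].
Qed.

Definition flow_orbit (X r : R -> R) := forall s, 0 <= s ->
  is_derive s 1 X (flow_X (X s) (r s)) /\ is_derive s 1 r (flow_r (X s) (r s)).

Definition solution_on (X r : R -> R) (tau : R) := forall s, 0 <= s <= tau ->
  is_derive s 1 X (flow_X (X s) (r s)) /\ is_derive s 1 r (flow_r (X s) (r s)).

Lemma confined_orbit (X0 r0 Xlo Xhi rlo rhi : R) :
  0 < Xlo -> Xlo < X0 < Xhi -> rlo < r0 < rhi ->
  (forall (X r : R -> R) tau, 0 <= tau -> X 0 = X0 -> r 0 = r0 -> solution_on X r tau ->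
    (forall s, 0 <= s <= tau -> Xlo <= X s <= Xhi /\ rlo <= r s <= rhi) ->
    Xlo < X tau < Xhi /\ rlo < r tau < rhi) ->
  exists X r : R -> R, [/\ X 0 = X0, r 0 = r0, flow_orbit X r &
    forall s, 0 <= s -> Xlo <= X s <= Xhi /\ rlo <= r s <= rhi].
Proof.
move=> Xlo0 hX0 hr0 apriori.
pose lo b := if b then Xlo else rlo; pose hi b := if b then Xhi else rhi.
pose x0 b := if b then X0 else r0.
have x0_in b : lo b < x0 b < hi b by case: b.
have Flip b : bounded_lip (box lo hi) (flow b) by exact: flow_bounded_lip.
have stay x tau : 0 <= tau -> (forall b, x b 0 = x0 b) -> solves_on flow x tau ->
    (forall s, 0 <= s <= tau -> box lo hi (fun b => x b s)) ->
    forall b, lo b < x b tau < hi b.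
  move=> tau0 x00 dx xb.
  have [h1 h2] : Xlo < x true tau < Xhi /\ rlo < x false tau < rhi.
    apply: (apriori _ _ tau tau0 (x00 true) (x00 false)).
    + by move=> s hs; split; [exact: (dx true) | exact: (dx false)].
    + by move=> s hs; split; [exact: (xb s hs true) | exact: (xb s hs false)].
  by case.
have [x [x00 dx xb]] := global_solution x0_in Flip stay.
exists (x true), (x false); split.
- exact: (x00 true).
- exact: (x00 false).
- by move=> s s0; split; [exact: (dx true) | exact: (dx false)].
- by move=> s s0; split; [exact: (xb s s0 true) | exact: (xb s s0 false)].
Qed.

Lemma cvg_of_sqr_le (f V : R -> R) (l C : R) :
  (forall s, 0 <= s -> (f s - l) ^+ 2 <= C * V s) ->
  V s @[s --> +oo] --> 0 -> f s @[s --> +oo] --> l.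
Proof.
move=> hf hV; apply/cvgrPdist_le => /= e e0.
have c1 : C * V s @[s --> +oo] --> 0.
  by rewrite -(mulr0 C); apply: cvgMr.
have := cvgr_lt 0 c1 (e ^+ 2) (exprn_gt0 2 e0) => h.
near=> s; have s0 : 0 <= s by near: s; apply: nbhs_pinfty_ge; rewrite num_real.
rewrite distrC -(ler_pXn2r (ltn0Sn 1)) ?nnegrE ?normr_ge0 ?(ltW e0) //.
rewrite real_normK ?num_real // (le_trans (hf s s0)) // ltW //.
by near: s; exact: h.
Unshelve. all: by end_near. Qed.

End PlanarFlow.

(** * Convergence for negative ratio *)

Section NegativeRatio.
Context {R : realType}.
Implicit Types (X r s t : R).

(** A product of two factors [(1 + z)^2 / z], each minimal at z = 1; so it is
    proper on the quadrant X > 0 > r, with minimum 16 at (1, -1). *)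
Definition lyap_neg X r := (1 + X) ^+ 2 * (1 - r) ^+ 2 / (X * - r).

(** Up to a positive factor, minus the logarithmic derivative of [lyap_neg] along
    the flow. *)
Definition rate_neg X r :=
  8 * (1 + X) * (2 * X - 1) ^+ 2 + 4 * (2 * X - 1) * (X ^+ 2 + 6 * X + 1) * r
  + 8 * (1 + X) * (X ^+ 2 - X + 1) * r ^+ 2.

Lemma lyap_neg_derive (X r : R -> R) s : X s != 0 -> 1 + X s != 0 -> r s != 0 ->
  is_derive s 1 X (flow_X (X s) (r s)) -> is_derive s 1 r (flow_r (X s) (r s)) ->
  is_derive s 1 (fun s => lyap_neg (X s) (r s))
    (- (lyap_neg (X s) (r s) * rate_neg (X s) (r s) / (X s * (1 + X s)))).
Proof.
move=> X0 X1 r0 dX dr; rewrite /lyap_neg.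
have Xr0 : X s * - r s != 0 by rewrite mulf_neq0 // oppr_eq0.
have d1 := deriveX_fun (deriveD_fun (derive_cst_fun 1 s) dX).
have d2 := deriveX_fun (deriveD_fun (derive_cst_fun 1 s) (deriveN_fun dr)).
have d3 := deriveV_fun (deriveM_fun dX (deriveN_fun dr)) Xr0.
apply: (is_derive_eq (deriveM_fun (deriveM_fun d1 d2) d3)).
rewrite /flow_X /flow_r /rate_neg; field.
by rewrite X0 X1 r0.
Qed.

(** As a quadratic polynomial in [r], [rate_neg] is nonnegative: completing the
    square leaves a multiple of [(X - 1)^2].  The present estimate controls
    [X - 1]; the next one completes the square in the other way and controls
    [1 + r] once [X - 1] is under control. *)
Lemma rate_neg_ge1 X r : 0 < X ->
  15 / 2 * r ^+ 2 * (X - 1) ^+ 2 <= rate_neg X r.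
Proof.
move=> X0; rewrite -subr_ge0 -(pmulr_rge0 _ (_ : 0 < 32 * (1 + X))); last by lra.
have -> : 32 * (1 + X) * (rate_neg X r - 15 / 2 * r ^+ 2 * (X - 1) ^+ 2)
  = (16 * (1 + X) * (2 * X - 1) + 4 * (X ^+ 2 + 6 * X + 1) * r) ^+ 2
    + 16 * (X - 1) ^+ 2 * (15 * X ^+ 2 + 19 * X) * r ^+ 2.
  by rewrite /rate_neg; field.
rewrite addr_ge0 ?sqr_ge0 // mulr_ge0 ?sqr_ge0 // mulr_ge0 //.
  by rewrite mulr_ge0 // sqr_ge0.
by rewrite addr_ge0 // mulr_ge0 ?sqr_ge0 // ltW.
Qed.

Lemma rate_neg_ge2 X r : 0 < X ->
  (32 * (1 + r) + (X - 1) * (16 * (2 * X + 3) + 4 * r * (X + 7))) ^+ 2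
  <= 32 * (1 + X) * rate_neg X r.
Proof.
move=> X0; rewrite -subr_ge0.
have -> : 32 * (1 + X) * rate_neg X r
  - (32 * (1 + r) + (X - 1) * (16 * (2 * X + 3) + 4 * r * (X + 7))) ^+ 2
  = 16 * (X - 1) ^+ 2 * (15 * X ^+ 2 + 34 * X + 15) * r ^+ 2.
  by rewrite /rate_neg; ring.
rewrite mulr_ge0 ?sqr_ge0 // mulr_ge0 //.
  by rewrite mulr_ge0 // sqr_ge0.
by rewrite addr_ge0 // addr_ge0 // mulr_ge0 ?sqr_ge0 // ltW.
Qed.

Lemma rate_neg_ge0 X r : 0 < X -> 0 <= rate_neg X r.
Proof.
move=> X0; apply: le_trans (rate_neg_ge1 r X0).
by rewrite mulr_ge0 ?sqr_ge0 // mulr_ge0 // sqr_ge0.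
Qed.

Lemma lyap_neg_ge16 X r : 0 < X -> r < 0 -> 16 <= lyap_neg X r.
Proof.
move=> X0 r0; have Xr : 0 < X * - r by rewrite mulr_gt0 // oppr_gt0.
rewrite /lyap_neg ler_pdivlMr // -subr_ge0.
have -> : (1 + X) ^+ 2 * (1 - r) ^+ 2 - 16 * (X * - r)
  = (X - 1) ^+ 2 * (1 - r) ^+ 2 + 4 * X * (1 + r) ^+ 2 by ring.
by rewrite addr_ge0 // mulr_ge0 ?sqr_ge0 // mulr_ge0 // ltW.
Qed.

(** Both factors of the Lyapunov function are at least 4, so each is at most
    [m = lyap_neg X r / 4]; and [(1 + z)^2 / z <= m] forces [z < m], [1 / z < m]. *)
Lemma lyap_neg_bound X r : 0 < X -> r < 0 ->
  let m := lyap_neg X r / 4 in m^-1 < X < m /\ - m < r < - m^-1.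
Proof.
move=> X0 r0 m; have q0 : 0 < - r by rewrite oppr_gt0.
have mE : m * (4 * (X * - r)) = (1 + X) ^+ 2 * (1 - r) ^+ 2.
  have Xn : X != 0 by rewrite gt_eqF.
  have rn : r != 0 by rewrite lt_eqF.
  by rewrite /m /lyap_neg; field; rewrite ?Xn ?rn.
have m0 : 0 < m.
  by have := lyap_neg_ge16 X0 r0; rewrite /m => h; lra.
have h1 : (1 + X) ^+ 2 <= m * X.
  rewrite -(ler_pM2r (_ : 0 < 4 * - r)); last by lra.
  have -> : m * X * (4 * - r) = (1 + X) ^+ 2 * (1 - r) ^+ 2 by rewrite -mE; ring.
  rewrite ler_wpM2l ?sqr_ge0 // -subr_ge0.
  have -> : (1 - r) ^+ 2 - 4 * - r = (1 + r) ^+ 2 by ring.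
  exact: sqr_ge0.
have h2 : (1 - r) ^+ 2 <= m * - r.
  rewrite -(ler_pM2r (_ : 0 < 4 * X)); last by lra.
  have -> : m * - r * (4 * X) = (1 - r) ^+ 2 * (1 + X) ^+ 2 by rewrite [RHS]mulrC -mE; ring.
  rewrite ler_wpM2l ?sqr_ge0 // -subr_ge0.
  have -> : (1 + X) ^+ 2 - 4 * X = (1 - X) ^+ 2 by ring.
  exact: sqr_ge0.
have bounds z : 0 < z -> (1 + z) ^+ 2 <= m * z -> m^-1 < z < m.
  move=> z0 hz; apply/andP; split.
    rewrite -(ltr_pM2l m0) mulfV ?gt_eqF //; apply: lt_le_trans hz.
    rewrite sqrrD expr1n; have : 0 <= z ^+ 2 by exact: sqr_ge0.
    lra.
  rewrite -(ltr_pM2r z0); apply: lt_le_trans hz.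
  rewrite sqrrD expr1n -expr2; lra.
have b1 := bounds X X0 h1.
have /andP[b2 b3] := bounds (- r) q0 h2.
by split=> //; apply/andP; split; lra.
Qed.

(** On a compact box the excess of the Lyapunov function over its minimum is
    quadratic in [X - 1] and [1 + r], and so bounded by a multiple of the
    dissipation. *)
Lemma lyap_neg_decay (M : R) : 4 <= M -> exists2 k : R, 0 < k &
  forall X r, M^-1 <= X <= M -> - M <= r <= - M^-1 ->
    k * (lyap_neg X r - 16)
    <= lyap_neg X r * rate_neg X r / (X * (1 + X)).
Proof.
move=> M4; have M0 : 0 < M by lra.
(* c1, c2 and c3 times the dissipation bound (X - 1)^2, (1 + r)^2 and the excess
   of the Lyapunov function times - X r; T bounds the mixed coefficient *)
pose c1 := 2 / 15 * M ^+ 2.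
pose T := 16 * (2 * M + 3) + 4 * M * (M + 7).
pose c2 := (64 * (1 + M) + 2 * T ^+ 2 * c1) / 32 ^+ 2.
pose c3 := (1 + M) ^+ 2 * c1 + 4 * M * c2.
have c1_gt0 : 0 < c1 by rewrite mulr_gt0 ?exprn_gt0 //; lra.
have c2_ge0 : 0 <= c2.
  rewrite divr_ge0 ?sqr_ge0 // addr_ge0 //; first by lra.
  by rewrite mulr_ge0 ?(ltW c1_gt0) // mulr_ge0 ?sqr_ge0.
have c3_gt0 : 0 < c3.
  have h1 : 0 < (1 + M) ^+ 2 * c1 by rewrite mulr_gt0 ?exprn_gt0 //; lra.
  have h2 : 0 <= 4 * M * c2 by rewrite mulr_ge0 //; lra.
  by rewrite /c3; lra.
have M1 : 0 < M * (1 + M) by rewrite mulr_gt0 //; lra.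
have M2 : 0 < M ^+ 2 by rewrite exprn_gt0.
exists (16 / (M * (1 + M)) / (c3 * M ^+ 2)).
  by rewrite !divr_gt0 // mulr_gt0.
move=> X r /andP[X1 X2] /andP[r1 r2].
have M'0 : 0 < M^-1 by rewrite invr_gt0.
have X0 : 0 < X by lra.
have r0 : r < 0 by lra.
have q0 : 0 < - r by lra.
have rho0 := rate_neg_ge0 r X0; set rho := rate_neg X r in rho0 *.
have inv_le z : M^-1 <= z -> 1 <= M * z.
  by move=> hz; rewrite -(mulfV (lt0r_neq0 M0)) ler_wpM2l // ltW.
have Mr : 1 <= M ^+ 2 * r ^+ 2.
  have h : 1 <= M * - r by apply: inv_le; lra.
  have -> : M ^+ 2 * r ^+ 2 = (M * - r) ^+ 2 by ring.
  by rewrite exprn_ege1.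
have A1 : (X - 1) ^+ 2 <= c1 * rho.
  apply: (@le_trans _ _ (M ^+ 2 * r ^+ 2 * (X - 1) ^+ 2)).
    by rewrite ler_peMl ?sqr_ge0.
  have := rate_neg_ge1 r X0; rewrite -/rho => h.
  have -> : c1 * rho = M ^+ 2 * (2 / 15 * rho) by rewrite /c1; ring.
  by rewrite -mulrA ler_wpM2l ?(ltW M2) //; lra.
pose T' := 16 * (2 * X + 3) + 4 * r * (X + 7).
have T'T : T' ^+ 2 <= T ^+ 2.
  rewrite -ler_sqrt ?sqr_ge0 // !sqrtr_sqr [leRHS]ger0_norm; last first.
    rewrite /T addr_ge0 //; first by lra.
    by rewrite mulr_ge0 //; lra.
  have rX : 0 <= - r * (X + 7) <= M * (M + 7).
    rewrite mulr_ge0 /=; [|lra|lra].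
    by rewrite ler_pM //; lra.
  rewrite /T' /T ler_norml; case/andP: rX => rX1 rX2.
  have MM : 0 <= M * (M + 7) by lra.
  apply/andP; split; lra.
have A2 : (1 + r) ^+ 2 <= c2 * rho.
  have := rate_neg_ge2 r X0; rewrite -/T' -/rho => h.
  have h1 : 32 * (1 + X) * rho <= 32 * (1 + M) * rho.
    by rewrite ler_wpM2r //; lra.
  have h2 : T' ^+ 2 * (X - 1) ^+ 2 <= T ^+ 2 * (c1 * rho).
    by rewrite ler_pM ?sqr_ge0.
  have h3 : 32 ^+ 2 * (1 + r) ^+ 2 <= 2 * (32 * (1 + r) + (X - 1) * T') ^+ 2
      + 2 * (T' ^+ 2 * (X - 1) ^+ 2).
    rewrite -subr_ge0.
    have -> : 2 * (32 * (1 + r) + (X - 1) * T') ^+ 2 + 2 * (T' ^+ 2 * (X - 1) ^+ 2)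
      - 32 ^+ 2 * (1 + r) ^+ 2 = (32 * (1 + r) + 2 * (X - 1) * T') ^+ 2 by ring.
    exact: sqr_ge0.
  rewrite /c2 mulrAC ler_pdivlMr ?exprn_gt0 // [leLHS]mulrC mulrDl.
  have -> : 2 * T ^+ 2 * c1 * rho = 2 * (T ^+ 2 * (c1 * rho)) by ring.
  by lra.
have Xr : 0 < X * - r by rewrite mulr_gt0.
have E16 : (lyap_neg X r - 16) * (X * - r) <= c3 * rho.
  rewrite mulrBl /lyap_neg divfK ?gt_eqF //.
  have -> : (1 + X) ^+ 2 * (1 - r) ^+ 2 - 16 * (X * - r)
    = (1 - r) ^+ 2 * (X - 1) ^+ 2 + 4 * X * (1 + r) ^+ 2 by ring.
  have -> : c3 * rho = (1 + M) ^+ 2 * (c1 * rho) + 4 * M * (c2 * rho).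
    by rewrite /c3; ring.
  apply: lerD; apply: ler_pM; rewrite ?sqr_ge0 //; try lra.
  by rewrite ler_pXn2r // ?nnegrE; lra.
have Xr1 : 1 <= M ^+ 2 * (X * - r).
  have -> : M ^+ 2 * (X * - r) = (M * X) * (M * - r) by ring.
  by rewrite mulr_ege1 // inv_le //; lra.
have E0 := lyap_neg_ge16 X0 r0.
have E16' : lyap_neg X r - 16 <= c3 * M ^+ 2 * rho.
  rewrite mulrAC; apply: (@le_trans _ _ ((lyap_neg X r - 16) * (X * - r) * M ^+ 2)).
    by rewrite -mulrA [X in _ * X]mulrC ler_peMr // subr_ge0.
  by rewrite ler_wpM2r // ltW.
rewrite mulrAC ler_pdivrMr ?mulr_gt0 //.
apply: (@le_trans _ _ (16 / (M * (1 + M)) * (c3 * M ^+ 2 * rho))).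
  by rewrite ler_wpM2l // divr_ge0 // ltW.
have -> : 16 / (M * (1 + M)) * (c3 * M ^+ 2 * rho)
  = 16 * rho / (M * (1 + M)) * (c3 * M ^+ 2) by ring.
apply: ler_wpM2r; first by rewrite ltW // mulr_gt0.
have XX : 0 < X * (1 + X) by rewrite mulr_gt0 //; lra.
apply: ler_pM.
- by rewrite mulr_ge0.
- by rewrite invr_ge0 ltW.
- by rewrite ler_wpM2r.
by rewrite lef_pV2 ?posrE // ler_pM //; lra.
Qed.

Lemma sqr_le_lyap_neg M X r : 0 < X <= M -> - M <= r < 0 ->
  (X - 1) ^+ 2 <= M / 4 * (lyap_neg X r - 16) /\
  (r - -1) ^+ 2 <= M / 4 * (lyap_neg X r - 16).
Proof.
move=> /andP[X0 XM] /andP[rM r0]; have q0 : 0 < - r by lra.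
have Xr : 0 < X * - r by rewrite mulr_gt0.
have E : (lyap_neg X r - 16) * (X * - r)
    = (X - 1) ^+ 2 * (1 + r) ^+ 2 + 4 * X * (1 + r) ^+ 2 + 4 * - r * (X - 1) ^+ 2.
  by rewrite mulrBl /lyap_neg divfK ?gt_eqF //; ring.
have V0 : 0 <= lyap_neg X r - 16 by rewrite subr_ge0 lyap_neg_ge16.
have S0 : 0 <= (X - 1) ^+ 2 * (1 + r) ^+ 2 by rewrite mulr_ge0 ?sqr_ge0.
have S1 : 0 <= X * (1 + r) ^+ 2 by rewrite mulr_ge0 ?sqr_ge0 // ltW.
have S2 : 0 <= - r * (X - 1) ^+ 2 by rewrite mulr_ge0 ?sqr_ge0 // ltW.
split.
  rewrite -(ler_pM2l q0); apply: (@le_trans _ _ (X / 4 * (- r * (lyap_neg X r - 16)))).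
    have -> : X / 4 * (- r * (lyap_neg X r - 16)) = (lyap_neg X r - 16) * (X * - r) / 4
      by ring.
    by rewrite E; lra.
  rewrite [leRHS]mulrCA; apply: ler_wpM2r; last by lra.
  by rewrite mulr_ge0 // ltW.
rewrite opprK -(ler_pM2l X0) addrC.
apply: (@le_trans _ _ (- r / 4 * (X * (lyap_neg X r - 16)))).
  have -> : - r / 4 * (X * (lyap_neg X r - 16)) = (lyap_neg X r - 16) * (X * - r) / 4
    by ring.
  by rewrite E; lra.
rewrite [leRHS]mulrCA; apply: ler_wpM2r; last by lra.
by rewrite mulr_ge0 // ltW.
Qed.

(** The sublevel set of the initial value of the Lyapunov function lies inside a
    compact box, so the orbit exists forever; the excess of the Lyapunov
    function over 16 decays exponentially and bounds the distance to (1, -1). *)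
Theorem orbit_neg X0 r0 : 0 < X0 -> r0 < 0 -> exists X r : R -> R,
  [/\ X 0 = X0, r 0 = r0, flow_orbit X r, forall s, 0 <= s -> 0 < X s /\ r s < 0 &
      X s @[s --> +oo] --> (1 : R) /\ r s @[s --> +oo] --> (-1 : R)].
Proof.
move=> X00 r00; set E0 := lyap_neg X0 r0; pose m := E0 / 4; pose M := m + 1.
have E016 : 16 <= E0 := lyap_neg_ge16 X00 r00.
have m4 : 4 <= m by rewrite /m; lra.
have M4 : 4 <= M by rewrite /M; lra.
have mM : M^-1 < m^-1 by rewrite ltf_pV2 ?posrE /M; lra.
have M'0 : 0 < M^-1 by rewrite invr_gt0; lra.
(* a point below the initial level is inside the box *)
have inside X r : 0 < X -> r < 0 -> lyap_neg X r <= E0 ->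
    M^-1 < X < M /\ - M < r < - M^-1.
  move=> Xp rn le; have [/andP[h1 h2] /andP[h3 h4]] := lyap_neg_bound Xp rn.
  have le4 : lyap_neg X r / 4 <= m by rewrite /m; lra.
  have E16 := lyap_neg_ge16 Xp rn.
  have le4' : m^-1 <= (lyap_neg X r / 4)^-1 by rewrite lef_pV2 ?posrE //; lra.
  by rewrite /M in mM *; split; apply/andP; split; lra.
have [/andP[i1 i2] /andP[i3 i4]] := inside _ _ X00 r00 (lexx _).
have [] := @confined_orbit R X0 r0 M^-1 M (- M) (- M^-1) M'0.
- by rewrite i1.
- by rewrite i3.
- move=> X r tau tau0 X0E r0E sol bnd.
  have pos s : 0 <= s <= tau -> 0 < X s /\ r s < 0.
    by move=> /bnd [/andP[h1 _] /andP[_ h2]]; split; lra.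
  have [Xt rt] : 0 < X tau /\ r tau < 0 by apply: pos; rewrite tau0 lexx.
  apply: inside => //; rewrite /E0 -X0E -r0E.
  apply: (@derive_le0 R (fun s => lyap_neg (X s) (r s)) _ 0 tau tau0) => s hs.
    have [Xs rs] := pos s hs; have [dX dr] := sol s hs.
    exact: (lyap_neg_derive (lt0r_neq0 Xs) (lt0r_neq0 (addr_gt0 ltr01 Xs)) (ltr0_neq0 rs) dX dr).
  have [|Xs rs] := pos s; first by case/andP: hs => *; rewrite !ltW.
  have E16 := lyap_neg_ge16 Xs rs; have rho0 := rate_neg_ge0 (r s) Xs.
  by rewrite oppr_le0 divr_ge0 // mulr_ge0 //; lra.
move=> X [r [X0E r0E orb bnd]]; exists X, r.
have pos s : 0 <= s -> 0 < X s /\ r s < 0.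
  by move=> /bnd [/andP[h1 _] /andP[_ h2]]; split; lra.
have [k k0 decay] := lyap_neg_decay M4.
have V0 : (lyap_neg (X s) (r s) - 16) @[s --> +oo] --> 0.
  apply: (@exp_decay R (fun s => lyap_neg (X s) (r s) - 16) (fun s =>
    - (lyap_neg (X s) (r s) * rate_neg (X s) (r s) / (X s * (1 + X s)))) k k0) => s s0.
  - have [Xs rs] := pos s s0; have [dX dr] := orb s s0.
    have d1 := lyap_neg_derive (lt0r_neq0 Xs) (lt0r_neq0 (addr_gt0 ltr01 Xs)) (ltr0_neq0 rs) dX dr.
    apply: (is_derive_eq (deriveD_fun d1 (derive_cst_fun (- 16) s))).
    by rewrite addr0.
  - by have [Xs rs] := pos s s0; rewrite subr_ge0 lyap_neg_ge16.
  - by have [h1 h2] := bnd s s0; rewrite mulNr lerN2 decay.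
split=> //; split.
  apply: (cvg_of_sqr_le _ V0) => s s0; have [Xs rs] := pos s s0.
  have [/andP[_ h1] /andP[h2 _]] := bnd s s0.
  by apply: (sqr_le_lyap_neg (M := M) _ _).1; rewrite ?Xs ?rs ?h1 ?h2.
apply: (cvg_of_sqr_le _ V0) => s s0; have [Xs rs] := pos s s0.
have [/andP[_ h1] /andP[h2 _]] := bnd s s0.
by apply: (sqr_le_lyap_neg (M := M) _ _).2; rewrite ?Xs ?rs ?h1 ?h2.
Qed.

End NegativeRatio.

(** * Convergence for positive ratio *)

Section PositiveRatio.
Context {R : realType}.
Implicit Types (X r s t : R).

(** The logarithmic derivative of [r (1 + X) / (1 - r)] along the flow is
    divisible by [r]: it is [4 r (f X + r)] with
    [f X = 6 X - 9 + 1 / X + 6 / (1 + X)].  This is negative for small [r] and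
    some X slightly above 1 / 2, where [r] increases; the decreasing factor
    [(3 + 3 r) / (3 + 4 r)] makes up for it.  The function vanishes exactly on
    r = 1. *)
Definition lyap_pos X r :=
  ((1 - r) ^+ 2 * (3 + 3 * r)) / ((r * (1 + X)) ^+ 2 * (3 + 4 * r)).

(** Up to a positive factor, minus the logarithmic derivative of [lyap_pos]. *)
Definition rate_pos X r :=
  2 * (2 * X - 1) ^+ 2 * (5 * X + 3) + r * (82 * X ^+ 3 - 37 * X ^+ 2 - 20 * X + 15)
  + r ^+ 2 * (46 * X ^+ 3 - 11 * X ^+ 2 - 2 * X + 7) + 8 * r ^+ 3 * (X + X ^+ 2).

Lemma lyap_pos_derive (X r : R -> R) s : 0 < X s -> 0 < r s ->
  is_derive s 1 X (flow_X (X s) (r s)) -> is_derive s 1 r (flow_r (X s) (r s)) ->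
  is_derive s 1 (fun s => lyap_pos (X s) (r s))
    (- (lyap_pos (X s) (r s) * (4 * r s * rate_pos (X s) (r s) /
        ((1 + r s) * (3 + 4 * r s) * (X s * (1 + X s)))))).
Proof.
move=> X0 r0 dX dr; rewrite /lyap_pos.
have Xn : X s != 0 by rewrite gt_eqF.
have rn : r s != 0 by rewrite gt_eqF.
have X1 : 1 + X s != 0 by rewrite gt_eqF //; lra.
have r1 : 1 + r s != 0 by rewrite gt_eqF //; lra.
have r4 : 3 + 4 * r s != 0 by rewrite gt_eqF //; lra.
have den : (r s * (1 + X s)) ^+ 2 * (3 + 4 * r s) != 0.
  by rewrite mulf_neq0 // expf_neq0 // mulf_neq0.
have cst c := derive_cst_fun c s.
have d1 := deriveX_fun (deriveD_fun (cst 1) (deriveN_fun dr)).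
have d2 := deriveD_fun (cst 3) (deriveM_fun (cst 3) dr).
have d3 := deriveX_fun (deriveM_fun dr (deriveD_fun (cst 1) dX)).
have d4 := deriveD_fun (cst 3) (deriveM_fun (cst 4) dr).
apply: (is_derive_eq (deriveM_fun (deriveM_fun d1 d2) (deriveV_fun (deriveM_fun d3 d4) den))).
rewrite /flow_X /flow_r /rate_pos; field.
by rewrite X1 r1 r4 Xn rn.
Qed.

(** All coefficients as a polynomial in [r] are nonnegative for X > 0, and that of
    [r] is at least 1; each cubic in X is a square times a positive factor, plus
    a positive remainder. *)
Lemma rate_pos_ge X r : 0 < X -> 0 < r -> r <= rate_pos X r.
Proof.
move=> X0 r0; have sq (z w : R) : 0 <= w -> 0 <= z ^+ 2 * w.
  by move=> ?; rewrite mulr_ge0 ?sqr_ge0.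
have h1 : 0 <= (2 * X - 1) ^+ 2 * (5 * X + 3) by apply: sq; lra.
have h2 : 1 <= 82 * X ^+ 3 - 37 * X ^+ 2 - 20 * X + 15.
  have := sq (X - 1 / 2) (82 * X + 45).
  have -> : 82 * X ^+ 3 - 37 * X ^+ 2 - 20 * X + 15
    = 1 + (X - 1 / 2) ^+ 2 * (82 * X + 45) + 9 / 2 * X + 11 / 4 by field.
  by lra.
have h3 : 0 <= 46 * X ^+ 3 - 11 * X ^+ 2 - 2 * X + 7.
  have := sq (X - 1 / 4) (46 * X + 12).
  have -> : 46 * X ^+ 3 - 11 * X ^+ 2 - 2 * X + 7
    = (X - 1 / 4) ^+ 2 * (46 * X + 12) + 9 / 8 * X + 25 / 4 by field.
  by lra.
have h4 : 0 <= r ^+ 3 * (X + X ^+ 2).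
  by rewrite mulr_ge0 ?exprn_ge0 ?(ltW r0) // addr_ge0 ?sqr_ge0 // ltW.
have h5 := sq r _ h3.
have h6 : r * 1 <= r * (82 * X ^+ 3 - 37 * X ^+ 2 - 20 * X + 15).
  by rewrite ler_wpM2l // ltW.
by rewrite /rate_pos; lra.
Qed.

(** The next four estimates confine an orbit: r cannot increase above 1, then
    [X (2 r + 1)] cannot increase where X >= 4, X cannot decrease near 0, and
    [lyap_pos] blows up as r tends to 0 with X bounded. *)
Lemma flow_r_le0 X r : 0 < X -> 1 < r -> flow_r X r <= 0.
Proof.
move=> X0 r1; rewrite /flow_r -mulrA -(pmulr_rle0 _ X0).
have -> : X * (4 * r * ((1 - r) * ((2 + r) * (2 * X - 1) + r / X)))
    = - (4 * r * (r - 1) * ((2 + r) * (2 * X ^+ 2 - X) + r)).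
  by field; rewrite gt_eqF.
rewrite oppr_le0 mulr_ge0 ?mulr_ge0 //; [lra|lra|].
have -> : (2 + r) * (2 * X ^+ 2 - X) + r
  = (r - 1) * (2 * (X - 1 / 4) ^+ 2 + 7 / 8) + (6 * (X - 1 / 4) ^+ 2 + 5 / 8) by field.
have h := sqr_ge0 (X - 1 / 4).
by rewrite addr_ge0 ?mulr_ge0 //; lra.
Qed.

Lemma weighted_X_le0 X r : 4 <= X -> 0 < r ->
  flow_X X r * (2 * r + 1) + X * (2 * flow_r X r) <= 0.
Proof.
move=> X4 r0; have Xn : X != 0 by rewrite gt_eqF //; lra.
have -> : flow_X X r * (2 * r + 1) + X * (2 * flow_r X r)
  = - (16 * ((1 - r) ^+ 2 * ((1 + r) * (X * (X - 4)))) + 2 * ((1 + r) * (X - 4))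
    + X * ((r - 1) ^+ 2 * (48 * r + 52) + 38 * r + 18)
    + 4 * r ^+ 2).
  by rewrite /flow_X /flow_r; field.
have h1 : 0 <= (1 + r) * (X - 4) by rewrite mulr_ge0 //; lra.
have h2 : 0 <= (1 - r) ^+ 2 * ((1 + r) * (X * (X - 4))).
  by rewrite mulr_ge0 ?sqr_ge0 // mulrCA mulr_ge0 //; lra.
have h3 : 0 <= (r - 1) ^+ 2 * (48 * r + 52) by apply: mulr_ge0; [exact: sqr_ge0 | lra].
have h4 : 0 <= X * ((r - 1) ^+ 2 * (48 * r + 52) + 38 * r + 18).
  apply: mulr_ge0; first by lra.
  by apply: addr_ge0; [apply: addr_ge0; [exact: h3 | lra] | lra].
rewrite oppr_le0; apply: addr_ge0; last by apply: mulr_ge0; [lra | exact: sqr_ge0].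
by apply: addr_ge0; [apply: addr_ge0; apply: mulr_ge0; [lra | | lra |] | exact: h4].
Qed.

Lemma flow_X_ge0 X r (B : R) : 0 < X -> X * (16 * B + 16) <= 1 -> 0 < r <= B ->
  0 <= flow_X X r.
Proof.
move=> X0 hX /andP[r0 rB]; rewrite /flow_X.
have h1 : X * r <= X * B by rewrite ler_wpM2l // ltW.
have h2 : 0 <= X * r by rewrite mulr_ge0 // ltW.
have X1 : X <= 1 by lra.
have h3 : X ^+ 2 <= X by rewrite expr2 ler_piMr // ltW.
have h4 : 0 <= X ^+ 2 * r by rewrite mulr_ge0 ?sqr_ge0 // ltW.
have h5 : 0 <= X * r ^+ 2 by rewrite mulr_ge0 ?sqr_ge0 // ltW.
have h6 := sqr_ge0 (r - 1).
have -> : 16 * (r - 1) * X ^+ 2 + (4 * r ^+ 2 - 16 * r - 8) * X + (8 - 8 * r + 4 * r ^+ 2)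
  = 16 * (X ^+ 2 * r) - 16 * X ^+ 2 + 4 * (X * r ^+ 2) - 16 * (X * r) - 8 * X
    + 4 * (r - 1) ^+ 2 + 4 by ring.
by lra.
Qed.

Lemma lyap_pos_lower X r (H U : R) : 0 < X -> X <= H -> 0 < r -> 0 <= U ->
  lyap_pos X r <= U -> (4 * (2 + H) * (1 + U))^-1 <= r.
Proof.
move=> X0 XH r0 U00 UU.
rewrite leNgt; apply/negP => rc.
pose D := 4 * (2 + H) * (1 + U).
have D0 : 0 < D by rewrite !mulr_gt0 //; lra.
have rD : r * D < 1 by rewrite -ltr_pdivlMr // div1r.
have D8 : 8 <= D.
  have -> : 8 = 8 * 1 :> R by rewrite mulr1.
  by apply: ler_pM => //; lra.
have r8 : r * 8 < 1.
  by apply: le_lt_trans rD; rewrite ler_wpM2l // ltW.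
pose z := r * (1 + X).
have z0 : 0 <= z by apply: mulr_ge0; lra.
have zU : z * (1 + U) <= 1 / 4.
  have : z * (4 * (1 + U)) <= r * D.
    have -> : r * D = r * (2 + H) * (4 * (1 + U)) by rewrite /D; ring.
    apply: ler_wpM2r; first by lra.
    by apply: ler_wpM2l; lra.
  by lra.
have zU0 : 0 <= z * U by rewrite mulr_ge0.
have zU1 : z + z * U <= 1 / 4 by move: zU; rewrite mulrDr mulr1.
have z4 : z <= 1 / 4 by apply: le_trans zU1; rewrite lerDl.
have zz : z * U * z <= 1 / 4 * (1 / 4).
  by apply: ler_pM => //; apply: le_trans zU1; rewrite lerDr.
have den : 0 < z ^+ 2 * (3 + 4 * r).
  rewrite mulr_gt0 ?exprn_gt0 //; last by lra.
  by apply: mulr_gt0; lra.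
move: UU; rewrite /lyap_pos -/z ler_pdivrMr //.
have -> : U * (z ^+ 2 * (3 + 4 * r)) = z * U * z * (3 + 4 * r) by ring.
have h1 : z * U * z * (3 + 4 * r) <= 1 / 4 * (1 / 4) * 4.
  by apply: ler_pM => //; [apply: mulr_ge0 | lra | lra].
have h2 : 7 / 8 * (7 / 8) * 3 <= (1 - r) ^+ 2 * (3 + 3 * r).
  by rewrite expr2; apply: ler_pM; [lra|lra|apply: ler_pM; lra|lra].
by move=> UU; move: (le_trans h2 (le_trans UU h1)); lra.
Qed.

Lemma lyap_pos_ge0 X r : 0 < r -> 0 <= lyap_pos X r.
Proof.
move=> r0; rewrite /lyap_pos divr_ge0 // mulr_ge0 ?sqr_ge0 //; lra.
Qed.

Lemma lyap_pos_rate X r (H B c : R) : 0 < X -> X <= H -> 0 < c -> c <= r -> r <= B ->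
  4 * c ^+ 2 / ((1 + B) * (3 + 4 * B) * (H * (1 + H)))
  <= 4 * r * rate_pos X r / ((1 + r) * (3 + 4 * r) * (X * (1 + X))).
Proof.
move=> X0 XH c0 cr rB; have r0 : 0 < r by lra.
have pos (z : R) : 0 < z -> forall y : R, 0 < y -> 0 < (1 + z) * (3 + 4 * z) * (y * (1 + y)).
  by move=> z0 y y0; rewrite !mulr_gt0 //; lra.
have B0 : 0 < B by lra.
have H0 : 0 < H by lra.
apply: ler_pM.
- by apply: mulr_ge0 => //; exact: sqr_ge0.
- by rewrite invr_ge0 ltW // pos.
- rewrite -mulrA; apply: ler_wpM2l => //; rewrite expr2.
  have := rate_pos_ge X0 r0; move: (rate_pos X r) => rho h.
  by apply: ler_pM => //; lra.
rewrite lef_pV2 ?posrE ?pos //.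
apply: ler_pM; [by apply: mulr_ge0; lra | by apply: mulr_ge0; lra | |].
  by apply: ler_pM; lra.
by apply: ler_pM; lra.
Qed.

Lemma sqr_le_lyap_pos X r (H B : R) : 0 < X -> X <= H -> 0 < r -> r <= B ->
  (r - 1) ^+ 2 <= (B * (1 + H)) ^+ 2 * (4 / 3) * lyap_pos X r.
Proof.
move=> X0 XH r0 rB.
have den : 0 < (r * (1 + X)) ^+ 2 * (3 + 4 * r).
  by rewrite mulr_gt0 ?exprn_gt0 ?mulr_gt0 //; lra.
rewrite /lyap_pos mulrA ler_pdivlMr //.
have -> : (r - 1) ^+ 2 = (1 - r) ^+ 2 by ring.
have h1 : (r * (1 + X)) ^+ 2 <= (B * (1 + H)) ^+ 2.
  rewrite ler_pXn2r // ?nnegrE; first by apply: ler_pM; lra.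
    by apply: mulr_ge0; lra.
  by apply: mulr_ge0; lra.
have -> : (B * (1 + H)) ^+ 2 * (4 / 3) * ((1 - r) ^+ 2 * (3 + 3 * r))
  = (1 - r) ^+ 2 * ((B * (1 + H)) ^+ 2 * (4 + 4 * r)) by field.
apply: ler_wpM2l; first exact: sqr_ge0.
by apply: ler_pM => //; [exact: sqr_ge0 | lra | lra].
Qed.

(** At r = 1 the equation for X is [X' = 4 - 20 X]; the error term is a multiple
    of [r - 1], absorbed into half of the decay rate 40 and a multiple of
    [lyap_pos]. *)
Lemma flow_X_decay X r (H B : R) : 0 < X -> X <= H -> 0 < r -> r <= B ->
  2 * (X - 5^-1) * flow_X X r <= - 20 * (X - 5^-1) ^+ 2 +
    (16 * H ^+ 2 + 4 * (B + 3) * H + 4 * (B + 1)) ^+ 2 / 20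
      * ((B * (1 + H)) ^+ 2 * (4 / 3)) * lyap_pos X r.
Proof.
move=> X0 XH r0 rB.
pose T := 16 * X ^+ 2 + 4 * (r - 3) * X + 4 * (r - 1).
pose T0 := 16 * H ^+ 2 + 4 * (B + 3) * H + 4 * (B + 1).
have TT : T ^+ 2 <= T0 ^+ 2.
  have XX : 0 <= X ^+ 2 <= H ^+ 2.
    by rewrite sqr_ge0 ler_pXn2r // ?nnegrE; lra.
  have rX : 0 <= r * X <= B * H by rewrite mulr_ge0 ?ler_pM //; lra.
  have T0' : 0 <= T0 by rewrite /T0; lra.
  rewrite -ler_sqrt ?sqr_ge0 // !sqrtr_sqr (ger0_norm T0') ler_norml.
  case/andP: XX => x1 x2; case/andP: rX => x3 x4.
  by rewrite /T /T0; apply/andP; split; lra.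
have r2 := sqr_le_lyap_pos X0 XH r0 rB.
have -> : 2 * (X - 5^-1) * flow_X X r
  = - 20 * (X - 5^-1) ^+ 2 + (r - 1) ^+ 2 * T ^+ 2 / 20
    - 20 * (X - 5^-1 - (r - 1) * T / 20) ^+ 2.
  by rewrite /flow_X /T; field.
have h : (r - 1) ^+ 2 * T ^+ 2 <= (B * (1 + H)) ^+ 2 * (4 / 3) * lyap_pos X r * T0 ^+ 2.
  by apply: ler_pM => //; exact: sqr_ge0.
have h' := sqr_ge0 (X - 5^-1 - (r - 1) * T / 20).
have -> : T0 ^+ 2 / 20 * ((B * (1 + H)) ^+ 2 * (4 / 3)) * lyap_pos X r
  = (B * (1 + H)) ^+ 2 * (4 / 3) * lyap_pos X r * T0 ^+ 2 / 20 by ring.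
move: h h'; move: (_ * T0 ^+ 2) (_ ^+ 2 * T ^+ 2) ((_ - _ / 20) ^+ 2) => p q w h h'.
by rewrite -addrA lerD2l; lra.
Qed.

(** The barriers give compactness.  There [lyap_pos] decays exponentially, hence
    r tends to 1; and [V = (X - 1/5)^2 + w * lyap_pos] decays exponentially when
    the weight [w] is large enough to dominate the error in [flow_X_decay]. *)
Theorem orbit_pos X0 r0 : 0 < X0 -> 0 < r0 -> exists X r : R -> R,
  [/\ X 0 = X0, r 0 = r0, flow_orbit X r, forall s, 0 <= s -> 0 < X s /\ 0 < r s &
      X s @[s --> +oo] --> (5^-1 : R) /\ r s @[s --> +oo] --> (1 : R)].
Proof.
move=> X00 r00.
(* the confining box: m <= X <= H and c <= r <= B *)
pose B := Num.max r0 1.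
have [Br B1] : r0 <= B /\ 1 <= B by rewrite /B !le_max !lexx orbT.
pose H := Num.max (X0 * (2 * r0 + 1)) (4 * (2 * B + 1)).
have [H1 H2] : X0 * (2 * r0 + 1) <= H /\ 4 * (2 * B + 1) <= H.
  by rewrite /H !le_max !lexx orbT.
pose m := Num.min X0 (16 * B + 16)^-1.
have [m1 m2] : m <= X0 /\ m <= (16 * B + 16)^-1 by rewrite /m !ge_min !lexx orbT.
have m0 : 0 < m by rewrite /m lt_min X00 invr_gt0; lra.
pose U0 := lyap_pos X0 r0.
have U00 : 0 <= U0.
  rewrite /U0 /lyap_pos divr_ge0 // mulr_ge0 ?sqr_ge0 //; lra.
pose c := (4 * (2 + H) * (1 + U0))^-1.
have c0 : 0 < c by rewrite invr_gt0 !mulr_gt0 //; lra.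
have bounds (X r : R -> R) tau : 0 <= tau -> X 0 = X0 -> r 0 = r0 -> solution_on X r tau ->
   (forall s, 0 <= s <= tau -> 0 < X s /\ 0 < r s) ->
   [/\ m <= X tau, X tau <= H, c <= r tau & r tau <= B].
  move=> tau0 X0E r0E sol pos.
  have sub s t : 0 <= s <= tau -> 0 <= t <= s -> 0 <= t <= tau.
    by move=> /andP[_ h1] /andP[h2 h3]; rewrite h2 (le_trans h3).
  have rB s : 0 <= s <= tau -> r s <= B.
    move=> hs; apply: (@barrier R r (fun s => flow_r (X s) (r s)) B s).
    - by case/andP: hs.
    - by move=> t /(sub _ _ hs) /sol [].
    - by rewrite r0E.
    - move=> t /(sub _ _ hs) /pos [Xt _] lt; apply: flow_r_le0 => //; lra.
  have htau : 0 <= tau <= tau by rewrite tau0 lexx.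
  have [Xt rt] := pos _ htau.
  have mX : m <= X tau.
    rewrite -lerN2; apply: (@barrier R (fun s => - X s) (fun s => - flow_X (X s) (r s)) (- m) tau) => //.
    - by move=> t /sol [dX _]; exact: deriveN_fun dX.
    - by rewrite X0E lerN2.
    - move=> t ht; rewrite ltrN2 => lt; have [Xp rp] := pos t ht.
      rewrite oppr_le0; apply: (@flow_X_ge0 _ _ B) => //; last by rewrite rp rB.
      rewrite -ler_pdivlMr ?div1r; last by lra.
      by apply: le_trans m2; exact: ltW.
  have XH : X tau <= H.
    have : X tau * (2 * r tau + 1) <= H.
      apply: (@barrier R (fun s => X s * (2 * r s + 1))
        (fun s => flow_X (X s) (r s) * (2 * r s + 1) + X s * (2 * flow_r (X s) (r s))) H tau) => //.
      - move=> t /sol [dX dr].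
        have d := deriveM_fun dX (deriveD_fun (deriveM_fun (derive_cst_fun 2 t) dr) (derive_cst_fun 1 t)).
        by apply: (is_derive_eq d); ring.
      - by rewrite X0E r0E.
      - move=> t ht lt; have [Xp rp] := pos t ht; apply: weighted_X_le0 => //.
        have rBt := rB t ht; rewrite leNgt; apply/negP => X4.
        have : X t * (2 * r t + 1) <= 4 * (2 * B + 1) by apply: ler_pM; lra.
        by lra.
    apply: le_trans; rewrite ler_peMr //; lra.
  split=> //; last exact: rB.
  have UU : lyap_pos (X tau) (r tau) <= U0.
    rewrite /U0 -X0E -r0E.
    apply: (@derive_le0 R (fun s => lyap_pos (X s) (r s)) _ 0 tau tau0) => s hs.
      have [Xs rs] := pos s hs; have [dX dr] := sol s hs.
      exact: (lyap_pos_derive Xs rs dX dr).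
    have [|Xs rs] := pos s; first by case/andP: hs => *; rewrite !ltW.
    have R0 := rate_pos_ge Xs rs.
    rewrite oppr_le0 mulr_ge0 //.
      rewrite /lyap_pos divr_ge0 // mulr_ge0 ?sqr_ge0 //; lra.
    by rewrite divr_ge0 // !mulr_ge0 //; lra.
  by apply: (lyap_pos_lower Xt XH rt U00).
have [] := @confined_orbit R X0 r0 (m / 2) (H + 1) (c / 2) (B + 1).
- by lra.
- have : X0 <= X0 * (2 * r0 + 1) by rewrite ler_peMr ?(ltW X00) //; lra.
  by move=> h; apply/andP; split; lra.
- have cr : c <= r0.
    by apply: (lyap_pos_lower X00 _ r00 U00) => //; apply: le_trans H1; rewrite ler_peMr ?(ltW X00) //; lra.
  by apply/andP; split; lra.
- move=> X r tau tau0 X0E r0E sol bnd.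
  have [|b1 b2 b3 b4] := bounds X r tau tau0 X0E r0E sol.
    by move=> s /bnd [/andP[h1 _] /andP[h2 _]]; split; lra.
  by split; apply/andP; split; lra.
move=> X [r [X0E r0E orb bnd]]; exists X, r.
have pos s : 0 <= s -> 0 < X s /\ 0 < r s.
  by move=> /bnd [/andP[h1 _] /andP[h2 _]]; split; lra.
have bds s : 0 <= s -> [/\ m <= X s, X s <= H, c <= r s & r s <= B].
  move=> s0; apply: bounds => //.
    by move=> t /andP[t0 _]; exact: orb.
  by move=> t /andP[t0 _]; exact: pos.
pose k := 4 * c ^+ 2 / ((1 + B) * (3 + 4 * B) * (H * (1 + H))).
pose K := (16 * H ^+ 2 + 4 * (B + 3) * H + 4 * (B + 1)) ^+ 2 / 20
      * ((B * (1 + H)) ^+ 2 * (4 / 3)).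
have H0 : 0 < H by lra.
have k0 : 0 < k.
  by apply: divr_gt0; rewrite !mulr_gt0 ?exprn_gt0 //; lra.
have K0 : 0 <= K.
  by apply: mulr_ge0; [apply: divr_ge0 | apply: mulr_ge0]; rewrite ?sqr_ge0 //; lra.
pose w := 2 * K / k + 1.
have w0 : 1 <= w by rewrite lerDr divr_ge0 ?(ltW k0) // mulr_ge0.
have wk : 2 * K <= w * k by rewrite /w (mulrDl (2 * K / k)) divfK ?gt_eqF // mul1r lerDl ltW.
pose U s := lyap_pos (X s) (r s).
pose V s := (X s - 5^-1) ^+ 2 + w * U s.
have U_ge0 s : 0 <= s -> 0 <= U s by move=> /pos [_ rs]; exact: lyap_pos_ge0.
pose dU s := - (U s * (4 * r s * rate_pos (X s) (r s) /
        ((1 + r s) * (3 + 4 * r s) * (X s * (1 + X s))))).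
have dUk s : 0 <= s -> dU s <= - (k * U s).
  move=> s0; have [Xs rs] := pos s s0; have [b1 b2 b3 b4] := bds s s0.
  rewrite lerN2 mulrC; apply: ler_wpM2l; first exact: U_ge0.
  exact: lyap_pos_rate.
have V0 : V s @[s --> +oo] --> 0.
  pose l := Num.min 20 (k / 2).
  have [l1 l2] : l <= 20 /\ l <= k / 2 by rewrite /l !ge_min !lexx orbT.
  have l0 : 0 < l by rewrite /l lt_min; apply/andP; split; lra.
  apply: (@exp_decay R V (fun s => 2 * (X s - 5^-1) * flow_X (X s) (r s) + w * dU s) l l0) => s s0.
  - have [Xs rs] := pos s s0; have [dX dr] := orb s s0.
    have d1 := deriveX_fun (deriveD_fun dX (derive_cst_fun (- 5^-1) s)).
    have d2 := deriveM_fun (derive_cst_fun w s) (lyap_pos_derive Xs rs dX dr).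
    by apply: (is_derive_eq (deriveD_fun d1 d2)); rewrite addr0 mul0r add0r.
  - by rewrite addr_ge0 ?sqr_ge0 // mulr_ge0 ?U_ge0 //; lra.
  have [Xs rs] := pos s s0; have [b1 b2 b3 b4] := bds s s0.
  have h1 := flow_X_decay Xs b2 rs b4; rewrite -/K -/(U s) in h1.
  have h2 : w * dU s <= w * - (k * U s) by rewrite ler_wpM2l ?dUk //; lra.
  have h3 : 2 * K * U s <= w * k * U s by rewrite ler_wpM2r ?U_ge0.
  have h4 : l * (X s - 5^-1) ^+ 2 <= 20 * (X s - 5^-1) ^+ 2.
    by rewrite ler_wpM2r ?sqr_ge0.
  have h5 : l * (w * U s) <= k / 2 * (w * U s).
    by rewrite ler_wpM2r // mulr_ge0 ?U_ge0 //; lra.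
  have -> : - l * V s = - (l * (X s - 5^-1) ^+ 2 + l * (w * U s)) by rewrite /V; ring.
  move: h1 h2 h3 h4 h5.
  move: ((X s - 5^-1) ^+ 2) (2 * _ * flow_X _ _) (dU s) (U s) => z f du u.
  clearbody w k l K; move=> h1 h2 h3 h4 h5.
  have e : k / 2 * (w * u) = w * k * u / 2 by ring.
  by rewrite e in h5; lra.
split=> //; split.
  apply: (@cvg_of_sqr_le R _ V _ 1 _ V0) => s s0.
  by rewrite mul1r /V lerDl mulr_ge0 ?U_ge0 //; lra.
apply: (@cvg_of_sqr_le R _ V _ ((B * (1 + H)) ^+ 2 * (4 / 3)) _ V0) => s s0.
have [Xs rs] := pos s s0; have [b1 b2 b3 b4] := bds s s0.
apply: (le_trans (sqr_le_lyap_pos Xs b2 rs b4)).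
apply: ler_wpM2l; first by apply: mulr_ge0; [exact: sqr_ge0 | lra].
rewrite /V -/(U s); have := sqr_ge0 (X s - 5^-1); have := U_ge0 s s0.
have : U s <= w * U s by rewrite ler_peMl ?U_ge0.
by move: (U s) (w * U s) (_ ^+ 2) => u v z; lra.
Qed.

End PositiveRatio.

(** * Derivatives on a half-open time interval *)

Section OneSidedDerivatives.
Context {R : realType}.
Implicit Types (D : set R) (f : R -> R) (t l : R) (T : \bar R).

Lemma has_deriv_in_eq D f f' t l : D t -> {in D, f =1 f'} ->
  has_deriv_in D f t l -> has_deriv_in D f' t l.
Proof.
move=> Dt ff'; apply: cvg_trans; apply: near_eq_cvg.
apply: (@filterS _ (within D t^') _ D); last exact: withinT.
by move=> u Du /=; rewrite !ff' // inE.
Qed.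

Lemma has_deriv_in_is_derive D f t l : is_derive t 1 f l -> has_deriv_in D f t l.
Proof.
move=> /is_derive1_caratheodory [h [hE ch <-]].
have hD : h u @[u --> within D t^'] --> h t.
  apply: cvg_trans ch; apply: cvg_app.
  by apply: (cvg_trans (cvg_within _)); exact: (@nbhs_dnbhs R t).
apply: cvg_trans hD; apply: near_eq_cvg.
apply: (@filterS _ (within D t^') _ (fun u => u != t)).
  by move=> u ut /=; rewrite hE mulfK // subr_eq0.
by apply: filterS (@nbhs_dnbhs_neq R t) => u ut _.
Qed.

Lemma time_near T t : 0 < t -> (t%:E < T)%E -> \forall u \near t, time T u.
Proof.
move=> t0 tT; apply: filterI.
  by near=> u; apply: ltW; near: u; exact: lt_nbhsr.
case: T tT => [r| |] //=; last by move=> _; near=> u; rewrite ltry.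
by rewrite lte_fin => tr; near=> u; rewrite lte_fin; near: u; exact: lt_nbhsl.
Unshelve. all: by end_near. Qed.

Lemma is_derive_has_deriv_in T f t l : 0 < t -> (t%:E < T)%E ->
  has_deriv_in (time T) f t l -> is_derive t 1 f l.
Proof.
move=> t0 tT fl; apply/is_derive1_caratheodory.
exists (fun z => if z == t then l else (f z - f t) / (z - t)); split.
- move=> z; case: eqP => [->|/eqP zt]; first by rewrite !subrr mulr0.
  by rewrite divfK // subr_eq0.
- apply/continuous_withinNx; rewrite /= eqxx.
  have fl' : (fun u => (f u - f t) / (u - t)) @ t^' --> l.
    move=> A /fl HA; have D := @nbhs_dnbhs R t _ (time_near t0 tT).
    apply: (@filterS2 _ (t^') _ _ _ _ _ D HA) => u Du Hu; exact: Hu.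
  apply: cvg_trans fl'; apply: near_eq_cvg.
  apply: filterS (@nbhs_dnbhs_neq R t) => u ut /=.
  by rewrite (negPf ut).
- by rewrite eqxx.
Qed.

Lemma has_deriv_in_right T f l : (0 < T)%E -> has_deriv_in (time T) f 0 l ->
  f u @[u --> 0^'+] --> f 0.
Proof.
move=> T0 fl.
have q : (fun u => (f u - f 0) / (u - 0)) @ 0^'+ --> l.
  move=> A /fl /= [e /= e0 H].
  have Tnear : \forall u \near 0^'+, (u%:E < T)%E.
    case: T T0 {fl} H => [r| |] //=; last by move=> _ _; near=> u; rewrite ltry.
    by rewrite lte_fin => r0 _; near=> u; rewrite lte_fin; near: u; exact: nbhs_right_lt.
  suff : \forall u \near 0^'+, A ((f u - f 0) / (u - 0)) by [].
  near=> u; apply: H => /=.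
  - near: u; exists e => //.
  - by rewrite gt_eqF.
  - by split; [apply: ltW | near: u].
have d : (fun u : R => u - 0) @ 0^'+ --> (0 : R).
  by under eq_fun do rewrite subr0; exact: cvg_at_right_filter cvg_id.
have qd : (fun u => (f u - f 0) / (u - 0) * (u - 0) + f 0) u @[u --> 0^'+] --> l * 0 + f 0.
  by apply: cvgD; [exact: cvgM q d | exact: cvg_cst].
rewrite mulr0 add0r in qd; apply: cvg_trans qd; apply: near_eq_cvg.
apply: filterS (@nbhs_right_gt R 0) => u u0 /=.
by rewrite divfK ?subrK // subr0 gt_eqF.
Unshelve. all: by end_near. Qed.

Lemma has_deriv_in_sum (K : finType) (P : pred K) D (c : K -> R) (f : K -> R -> R) t (l : K -> R) :
  (forall i, has_deriv_in D (f i) t (l i)) ->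
  has_deriv_in D (fun u => \sum_(i | P i) c i * f i u) t (\sum_(i | P i) c i * l i).
Proof.
move=> H; rewrite /has_deriv_in.
have -> : (fun u => (\sum_(i | P i) c i * f i u - \sum_(i | P i) c i * f i t) / (u - t))
    = (fun u => \sum_(i | P i) c i * ((f i u - f i t) / (u - t))).
  apply/funext => u; rewrite -sumrB mulr_suml; apply: eq_bigr => i _.
  by rewrite -mulrBr mulrA.
elim: (index_enum K) => [|i r IH].
  rewrite big_nil; under eq_fun do rewrite big_nil; exact: cvg_cst.
rewrite big_cons; under eq_fun do rewrite big_cons; case: (P i) => //.
by apply: cvgD => //; apply: cvgMr; exact: H.
Qed.

End OneSidedDerivatives.

(** * Change of time *)

Section TimeChange.
Context {R : realType}.

(** The new time [sigma] is the inverse of a primitive [tau] of [f], which is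
    strictly increasing, and unbounded because [f >= m] eventually.  As [tau] is
    also defined slightly before 0, [sigma] has a two-sided derivative at 0. *)
Lemma time_change (f : R -> R) (m s1 : R) : continuous f -> (forall s, 0 < f s) ->
  0 < m -> 0 <= s1 -> (forall s, s1 <= s -> m <= f s) ->
  exists sigma : R -> R, [/\ sigma 0 = 0,
    forall t : R, 0 <= t -> 0 <= sigma t,
    forall t : R, 0 <= t -> is_derive t 1 sigma (f (sigma t))^-1 &
    forall s : R, 0 <= s -> exists2 t : R, 0 <= t & sigma t = s].
Proof.
move=> cf f0 m0 s10 fm; have [tau tau0 dtau] := antiderivative cf.
have ctau (a b : R) : -1 < a -> {within `[a, b], continuous tau}.
  move=> a1; apply: derivable_within_continuous => s; rewrite in_itv /= => /andP[h1 h2].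
  by have [] := dtau s (lt_le_trans a1 h1).
have incr (a b : R) : -1 < a -> a < b -> tau a < tau b.
  move=> a1 ab; apply: (@gtr0_derive1_incr _ tau a b) => //.
  - move=> s; rewrite in_itv /= => /andP[h1 h2].
    by have [] := dtau s (lt_trans a1 h1).
  - move=> s; rewrite in_itv /= => /andP[h1 h2].
    by have [_ dv] := dtau s (lt_trans a1 h1); rewrite derive1E dv.
  - exact: ctau.
have inj (a b : R) : -1 < a -> -1 < b -> tau a = tau b -> a = b.
  move=> a1 b1 ab; case: (ltgtP a b) => // h.
    by have := incr _ _ a1 h; rewrite ab ltxx.
  by have := incr _ _ b1 h; rewrite ab ltxx.
pose sigma t := xget 0 [set s | -1 < s /\ tau s = t].
have sigmaK (s : R) : -1 < s -> sigma (tau s) = s.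
  move=> s1'; rewrite /sigma; case: xgetP => [y _ [y1 ys]|/(_ s)[]//].
  exact: inj.
have onto (t : R) : 0 <= t -> exists2 s : R, 0 <= s & tau s = t.
  move=> t0; have tm0 : 0 <= t / m by rewrite divr_ge0 // ltW.
  pose b := s1 + t / m; have b0 : 0 <= b by rewrite addr_ge0.
  have tb : t <= tau b.
    have h1 : 0 <= tau s1.
      rewrite -tau0; case: (ltgtP 0 s1) s10 => // [h _|-> //].
      by apply/ltW/incr; rewrite // ltrN10.
    have h2 : tau s1 - m * s1 <= tau b - m * b.
      apply: (@derive_ge0 _ (fun s => tau s - m * s) (fun s => f s - m)).
      - by rewrite /b lerDl.
      - move=> s /andP[h _]; apply: deriveD_fun.
          by apply: dtau; lra.
        by apply: deriveN_fun; exact: is_derive_mull.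
      - by move=> s /andP[/ltW h _]; rewrite subr_ge0 fm.
    have h3 : m * b = m * s1 + t.
      by rewrite /b mulrDr mulrCA mulfV ?mulr1 // gt_eqF.
    lra.
  have [|s] := @IVT _ tau 0 b t b0 (ctau _ _ (ltrN10 _)).
    by rewrite tau0 ge_min t0 le_max tb orbT.
  by rewrite in_itv /= => /andP[s0 _] st; exists s.
exists sigma; split.
- by rewrite -[in sigma _]tau0 sigmaK // ltrN10.
- by move=> t /onto[s s0 <-]; rewrite sigmaK // (lt_le_trans _ s0) ?ltrN10.
- move=> t /onto[s s0 <-]; have sN : -1 < s by rewrite (lt_le_trans _ s0) ?ltrN10.
  rewrite sigmaK //; apply: (is_derive_inverse (f := tau)).
  + by near=> u; apply: sigmaK; near: u; exact: lt_nbhsr.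
  + near=> u; apply: (@is_derive_continuous _ _ _ (f u)); apply: dtau.
    by near: u; exact: lt_nbhsr.
  + exact: dtau.
  + by rewrite gt_eqF.
- move=> s s0; exists (tau s); last by rewrite sigmaK // (lt_le_trans _ s0) ?ltrN10.
  rewrite -tau0; case: (ltgtP 0 s) s0 => // [h _|<- //].
  by apply/ltW/incr; rewrite // ltrN10.
Unshelve. all: by end_near. Qed.

End TimeChange.

(** * The coflow in the coordinates c^2, X and r *)

Section ScaleCoordinates.
Context {R : realType}.
Implicit Types (eps X r : R) (p : scales R).

Definition fibre_ratio p := sa p ^+ 2 / sc p ^+ 2.

Definition shape_ratio eps p := eps * sb p / sa p.

(** Twice the derivative of [c^2] along the coflow. *)
Definition base_speed X r := 16 * (X + 1) + 8 * (r ^+ 2 * X + 2 * r - r ^+ 2).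

(** The three coordinates of psi are c^4, - r X c^4 and - X c^4, so this says that
    the Laplacian is the derivative of psi when [c^2] moves with speed
    [base_speed / 2] and X and r move along the rescaled field divided by c^2. *)
Lemma laplacian_coef_ratios eps p : eps * eps = 1 -> positive_scales p ->
  let X := fibre_ratio p in let r := shape_ratio eps p in let c2 := sc p ^+ 2 in
  [/\ (laplacian_coef eps p).1.1 = c2 * base_speed X r,
    (laplacian_coef eps p).1.2
      = - (c2 * (flow_X X r * r + X * flow_r X r + base_speed X r * (r * X))) &
    (laplacian_coef eps p).2 = - (c2 * (flow_X X r + base_speed X r * X))].
Proof.
move=> eps2; have [->|->] : eps = 1 \/ eps = -1.
- by move/eqP: eps2; rewrite -expr2 sqrf_eq1 => /orP[]/eqP; [left|right].
- case: p => a b c [/= a0 b0 c0]; have [an bn cn] : [/\ a != 0, b != 0 & c != 0].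
    by rewrite !gt_eqF.
  rewrite /laplacian_coef /torsion_coef /fibre_ratio /shape_ratio /flow_X /flow_r /base_speed /=.
  by split; field; rewrite ?an ?bn ?cn.
- case: p => a b c [/= a0 b0 c0]; have [an bn cn] : [/\ a != 0, b != 0 & c != 0].
    by rewrite !gt_eqF.
  rewrite /laplacian_coef /torsion_coef /fibre_ratio /shape_ratio /flow_X /flow_r /base_speed /=.
  by split; field; rewrite ?an ?bn ?cn.
Qed.

(** A system over a finite index type, as uniqueness of solutions requires. *)
Definition scale_coord eps p (i : option bool) : R :=
  if i is Some b then if b then fibre_ratio p else shape_ratio eps p else sc p ^+ 2.

Definition scale_field (i : option bool) (u : option bool -> R) : R :=
  let X := u (Some true) in let r := u (Some false) in
  match i with
  | None => base_speed X r / 2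
  | Some true => flow_X X r / u None
  | Some false => flow_r X r / u None
  end.

Lemma scale_coord_inj eps p q : eps != 0 -> positive_scales p -> positive_scales q ->
  (forall i, scale_coord eps p i = scale_coord eps q i) -> p = q.
Proof.
move=> e0 [pa pb pc] [qa qb qc] h.
have sqr_inj (a b : R) : 0 < a -> 0 < b -> a ^+ 2 = b ^+ 2 -> a = b.
  move=> a0 b0 /eqP; rewrite eqrXn2 ?ltW // => /eqP //.
have hc : sc p = sc q by apply: sqr_inj => //; exact: (h None).
have ha : sa p = sa q.
  have := h (Some true); rewrite /= /fibre_ratio hc => /divIf h'.
  by apply: sqr_inj => //; apply: h'; rewrite gt_eqF // exprn_gt0.
have hb : sb p = sb q.
  have := h (Some false); rewrite /= /shape_ratio ha => /divIf h'.
  by apply: (mulfI e0); apply: h'; rewrite gt_eqF.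
by move: ha hb hc; case: (p) => ? ? ?; case: (q) => ? ? ? /= -> -> ->.
Qed.

(** Bounded and away from the poles of [scale_field]. *)
Definition tame (m B : R) : set (option bool -> R) :=
  [set u | m <= u None /\ m <= u (Some true) /\ forall i, `|u i| <= B].

Lemma scale_field_bounded_lip m B : 0 < m -> forall i, bounded_lip (tame m B) (scale_field i).
Proof.
move=> m0.
have cb i : bounded_lip (tame m B) (fun u => u i).
  by apply: (@bounded_lip_coord _ _ _ _ B) => u [_ [_ h]]; exact: h.
have cV0 : bounded_lip (tame m B) (fun u => (u None)^-1).
  by apply: (bounded_lipV m0) => // u [].
have cV1 : bounded_lip (tame m B) (fun u => (u (Some true))^-1).
  by apply: (bounded_lipV m0) => // u [_ []].
have cc c : bounded_lip (tame m B) (fun=> c) by exact: bounded_lip_cst.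
case=> [[]|]; rewrite /scale_field /flow_X /flow_r /base_speed.
- by do ![exact: cb | exact: cc | exact: cV0 | apply: bounded_lipD | apply: bounded_lipN | apply: bounded_lipM | apply: bounded_lipX].
- by do ![exact: cb | exact: cc | exact: cV0 | exact: cV1 | apply: bounded_lipD | apply: bounded_lipN | apply: bounded_lipM].
- by do ![exact: cb | exact: cc | apply: bounded_lipD | apply: bounded_lipN | apply: bounded_lipM | apply: bounded_lipX].
Qed.

End ScaleCoordinates.

(** * Uniqueness of the coflow *)

Section CoflowEquations.
Context {R : realType} {M : manifold R 7}.
Variables (g : mfield M) (E : 'I_3 -> vfield M).
Variables (omega : 'I_3 -> efield M) (nu : efield M).
Hypothesis hS : is_three_sasakian g E.
Hypothesis hT : is_transverse_data g E omega nu.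
Variable eps : R.
Hypothesis eps2 : eps * eps = 1.
Implicit Types (D : set R) (t : R) (T : \bar R) (p : R -> scales R).

Lemma has_deriv_in_wedge n D (f : R -> ext R n) t (l theta : ext R n) K :
  (forall I, has_deriv_in D (fun u => f u I) t (l I)) ->
  has_deriv_in D (fun u => (f u /^\ theta) K) t ((l /^\ theta) K).
Proof.
move=> H; have wE (a : ext R n) : (a /^\ theta) K = \sum_(I : {set 'I_n} | I \subset K)
    (ext_sign I (K :\: I)%SET * theta (K :\: I)%SET) * a I.
  by rewrite ffunE; apply: eq_bigr => I _; rewrite -mulrA [theta _ * _]mulrC.
rewrite wE; under eq_fun do rewrite wE.
exact: has_deriv_in_sum.
Qed.

Lemma has_deriv_in_unscale D (f : R -> R) t (l v : R) : v != 0 ->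
  has_deriv_in D (fun u => v * f u) t (v * l) -> has_deriv_in D f t l.
Proof.
move=> v0 H.
have vH : v^-1 * ((v * f u - v * f t) / (u - t)) @[u --> within D (t^')] --> v^-1 * (v * l).
  by apply: cvgMr; exact: H.
rewrite mulKf // in vH; apply: cvg_trans vH; apply: near_eq_cvg; apply: nearW => u /=.
by rewrite -mulrBr mulrA mulKf.
Qed.

(** The coefficients are fixed linear combinations of the components in a chart,
    namely top coefficients of wedge products with fixed 3-forms. *)
Lemma comb4_speed D (P Q S : R -> R) t (dP dQ dS : R) k x : img k x ->
  (forall I, has_deriv_in D (fun u => comb4 g E omega nu (P u) (Q u) (S u) k x I) t
    (comb4 g E omega nu dP dQ dS k x I)) ->
  [/\ has_deriv_in D P t dP, has_deriv_in D Q t dQ & has_deriv_in D S t dS].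
Proof.
move=> kx H; have v0 := volume_neq0 hS hT kx.
pose e i := covec (E i k x *m g k x).
pose vol : ext R 7 := e 0 /^\ e 1 /^\ e 2 /^\ nu k x.
have {}v0 : vol [set: 'I_7]%SET != 0 by exact: v0.
have extract (theta : ext R 7) (c : R) (F : R -> R -> R -> R) : c != 0 ->
    (forall a b d, comb4 g E omega nu a b d k x /^\ theta = (c * F a b d) *: vol) ->
    has_deriv_in D (fun u => F (P u) (Q u) (S u)) t (F dP dQ dS).
  move=> c0 hF; apply: (has_deriv_in_unscale (mulf_neq0 c0 v0)).
  have FE a b d : (comb4 g E omega nu a b d k x /^\ theta) [set: 'I_7]%SET
      = c * vol [set: 'I_7]%SET * F a b d.
    by rewrite hF ffunE /GRing.scale /= mulrAC.
  rewrite -FE.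
  have -> : (fun u => c * vol [set: 'I_7]%SET * F (P u) (Q u) (S u))
      = (fun u => (comb4 g E omega nu (P u) (Q u) (S u) k x /^\ theta) [set: 'I_7]%SET).
    by apply/funext => u; rewrite FE.
  exact: (has_deriv_in_wedge (f := fun u => comb4 g E omega nu (P u) (Q u) (S u) k x)).
have two0 : (2 : R) != 0 by rewrite pnatr_eq0.
split.
- apply: (extract _ 1 (fun a _ _ => a) (oner_neq0 _)) => a b d.
  by rewrite mul1r; exact: (comb4_e123 hT kx).
- by apply: (extract _ 2 (fun _ b _ => b) two0) => a b d; exact: (comb4_B0 hT kx).
- by apply: (extract _ 2 (fun _ _ d => d) two0) => a b d; exact: (comb4_B2 hT kx).
Qed.

Lemma coflow_speed T p t : coflow g E omega nu eps T p -> time T t ->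
  [/\ has_deriv_in (time T) (fun u => sc (p u) ^+ 4) t (laplacian_coef eps (p t)).1.1,
    has_deriv_in (time T) (fun u => - (eps * sa (p u) * sb (p u) * sc (p u) ^+ 2)) t
      (laplacian_coef eps (p t)).1.2 &
    has_deriv_in (time T) (fun u => - (sa (p u) ^+ 2 * sc (p u) ^+ 2)) t
      (laplacian_coef eps (p t)).2].
Proof.
move=> [_ H] tT; have [pp {}H] := H t tT.
have [y _] := mfd_nonempty M; have [k ky] := dom_cover y.
have kx : img k (chart_map k y) by exists y.
apply: (comb4_speed kx) => I; have := H k _ I kx.
rewrite laplacian_comb4 //.
have psiE u := psi_comb4 g E omega nu eps (p u) k (chart_map k y).
by under eq_fun do rewrite psiE.
Qed.

(** Recovers [scale_coord] from the three coefficients of psi, which are what the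
    coflow differentiates. *)
Definition coord_of_psi (i : option bool) (P Q S : R) : R :=
  match i with
  | None => Num.sqrt P
  | Some true => - (S / P)
  | Some false => Q / S
  end.

Lemma coord_of_psiE (p : scales R) i : positive_scales p ->
  coord_of_psi i (sc p ^+ 4) (- (eps * sa p * sb p * sc p ^+ 2))
    (- (sa p ^+ 2 * sc p ^+ 2)) = scale_coord eps p i.
Proof.
case: p => a b c [/= a0 b0 c0]; have [an bn cn] : [/\ a != 0, b != 0 & c != 0].
  by rewrite !gt_eqF.
case: i => [[]|]; rewrite /scale_coord /fibre_ratio /shape_ratio /=.
- by field; rewrite cn.
- by field; rewrite ?an ?cn.
- by rewrite (exprM c 2 2) sqrtr_sqr ger0_norm // sqr_ge0.
Qed.

Lemma coflow_coord_derive T p t i : coflow g E omega nu eps T p ->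
  0 < t -> (t%:E < T)%E ->
  is_derive t 1 (fun u => scale_coord eps (p u) i)
    (scale_field i (scale_coord eps (p t))).
Proof.
move=> hp t0 tT; have ht : time T t by split; [exact: ltW | exact: tT].
have [dP dQ dS] := coflow_speed hp ht.
have {}dP := is_derive_has_deriv_in t0 tT dP.
have {}dQ := is_derive_has_deriv_in t0 tT dQ.
have {}dS := is_derive_has_deriv_in t0 tT dS.
have [_ pos] := hp; have [pt0 _] := pos t ht.
apply: (@near_eq_is_derive _ _ _ (fun u => coord_of_psi i (sc (p u) ^+ 4)
    (- (eps * sa (p u) * sb (p u) * sc (p u) ^+ 2))
    (- (sa (p u) ^+ 2 * sc (p u) ^+ 2)))).
  have := time_near t0 tT; apply: filterS => u hu.
  by rewrite coord_of_psiE //; have [] := pos u hu.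
have [] := laplacian_coef_ratios eps2 pt0.
have [a0 b0 c0] := pt0.
have [an bn cn] : [/\ sa (p t) != 0, sb (p t) != 0 & sc (p t) != 0] by rewrite !gt_eqF.
have QE : - (eps * sa (p t) * sb (p t) * sc (p t) ^+ 2)
    = - (shape_ratio eps (p t) * fibre_ratio (p t) * sc (p t) ^+ 4).
  by rewrite /fibre_ratio /shape_ratio; field; rewrite an cn.
have SE : - (sa (p t) ^+ 2 * sc (p t) ^+ 2) = - (fibre_ratio (p t) * sc (p t) ^+ 4).
  by rewrite /fibre_ratio; field.
have Xn : fibre_ratio (p t) != 0 by rewrite gt_eqF // divr_gt0 ?exprn_gt0.
have P0 : sc (p t) ^+ 4 != 0 by rewrite expf_neq0.
have S0 : - (sa (p t) ^+ 2 * sc (p t) ^+ 2) != 0 by rewrite oppr_eq0 mulf_neq0 ?expf_neq0.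
move=> LP LQ LS.
case: i => [[]|].
- apply: (is_derive_eq (deriveN_fun (deriveM_fun dS (deriveV_fun dP P0)))).
  by rewrite LP LS SE /scale_field /scale_coord; field.
- apply: (is_derive_eq (deriveM_fun dQ (deriveV_fun dS S0))).
  by rewrite LQ LS SE QE /scale_field /scale_coord; field; rewrite Xn cn.
- have Pgt : 0 < sc (p t) ^+ 4 by rewrite exprn_gt0.
  have dsqrt : is_derive t 1 (fun u => Num.sqrt (sc (p u) ^+ 4))
      ((2 * Num.sqrt (sc (p t) ^+ 4))^-1 * (laplacian_coef eps (p t)).1.1).
    exact: (is_derive1_comp (f := Num.sqrt) (g := fun u => sc (p u) ^+ 4)
      (is_derive1_sqrt Pgt) dP).
  apply: (is_derive_eq dsqrt).
  rewrite LP (exprM _ 2 2) sqrtr_sqr ger0_norm ?sqr_ge0 // /scale_field /scale_coord.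
  by field.
Qed.

Lemma coflow_coord_continuous T p b i : coflow g E omega nu eps T p ->
  0 < b -> (b%:E < T)%E ->
  {within `[0, b], continuous (fun u => scale_coord eps (p u) i)}.
Proof.
move=> hp b0 bT; have [T0 pos] := hp.
have cont t : 0 < t -> t <= b -> {for t, continuous (fun u => scale_coord eps (p u) i)}.
  move=> t0 tb; apply: is_derive_continuous; apply: (coflow_coord_derive i hp t0).
  by apply: le_lt_trans bT; rewrite lee_fin.
apply/(continuous_within_itvP _ b0); split.
- by move=> t; rewrite in_itv /= => /andP[t0 tb]; apply: cont => //; exact: ltW.
- have h0 : time T 0 by split.
  have [/(has_deriv_in_right T0) cP /(has_deriv_in_right T0) cQ /(has_deriv_in_right T0) cS]
    := coflow_speed hp h0.
  have [p00 _] := pos 0 h0; have [a0 _ c0] := p00.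
  rewrite -(coord_of_psiE i p00).
  have cc : coord_of_psi i (sc (p u) ^+ 4)
      (- (eps * sa (p u) * sb (p u) * sc (p u) ^+ 2))
      (- (sa (p u) ^+ 2 * sc (p u) ^+ 2)) @[u --> 0^'+] -->
     coord_of_psi i (sc (p 0) ^+ 4)
      (- (eps * sa (p 0) * sb (p 0) * sc (p 0) ^+ 2))
      (- (sa (p 0) ^+ 2 * sc (p 0) ^+ 2)).
    case: i {cont} => [[]|] /=.
    + by apply: cvgN; apply: cvgM => //; apply: cvgV => //; rewrite gt_eqF // exprn_gt0.
    + apply: cvgM => //; apply: cvgV => //.
      by rewrite oppr_eq0 mulf_neq0 // gt_eqF // exprn_gt0.
    + exact: cvg_comp cP (@sqrt_continuous _ _).
  apply: cvg_trans cc; apply: near_eq_cvg; near=> u.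
  rewrite coord_of_psiE //.
  have uT : time T u.
    split; first by near: u; exact: nbhs_right_ge.
    apply: lt_trans bT; rewrite lte_fin; near: u; exact: nbhs_right_lt.
  by have [] := pos u uT.
- by apply: cvg_at_left_filter; apply: cont.
Unshelve. all: by end_near. Qed.

(** Continuous functions attain their bounds on [0, b]. *)
Lemma coflow_tame T p (b : R) : coflow g E omega nu eps T p -> 0 < b -> (b%:E < T)%E ->
  exists m B : R, 0 < m /\ forall t, 0 <= t <= b -> tame m B (scale_coord eps (p t)).
Proof.
move=> hp b0 bT; have [_ pos] := hp.
have cc i := coflow_coord_continuous (i := i) hp b0 bT.
have posX t : 0 <= t <= b -> 0 < scale_coord eps (p t) None /\
    0 < scale_coord eps (p t) (Some true).
  move=> /andP[t0 tb]; have ht : time T t.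
    by split=> //; apply: le_lt_trans bT; rewrite lee_fin.
  have [[a0 _ c0] _] := pos t ht.
  by rewrite /= /fibre_ratio divr_gt0 ?exprn_gt0.
have [m1 h1 min1] := EVT_min (ltW b0) (cc None).
have [m2 h2 min2] := EVT_min (ltW b0) (cc (Some true)).
have bound i : exists B : R, forall t, 0 <= t <= b -> `|scale_coord eps (p t) i| <= B.
  have [u _ maxu] := EVT_max (ltW b0) (cc i); have [v _ minv] := EVT_min (ltW b0) (cc i).
  exists (Num.max (scale_coord eps (p u) i) (- scale_coord eps (p v) i)) => t ht.
  have ti : t \in `[0, b] by rewrite in_itv.
  by rewrite ler_norml le_max (maxu t ti) andbT lerNl le_max lerN2 (minv t ti) orbT.
have [B1 b1] := bound None; have [B2 b2] := bound (Some true).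
have [B3 b3] := bound (Some false).
exists (Num.min (scale_coord eps (p m1) None) (scale_coord eps (p m2) (Some true))).
exists (Num.max B1 (Num.max B2 B3)); split.
  by rewrite lt_min (posX m1 h1).1 (posX m2 h2).2.
move=> t ht; have ti : t \in `[0, b] by rewrite in_itv.
split; first by rewrite ge_min (min1 t ti).
split; first by rewrite ge_min (min2 t ti) orbT.
by case=> [[]|]; rewrite !le_max ?b1 ?b2 ?b3 ?orbT.
Qed.

Lemma tameW (m B m' B' : R) u : m' <= m -> B <= B' -> tame m B u -> tame m' B' u.
Proof.
by move=> hm hB [h1 [h2 h3]]; split; [|split=> [|i]]; [exact: le_trans h1|
  exact: le_trans h2|exact: le_trans (h3 i) hB].
Qed.

(** In the coordinates [scale_coord] the coflow is a system with Lipschitz right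
    side, as long as the solutions stay [tame], which they do on compact
    intervals. *)
Theorem coflow_unique T T' p p' : coflow g E omega nu eps T p ->
  coflow g E omega nu eps T' p' -> p 0 = p' 0 ->
  forall t, time T t -> time T' t -> p t = p' t.
Proof.
move=> hp hp' p00 t [t0 tT] [_ tT'].
case: (ltgtP 0 t) t0 => // [{}t0 _|<- //].
have [m [B [m0 hB]]] := coflow_tame hp t0 tT.
have [m' [B' [m'0 hB']]] := coflow_tame hp' t0 tT'.
have [[_ pos] [_ pos']] := (hp, hp').
have e0 : eps != 0.
  by apply/eqP => e0; move: eps2; rewrite e0 mul0r => /esym/eqP; rewrite oner_eq0.
have [pt _] := pos t (conj (ltW t0) tT); have [pt' _] := pos' t (conj (ltW t0) tT').
apply: (scale_coord_inj e0 pt pt').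
have mm : 0 < Num.min m m' by rewrite lt_min m0.
apply: (unique_solution (x := fun i u => scale_coord eps (p u) i)
  (y := fun i u => scale_coord eps (p' u) i) (scale_field_bounded_lip (Num.max B B') mm) (ltW t0)).
- move=> s /andP[s0 st]; have hs : 0 <= s <= t by rewrite !ltW.
  by split; [apply: tameW (hB s hs)|apply: tameW (hB' s hs)];
    rewrite ?ge_min ?le_max ?lexx ?orbT.
- move=> i s /andP[s0 st]; apply: (coflow_coord_derive i hp s0).
  by apply: lt_trans tT; rewrite lte_fin.
- move=> i s /andP[s0 st]; apply: (coflow_coord_derive i hp' s0).
  by apply: lt_trans tT'; rewrite lte_fin.
- by move=> i; exact: (coflow_coord_continuous hp).
- by move=> i; exact: (coflow_coord_continuous hp').
- by move=> i; rewrite p00.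
Qed.

End CoflowEquations.

(** * From orbits of the rescaled flow to the coflow *)

Section RescaledFlow.
Context {R : realType} {M : manifold R 7}.
Variables (g : mfield M) (E : 'I_3 -> vfield M).
Variables (omega : 'I_3 -> efield M) (nu : efield M).
Hypothesis hS : is_three_sasakian g E.
Hypothesis hT : is_transverse_data g E omega nu.
Variable eps : R.
Hypothesis eps2 : eps * eps = 1.

Lemma comb4_coord k x (I : {set 'I_7}) : exists n a b : R, forall P Q S,
  comb4 g E omega nu P Q S k x I = P * n + Q * a + S * b.
Proof.
have lin (v a b : ext R 7) P Q S :
    (P *: v + Q *: a + S *: b) I = P * v I + Q * a I + S * b I by rewrite !ffunE.
by do 3! eexists; move=> P Q S; exact: lin.
Qed.

(** The ratios X and r as functions of the rescaled time s determine everything: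
    [c^2] solves [d (c^2) / ds = c^2 * base_speed / 2], a linear equation, and the
    time t is the primitive of c^2.  That [base_speed] is eventually nonnegative
    keeps c^2 away from 0, so t runs through all of [0, +oo) and the coflow is
    immortal.  Maximality comes from uniqueness. *)
Theorem rescaled_flow_of_orbit (p0 : scales R) (X r : R -> R) (s1 : R) :
  positive_scales p0 -> flow_orbit X r ->
  X 0 = fibre_ratio p0 -> r 0 = shape_ratio eps p0 ->
  (forall s : R, 0 <= s -> 0 < X s /\ 0 < eps * r s) ->
  0 <= s1 -> (forall s, s1 <= s -> 0 <= base_speed (X s) (r s)) ->
  rescaled_flow g E omega nu eps p0 (fun s => (X s, eps * r s * X s)).
Proof.
move=> [a0 b0 c0] orb X0 r0 pos s10 Cpos.
(* clamping to nonnegative times, where the orbit is known to be regular *)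
pose h (s : R) := base_speed (X (Num.max 0 s)) (r (Num.max 0 s)) / 2.
have max0 (s : R) : 0 <= Num.max 0 s by rewrite le_max lexx.
have maxc : continuous (fun s : R => Num.max 0 s).
  apply: (@lipschitz_continuous _ 1) => s t; rewrite mul1r; exact: max_lip.
have cX : continuous (fun s : R => X (Num.max 0 s)).
  move=> s; apply: (@continuous_comp _ _ _ (fun s : R => Num.max 0 s) X); first exact: maxc.
  by apply: is_derive_continuous; exact: (orb _ (max0 s)).1.
have cr : continuous (fun s : R => r (Num.max 0 s)).
  move=> s; apply: (@continuous_comp _ _ _ (fun s : R => Num.max 0 s) r); first exact: maxc.
  by apply: is_derive_continuous; exact: (orb _ (max0 s)).2.
have ch : continuous h.
  move=> s; rewrite /h /base_speed.
  have Xs := cX s; have rs := cr s.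
  have cc (c : R) : (fun=> c) u @[u --> s] --> c by exact: cvg_cst.
  by do ![exact: Xs | exact: rs | exact: cc | apply: cvgM | apply: cvgN | apply: cvgD].
have [lam lam0 dlam] := antiderivative ch.
pose c2 s := sc p0 ^+ 2 * expR (lam s).
have c2gt s : 0 < c2 s by rewrite mulr_gt0 ?expR_gt0 ?exprn_gt0.
have dc2 (s : R) : -1 < s -> is_derive s 1 c2 (c2 s * h s).
  move=> s1'; have de := is_derive1_comp (is_derive_expR (lam s)) (dlam s s1').
  by apply: (is_derive_eq (deriveM_fun (derive_cst_fun _ s) de)); rewrite /c2 /=; ring.
have cf : continuous (fun s : R => c2 (Num.max 0 s)).
  move=> s; apply: (@continuous_comp _ _ _ (fun s : R => Num.max 0 s) c2); first exact: maxc.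
  apply: is_derive_continuous; apply: dc2; exact: lt_le_trans (ltrN10 _) (max0 s).
have maxE (s : R) : 0 <= s -> Num.max 0 s = s by move=> s0; apply/max_idPr.
have c2m (s : R) : s1 <= s -> c2 s1 <= c2 (Num.max 0 s).
  move=> ss; rewrite maxE ?(le_trans s10) //.
  apply: (derive_ge0 ss (df := fun s => c2 s * h s)) => t /andP[t1 t2].
    by apply: dc2; rewrite (lt_le_trans _ (le_trans s10 t1)) ?ltrN10.
  rewrite mulr_ge0 ?(ltW (c2gt t)) // /h maxE ?(le_trans s10 (ltW t1)) //.
  by rewrite divr_ge0 // Cpos ?ltW.
have [sigma [sigma0 sigma_ge0 dsigma sigma_onto]] :=
  time_change cf (fun s => c2gt _) (c2gt s1) s10 c2m.
(* the scales with ratios X and r and with c^2 = c2 *)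
pose p t := Scales (Num.sqrt (X (sigma t) * c2 (sigma t)))
  (eps * r (sigma t) * Num.sqrt (X (sigma t) * c2 (sigma t))) (Num.sqrt (c2 (sigma t))).
have Xc2 (t : R) : 0 <= t -> 0 < X (sigma t) * c2 (sigma t).
  by move=> t0; rewrite mulr_gt0 // (pos _ (sigma_ge0 t t0)).1.
have ppos (t : R) : 0 <= t -> positive_scales (p t).
  move=> t0; split; rewrite /= ?sqrtr_gt0 ?Xc2 //.
  by rewrite mulr_gt0 ?sqrtr_gt0 ?Xc2 // (pos _ (sigma_ge0 t t0)).2.
have sc2 (t : R) : sc (p t) ^+ 2 = c2 (sigma t) by rewrite /= sqr_sqrtr // ltW.
have fibreE (t : R) : 0 <= t -> fibre_ratio (p t) = X (sigma t).
  move=> t0; rewrite /fibre_ratio sc2 /= sqr_sqrtr ?ltW ?Xc2 //.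
  by rewrite mulfK // gt_eqF.
have shapeE (t : R) : 0 <= t -> shape_ratio eps (p t) = r (sigma t).
  move=> t0; rewrite /shape_ratio /= mulrA mulfK; last first.
    by rewrite gt_eqF // sqrtr_gt0 Xc2.
  by rewrite mulrA eps2 mul1r.
have dsig (t : R) : 0 <= t -> is_derive t 1 sigma (c2 (sigma t))^-1.
  by move=> t0; have := dsigma t t0; rewrite maxE // sigma_ge0.
have time_ge0 (t : R) : time +oo%E t -> 0 <= t by case.
have flow_p : coflow g E omega nu eps +oo%E p.
  split; first exact: ltry.
  move=> t /time_ge0 t0; split=> [|k x I kx]; first exact: ppos.
  have [n [a [b combE]]] := comb4_coord k x I.
  rewrite laplacian_comb4 ?combE //; last exact: ppos.
  have [-> -> ->] := laplacian_coef_ratios eps2 (ppos t t0).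
  rewrite fibreE // shapeE // sc2.
  pose G s := c2 s ^+ 2 * n + - (r s * X s * c2 s ^+ 2) * a + - (X s * c2 s ^+ 2) * b.
  apply: (@has_deriv_in_eq _ _ (G \o sigma)) => [|u|].
  - by split=> //; exact: ltry.
  - rewrite inE => /time_ge0 u0; rewrite psi_comb4 combE /G /comp.
    have -> : sc (p u) ^+ 4 = c2 (sigma u) ^+ 2 by rewrite (exprM _ 2 2) sc2.
    have [sa0 sb0 sc0] := ppos u u0.
    rewrite -(shapeE u u0) -(fibreE u u0) -sc2 /shape_ratio /fibre_ratio.
    by field; rewrite !gt_eqF.
  apply: has_deriv_in_is_derive.
  have s0 := sigma_ge0 t t0; have [dX dr] := orb _ s0.
  have dc : is_derive (sigma t) 1 c2 (c2 (sigma t) * h (sigma t)).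
    by apply: dc2; exact: lt_le_trans (ltrN10 _) s0.
  have dcc := deriveX_fun dc; have dXc := deriveM_fun dX dcc.
  have dG := deriveD_fun (deriveD_fun (deriveM_fun dcc (derive_cst_fun n _))
    (deriveM_fun (deriveN_fun (deriveM_fun (deriveM_fun dr dX) dcc)) (derive_cst_fun a _)))
    (deriveM_fun (deriveN_fun dXc) (derive_cst_fun b _)).
  apply: (is_derive_eq (is_derive1_comp (f := G) dG (dsig t t0))).
  rewrite /h maxE //; move: (base_speed _ _) (flow_X _ _) (flow_r _ _) => C FX Fr.
  by field; rewrite gt_eqF.
have p00 : p 0 = p0.
  rewrite /p sigma0 X0 r0 /c2 lam0 expR0 mulr1 /fibre_ratio /shape_ratio.
  move: a0 b0 c0; case: (p0) => a b c /= a0 b0 c0.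
  rewrite divfK ?expf_neq0 ?gt_eqF // !sqrtr_sqr !ger0_norm ?ltW //.
  by congr Scales; rewrite mulrA mulrA eps2 mul1r divfK // gt_eqF.
exists +oo%E, p, sigma; split=> //.
- split=> // T' p' hp' p'0; split=> [|t tT']; first exact: leey.
  apply/esym; apply: (coflow_unique hS hT eps2 flow_p hp') => //; first by rewrite p00.
  by case: tT' => t0 _; split=> //; exact: ltry.
- move=> t /time_ge0 t0; rewrite sc2; apply: has_deriv_in_is_derive; exact: dsig.
- move=> s s0; have [t t0 ts] := sigma_onto s s0; exists t => //.
  by split=> //; exact: ltry.
- move=> t /time_ge0 t0; rewrite -fibreE // /ratios; congr pair.
  rewrite -shapeE // /fibre_ratio /shape_ratio.
  have [sa0 sb0 sc0] := ppos t t0.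
  transitivity (eps * eps * (sa (p t) * sb (p t) / sc (p t) ^+ 2)).
    by field; rewrite !gt_eqF.
  by rewrite eps2 mul1r.
Qed.

End RescaledFlow.

(** * Nearly parallel structures, convergence and stability *)

Section NearlyParallel.
Context {R : realType} {M : manifold R 7}.
Variables (g : mfield M) (E : 'I_3 -> vfield M).
Variables (omega : 'I_3 -> efield M) (nu : efield M).
Hypothesis hS : is_three_sasakian g E.
Hypothesis hT : is_transverse_data g E omega nu.
Implicit Types (eps : R) (p q : scales R).

Lemma scale_psi eps p (lambda : R) k x : lambda *: psi g E omega nu eps p k x
  = comb4 g E omega nu (lambda * sc p ^+ 4)
      (lambda * - (eps * sa p * sb p * sc p ^+ 2))
      (lambda * - (sa p ^+ 2 * sc p ^+ 2)) k x.
Proof. by rewrite psi_comb4 /comb4 !scalerDr !scalerA. Qed.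

(** Comparing the coefficients of [d phi = lambda psi] gives
    [lambda c^2 = 4 (2 a + eps b)], [c^2 = 3 a^2 + 2 eps a b] and
    [a (a - b) (a + b) = 0]. *)
Lemma nearly_parallel_scales eps p : eps * eps = 1 -> positive_scales p ->
  nearly_parallel g E omega nu eps p <->
  sb p = sa p /\ sc p ^+ 2 = (3 + 2 * eps) * sa p ^+ 2.
Proof.
move=> eps2 [a0 b0 c0].
have [an bn cn] : [/\ sa p != 0, sb p != 0 & sc p != 0] by rewrite !gt_eqF.
have eps0 : eps != 0.
  by apply/eqP => e0; move: eps2; rewrite e0 mul0r => /esym/eqP; rewrite oner_eq0.
split=> [[lambda _ npE]|[ba c2]].
- have [y _] := mfd_nonempty M; have [k ky] := dom_cover y.
  have kx : img k (chart_map k y) by exists y.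
  have := npE k _ kx; rewrite (d_phi hS hT) // scale_psi.
  move=> /(comb4_inj hS hT kx); case: p a0 b0 c0 an bn cn {npE} => a b c /= a0 b0 c0 an bn cn.
  case=> e1 e2 e3.
  have l2 : lambda * c ^+ 2 = 4 * (2 * a + eps * b).
    apply: (mulfI (_ : c ^+ 2 != 0)); first by rewrite expf_neq0.
    by transitivity (lambda * c ^+ 4); [ring | rewrite -e1; ring].
  have c2 : c ^+ 2 = 3 * a ^+ 2 + 2 * eps * a * b.
    have h : 2 * (a ^+ 2 + c ^+ 2) = a * (4 * (2 * a + eps * b)).
      rewrite -l2; apply: (mulfI (_ : - (eps * b) != 0)); first by rewrite oppr_eq0 mulf_neq0.
      by transitivity (- 2 * eps * b * (a ^+ 2 + c ^+ 2)); [ring | rewrite e2; ring].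
    lra.
  have ab : a = b.
    have h : 2 * (eps * a ^+ 2 * b + 2 * a * c ^+ 2 - eps * b * c ^+ 2)
        = a ^+ 2 * (4 * (2 * a + eps * b)).
      by rewrite -l2; apply: oppr_inj; rewrite -mulNr e3; ring.
    have : 4 * a * ((a - b) * (a + b)) = 0.
      transitivity (4 * a * (a ^+ 2 - eps * eps * b ^+ 2)); first by rewrite eps2; ring.
      transitivity (2 * (eps * a ^+ 2 * b + 2 * a * (3 * a ^+ 2 + 2 * eps * a * b)
        - eps * b * (3 * a ^+ 2 + 2 * eps * a * b)) - a ^+ 2 * (4 * (2 * a + eps * b))).
        by ring.
      by rewrite -c2 h subrr.
    move=> /eqP; rewrite !mulf_eq0 pnatr_eq0 (negPf an) /= subr_eq0 => /orP[/eqP //|].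
    by rewrite gt_eqF // addr_gt0.
  by split=> //; rewrite c2 -ab; ring.
- exists (4 * (2 + eps) * sa p / sc p ^+ 2).
    rewrite !mulf_neq0 ?invr_neq0 ?expf_neq0 ?pnatr_eq0 //.
    apply/eqP => h; have e : eps = -2 by lra.
    by move: eps2; rewrite e; lra.
  move=> k x kx; rewrite (d_phi hS hT) // scale_psi.
  move: ba c2 an cn {bn a0 b0 c0}; case: p => a b c /= -> c2 an cn.
  congr (comb4 _ _ _ _ _ _ _ k x).
  + by field.
  + transitivity (- 2 * eps * a * (a ^+ 2 + (3 + 2 * eps) * a ^+ 2)); first by rewrite c2.
    by field.
  + transitivity (- 2 * (eps * a ^+ 3 + (2 - eps) * a * ((3 + 2 * eps) * a ^+ 2))).
      by rewrite -c2; ring.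
    transitivity (- 2 * a ^+ 3 * (eps + 6 + eps - 2 * (eps * eps))); first by ring.
    by rewrite eps2; field.
Qed.

Theorem nearly_parallel_multiple eps p q : eps * eps = 1 ->
  sb q = sa q -> sc q = 1 -> 0 < sa q -> (3 + 2 * eps) * sa q ^+ 2 = 1 ->
  positive_scales p ->
  nearly_parallel g E omega nu eps p <->
  exists2 mu : R, 0 < mu & p = Scales (mu * sa q) (mu * sb q) (mu * sc q).
Proof.
move=> eps2 qb qc qa qE ppos; rewrite (nearly_parallel_scales eps2 ppos) qb qc.
case: ppos => a0 b0 c0; split=> [[ba c2]|[mu _ ->]] /=.
- have a_def : sa p = sc p * sa q.
    apply/eqP; rewrite -(@eqrXn2 _ 2) ?mulr_ge0 ?ltW //; apply/eqP.
    by rewrite exprMn c2 mulrAC qE mul1r.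
  exists (sc p) => //; rewrite mulr1 -a_def; move: ba.
  by case: (p) => a b c /= ->.
- by split=> //; rewrite [in RHS]exprMn [RHS]mulrCA qE !mulr1.
Qed.

End NearlyParallel.

Section Convergence.
Context {R : realType} {M : manifold R 7}.
Variables (g : mfield M) (E : 'I_3 -> vfield M).
Variables (omega : 'I_3 -> efield M) (nu : efield M).
Hypothesis hS : is_three_sasakian g E.
Hypothesis hT : is_transverse_data g E omega nu.
Implicit Types (eps : R) (p q : scales R).

(** At the limit point [base_speed] is positive, so it is eventually nonnegative
    along the orbit, as the construction of the coflow requires. *)
Lemma converges_of_orbit eps p0 q (X r : R -> R) (X1 r1 : R) :
  eps * eps = 1 -> positive_scales p0 -> flow_orbit X r ->
  X 0 = fibre_ratio p0 -> r 0 = shape_ratio eps p0 ->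
  (forall s : R, 0 <= s -> 0 < X s /\ 0 < eps * r s) ->
  X s @[s --> +oo] --> X1 -> r s @[s --> +oo] --> r1 ->
  0 < base_speed X1 r1 -> ratios q = (X1, eps * r1 * X1) ->
  converges_after_rescaling g E omega nu eps p0 q.
Proof.
move=> eps2 p0pos orb X0 r0 pos cX cr C1 qE; rewrite /converges_after_rescaling qE.
have cc (c : R) : (fun=> c) s @[s --> +oo] --> c by exact: cvg_cst.
have cC : base_speed (X s) (r s) @[s --> +oo] --> base_speed X1 r1.
  rewrite /base_speed; apply: cvgD.
    by apply: cvgM => //; apply: cvgD.
  apply: cvgM => //; apply: cvgD; last by apply: cvgN; exact: cvgM.
  by apply: cvgD; [apply: cvgM => //; exact: cvgM | exact: cvgM].
have [A [_ HA]] := cvgr_gt _ cC _ C1.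
pose s1 := Num.max 0 (A + 1).
exists (fun s => (X s, eps * r s * X s)).
  apply: (rescaled_flow_of_orbit hS hT eps2 (s1 := s1)) => //.
    by rewrite /s1 le_max lexx.
  move=> s; rewrite /s1 ge_max => /andP[_ As]; apply: ltW; apply: HA.
  by apply: lt_le_trans As; rewrite ltrDl.
have cY : eps * r s * X s @[s --> +oo] --> eps * r1 * X1.
  by apply: cvgM => //; exact: cvgM.
by have h := cvg_pair cX cY; exact: h.
Qed.

Lemma ratios_np : ratios (@np R) = (5^-1, 1 * 1 * 5^-1).
Proof.
have h : (Num.sqrt 5)^-1 * (Num.sqrt 5)^-1 = 5^-1 :> R by rewrite -invfM -expr2 sqr_sqrtr.
by rewrite /ratios /= expr2 h expr1n divr1 !mul1r.
Qed.

Lemma ratios_ts : ratios (@ts R) = (1, - 1 * - 1 * 1).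
Proof. by rewrite /ratios /= !expr1n !mulr1 divr1 mulrNN mulr1. Qed.

Lemma shape_ratio_gt0 p : positive_scales p -> 0 < shape_ratio 1 p.
Proof. by case=> a0 b0 _; rewrite /shape_ratio mul1r divr_gt0. Qed.

Lemma shape_ratio_lt0 p : positive_scales p -> shape_ratio (- 1) p < 0.
Proof. by case=> a0 b0 _; rewrite /shape_ratio mulN1r mulNr oppr_lt0 divr_gt0. Qed.

Lemma fibre_ratio_gt0 p : positive_scales p -> 0 < fibre_ratio p.
Proof. by case=> a0 _ c0; rewrite /fibre_ratio divr_gt0 ?exprn_gt0. Qed.

Theorem converges_np p0 : positive_scales p0 ->
  converges_after_rescaling g E omega nu 1 p0 np.
Proof.
move=> p0pos; have [X [r [X0 r0 orb pos [cX cr]]]] :=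
  orbit_pos (fibre_ratio_gt0 p0pos) (shape_ratio_gt0 p0pos).
apply: (converges_of_orbit (mulr1 1) p0pos orb X0 r0 _ cX cr _ ratios_np).
  by move=> s /pos[Xs rs]; rewrite mul1r.
by rewrite /base_speed; lra.
Qed.

Theorem converges_ts p0 : positive_scales p0 ->
  converges_after_rescaling g E omega nu (- 1) p0 ts.
Proof.
move=> p0pos; have [X [r [X0 r0 orb pos [cX cr]]]] :=
  orbit_neg (fibre_ratio_gt0 p0pos) (shape_ratio_lt0 p0pos).
have sqrN1 : - 1 * - 1 = 1 :> R by rewrite mulrNN mulr1.
apply: (converges_of_orbit sqrN1 p0pos orb X0 r0 _ cX cr _ ratios_ts).
  by move=> s /pos[Xs rs]; rewrite mulN1r oppr_gt0.
by rewrite /base_speed; lra.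
Qed.

(** A zero of the rescaled field is a constant orbit. *)
Lemma critical_of_rest eps q (X1 r1 : R) : eps * eps = 1 -> positive_scales q ->
  flow_X X1 r1 = 0 -> flow_r X1 r1 = 0 -> 0 < X1 -> 0 < eps * r1 ->
  0 < base_speed X1 r1 -> X1 = fibre_ratio q -> r1 = shape_ratio eps q ->
  ratios q = (X1, eps * r1 * X1) -> critical_point g E omega nu eps q.
Proof.
move=> eps2 qpos fX fr X10 r10 C1 X1E r1E qE; rewrite /critical_point qE.
apply: (@rescaled_flow_of_orbit _ _ g E omega nu hS hT eps eps2 q (fun=> X1) (fun=> r1) 0) => //.
- by move=> s _; rewrite fX fr; split; exact: is_derive_cst.
- by move=> s _; exact: ltW.
Qed.

Lemma np_pos : positive_scales (@np R).
Proof. by split; rewrite /= ?invr_gt0 ?sqrtr_gt0 //. Qed.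

Lemma ts_pos : positive_scales (@ts R).
Proof. by split=> /=. Qed.

(** Convergence holds from every initial structure, a fortiori from those near the
    critical point. *)
Theorem stable_np : dynamically_stable g E omega nu 1 np.
Proof.
split; last first.
  exists ([set: R], [set: R]); first by split; exact: filterT.
  by move=> z _ p0 p0pos _; exact: converges_np.
apply: (critical_of_rest (X1 := 5^-1) (r1 := 1)); rewrite ?mulr1 ?invr_gt0 //.
- exact: np_pos.
- by rewrite /flow_X; lra.
- by rewrite /flow_r subrr mulr0 mul0r.
- by rewrite /base_speed; lra.
- by rewrite /fibre_ratio /= expr1n divr1 exprVn sqr_sqrtr.
- by rewrite /shape_ratio /= mul1r divff // invr_eq0 gt_eqF // sqrtr_gt0.
- by rewrite ratios_np mulr1.
Qed.

Theorem stable_ts : dynamically_stable g E omega nu (- 1) ts.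
Proof.
split; last first.
  exists ([set: R], [set: R]); first by split; exact: filterT.
  by move=> z _ p0 p0pos _; exact: converges_ts.
have sqrN1 : - 1 * - 1 = 1 :> R by rewrite mulrNN mulr1.
apply: (critical_of_rest (X1 := 1) (r1 := - 1) sqrN1 ts_pos); rewrite ?sqrN1 //.
- by rewrite /flow_X; ring.
- by rewrite /flow_r; field.
- by rewrite /base_speed; lra.
- by rewrite /fibre_ratio /= expr1n divr1.
- by rewrite /shape_ratio /= mulr1 divr1.
- by rewrite ratios_ts sqrN1.
Qed.

End Convergence.

Theorem theorem1p1 (R : realType) (M : manifold R 7) (g : mfield M)
    (E : 'I_3 -> vfield M) (omega : 'I_3 -> efield M) (nu : efield M) :
  is_three_sasakian g E ->
  is_transverse_data g E omega nu ->
  (forall eps : R, eps = 1 \/ eps = - 1 ->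
     let q := if eps == 1 then np else ts in
     (forall p : scales R, positive_scales p ->
        (nearly_parallel g E omega nu eps p <->
         exists2 mu : R, 0 < mu &
           p = Scales (mu * sa q) (mu * sb q) (mu * sc q))) /\
     (forall p0 : scales R, positive_scales p0 ->
        converges_after_rescaling g E omega nu eps p0 q)) /\
  dynamically_stable g E omega nu 1 np /\
  dynamically_stable g E omega nu (- 1) ts.
Proof.
move=> hS hT; split; last by split; [exact: stable_np | exact: stable_ts].
move=> eps [->|->].
- rewrite eqxx; split=> [p ppos|p0]; last exact: converges_np.
  apply: (nearly_parallel_multiple hS hT (q := np) (mulr1 1) _ _ _ _ ppos); rewrite //=.
  by rewrite exprVn sqr_sqrtr // mulr1 -natrD divff // pnatr_eq0.
- have -> : (- 1 == 1 :> R) = false by apply/eqP => h; lra.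
  split=> [p ppos|p0]; last exact: converges_ts.
  have sqrN1 : - 1 * - 1 = 1 :> R by rewrite mulrNN mulr1.
  by apply: (nearly_parallel_multiple hS hT (q := ts) sqrN1 _ _ _ _ ppos); rewrite //=; lra.
Qed.
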